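(* Let $K$ be a finite convolution operator $(Ku)(x)=\int_{-1}^1k(x-y)u(y)\,dy$ whose kernel $k$ is one of the kernels in the list (T) of the context, and let $L$ be the corresponding differential operator in (T), which sesquicommutes with it, i.e. $\overline KL=LK$. Then $L^*L$ commutes with $K$. In particular, the eigenfunctions of $K$ are eigenfunctions of the fourth order self-adjoint differential operator $L^*L$. Moreover, if the eigenspaces of $K$ are one-dimensional, then each eigenfunction $u$ of $K$ satisfies the second order differential equation $Lu=\sigma\overline u$ for some $\sigma\in\mathbb C$.
   Context: $\overline K$ is the convolution operator on $[-1,1]$ with kernel $\overline k$. For $Lu=(bu')'+cu$ with $b(\pm1)=0$, $L^*$ is the adjoint, $L^*u=(\overline b u')'+\overline c u$. List (T): $k$ is smooth on $[-2,2]$, analytic at $0$, not identically zero near $0$, satisfies $k(-z)=\overline{k(z)}$, is nontrivial (not a finite linear combination of exponentials $e^{\alpha z}$ and not of the form $e^{\alpha z}p(z)$ with $p$ a polynomial), and, with $Lu=(bu')'+cu$, $(k,b,c)$ is one of the following (parameters real unless stated otherwise, limits taken if $\mu,\mu_1,\mu_2$ or $\gamma$ vanish in items 1 and 3): 1. $k(z)=\frac{\gamma\sinh\mu z}{\mu\sinh\gamma z}$, $b(y)=\frac{1}{2\gamma^2}[\cosh(2\gamma y)-\cosh(2\gamma)]$, $c(y)=(\gamma^2-\mu^2)b(y)+c_0$, with $\mu\in\mathbb R\cup i\mathbb R$, $c_0\in\mathbb C$. 2. $k(z)=\alpha e^{-i\mu z}+\frac{\sin\mu z}{z}$, $\alpha\ne0$,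 $b(y)=y^2-1$, $c(y)=i\mu b'(y)+\mu^2b(y)+\frac{\mu}{\alpha}$. 3. $k(z)=\frac{\sinh(2\mu_2)\sinh(\mu_1z)e^{-i\pi z/4}+\sinh(2\mu_1)\sinh(\mu_2z)e^{i\pi z/4}}{\mu_1\mu_2\sin(\pi z/2)}$, $b(y)=-\cos\frac{\pi y}{2}$, $c(y)=i\frac{\mu_2^2-\mu_1^2}{\pi}b'(y)-\left(\frac{\pi^2}{16}+\frac{\mu_1^2+\mu_2^2}{2}\right)b(y)$, with $\mu_1,\mu_2\in\mathbb R\cup i\mathbb R$; in the special case $\mu_1=i\mu$, $\mu_2=i(\mu\pm\frac\pi2)$, $\mu\in\mathbb R$, a complex multiple of $e^{-2i(\frac\pi4\pm\mu)y}$ can be added to $c$. These are taken up to multiplication of $k$ by a nonzero real constant and of $L$ by a nonzero complex constant, and up to replacing $(K,L)$ by $(MKM^{-1},M^{-1}LM^{-1})$, where $M$ is multiplication by $e^{\tau z}$ with $\tau\in i\mathbb R$ (so the kernel becomes $k(z)e^{\tau z}$). *)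

(* Defs.v *)
(* Stdlib reals with Coquelicot.  Functions of one real variable with complex
   values are total functions R -> C; only their values on [-1,1] (on [-2,2]
   for convolution kernels) are ever used. *)
From Stdlib Require Export Reals List.
From Coquelicot Require Export Coquelicot.
Export ListNotations.
Open Scope C_scope.

Definition inI (x : R) : Prop := (-1 <= x <= 1)%R.
Definition intI (x : R) : Prop := (-1 < x < 1)%R.
Definition in2I (z : R) : Prop := (-2 <= z <= 2)%R.

(** * Regularity *)

(* C^n up to the end points, i.e. the restriction to [a,b] of a function of
   class C^n on the whole line. *)
Definition Cn_on (n : nat) (a b : R) (f : R -> C) : Prop :=
  exists g : R -> C,
    (forall x : R, (a <= x <= b)%R -> g x = f x) /\
    (forall (j : nat) (x : R), (j <= n)%nat ->
       ex_derive_n (fun t => Re (g t)) j x /\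
       ex_derive_n (fun t => Im (g t)) j x /\
       continuous (Derive_n (fun t => Re (g t)) j) x /\
       continuous (Derive_n (fun t => Im (g t)) j) x).

Definition smooth_on (a b : R) (f : R -> C) : Prop :=
  forall n : nat, Cn_on n a b f.

Definition analytic_at_0 (f : R -> C) : Prop :=
  exists (a : nat -> C) (r : R), (0 < r)%R /\
    forall z : R, (Rabs z < r)%R ->
      is_pseries (K := R_AbsRing) (V := C_R_NormedModule) a z (f z).

(** * Integral and differential operators *)

Definition cRInt (f : R -> C) (a b : R) : C :=
  RInt (V := C_R_CompleteNormedModule) f a b.

Definition cDerive (f : R -> C) (x : R) : C :=
  (Derive (fun t => Re (f t)) x, Derive (fun t => Im (f t)) x).

Definition conv (k u : R -> C) (x : R) : C :=
  cRInt (fun y => k (x - y)%R * u y) (-1) 1.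

Definition cconj (f : R -> C) (x : R) : C := Cconj (f x).

Definition inner (u v : R -> C) : C := cRInt (fun y => u y * Cconj (v y)) (-1) 1.

(* Since [cDerive] uses two-sided derivatives, [diffop b c u] is meaningful in
   the open interval (-1,1) only. *)
Definition diffop (b c u : R -> C) (y : R) : C :=
  cDerive (fun t => b t * cDerive u t) y + c y * u y.

Definition diffop_adj (b c : R -> C) : (R -> C) -> (R -> C) :=
  diffop (cconj b) (cconj c).

(** * Kernels and differential operators *)

Definition cexp (w : C) : C := RtoC (exp (Re w)) * (cos (Im w), sin (Im w)).
Definition csinh (w : C) : C := (cexp w - cexp (- w)) / 2.

(* sinh(mu z)/mu, with its limit z at mu = 0. *)
Definition sinh_over (mu : C) (z : R) : C :=
  if Ceq_dec mu 0 then RtoC z else csinh (mu * z) / mu.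

Definition real_or_imaginary (mu : C) : Prop := Im mu = 0%R \/ Re mu = 0%R.

(* [cosh (2 gam y) - cosh (2 gam)] / (2 gam^2), with its limit y^2 - 1 at
   gam = 0. *)
Definition b_hyp (gam y : R) : R :=
  if Req_dec_T gam 0 then (y ^ 2 - 1)%R
  else ((cosh (2 * gam * y) - cosh (2 * gam)) / (2 * gam ^ 2))%R.

Definition b_quad (y : R) : R := (y ^ 2 - 1)%R.

Definition b_trig (y : R) : R := (- cos (PI * y / 2))%R.

(* In the three families the kernel is prescribed where the denominator of its
   formula does not vanish; the remaining values (z = 0 and, in the third
   family, also z = 2 and z = -2) are fixed by the continuity of the kernel
   required in [listT]. *)

Definition family_hyp (k b c : R -> C) : Prop :=
  exists (gam : R) (mu c0 : C), real_or_imaginary mu /\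
    (forall z : R, in2I z -> z <> 0%R ->
       k z = sinh_over mu z / sinh_over gam z) /\
    (forall y : R, b y = b_hyp gam y) /\
    (forall y : R, c y = (RtoC gam ^ 2 - mu ^ 2) * b_hyp gam y + c0).

Definition family_sinc (k b c : R -> C) : Prop :=
  exists alpha mu : R, alpha <> 0%R /\
    (forall z : R, in2I z -> z <> 0%R ->
       k z = alpha * cexp (- Ci * mu * z) + RtoC (sin (mu * z) / z)) /\
    (forall y : R, b y = b_quad y) /\
    (forall y : R, c y = Ci * mu * Derive b_quad y + RtoC mu ^ 2 * b_quad y
                         + RtoC (mu / alpha)).

(* The last summand of [c] is present only in the special case
   mu1 = i m, mu2 = i (m + s pi/2) with s = 1 or s = -1. *)
Definition family_trig (k b c : R -> C) : Prop :=
  exists mu1 mu2 : C, real_or_imaginary mu1 /\ real_or_imaginary mu2 /\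
    (forall z : R, in2I z -> sin (PI * z / 2) <> 0%R ->
       k z = (sinh_over mu2 2 * sinh_over mu1 z * cexp (- Ci * PI * z / 4)
              + sinh_over mu1 2 * sinh_over mu2 z * cexp (Ci * PI * z / 4))
             / RtoC (sin (PI * z / 2))) /\
    (forall y : R, b y = b_trig y) /\
    (exists e : R -> C,
       ((forall y : R, e y = 0) \/
        (exists (m s : R) (beta : C), (s = 1%R \/ s = (-1)%R) /\
           mu1 = Ci * m /\ mu2 = Ci * (RtoC m + s * PI / 2) /\
           forall y : R,
             e y = beta * cexp (- 2 * Ci * (PI / 4 + s * m) * y))) /\
       forall y : R,
         c y = Ci * (mu2 ^ 2 - mu1 ^ 2) / PI * Derive b_trig y
               - (RtoC PI ^ 2 / 16 + (mu1 ^ 2 + mu2 ^ 2) / 2) * b_trig y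
               + e y).

Definition exp_sum (l : list (C * C)) (z : R) : C :=
  fold_right Cplus 0 (map (fun p => fst p * cexp (snd p * z)) l).

Definition cpoly (p : list C) (z : R) : C :=
  fold_right (fun a s => a + z * s) 0 p.

Definition nontrivial_kernel (k : R -> C) : Prop :=
  ~ (exists l : list (C * C), forall z : R, in2I z -> k z = exp_sum l z) /\
  ~ (exists (alpha : C) (p : list C),
       forall z : R, in2I z -> k z = cexp (alpha * z) * cpoly p z).

(* The normalisations are k = r k0 e^{tau z} and L = kappa M^{-1} L0 M^{-1}
   with M = multiplication by e^{tau y} and tau = i t.  Expanding
     e^{-tau y} (b0 (e^{-tau y} u)')' + c0 e^{-2 tau y} u
   gives (b u')' + c u with b = e^{-2 tau y} b0 and
   c = e^{-2 tau y} (c0 - tau b0' + tau^2 b0). *)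
Definition listT (k b c : R -> C) : Prop :=
  smooth_on (-2) 2 k /\
  analytic_at_0 k /\
  (forall eps : R, (0 < eps)%R -> exists z : R, (Rabs z < eps)%R /\ k z <> 0) /\
  (forall z : R, in2I z -> k (- z)%R = Cconj (k z)) /\
  nontrivial_kernel k /\
  exists (k0 b0 c0 : R -> C) (r : R) (kappa : C) (t : R),
    (family_hyp k0 b0 c0 \/ family_sinc k0 b0 c0 \/ family_trig k0 b0 c0) /\
    r <> 0%R /\ kappa <> 0 /\
    let tau : C := Ci * t in
    (forall z : R, in2I z -> k z = r * k0 z * cexp (tau * z)) /\
    (forall y : R, inI y -> b y = kappa * (cexp (- 2 * tau * y) * b0 y)) /\
    (forall y : R, inI y ->
       c y = kappa * (cexp (- 2 * tau * y)
                      * (c0 y - tau * cDerive b0 y + tau ^ 2 * b0 y))).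

(** * Eigenfunctions *)

Definition nonzero_on_I (u : R -> C) : Prop := exists x : R, inI x /\ u x <> 0.

(* An eigenfunction for lambda <> 0 is automatically smooth.  This fails in
   general for lambda = 0, where smoothness has to be required for a
   differential operator to be applicable. *)
Definition in_eigenspace (k : R -> C) (lambda : C) (u : R -> C) : Prop :=
  Cn_on 0 (-1) 1 u /\
  (lambda = 0 -> smooth_on (-1) 1 u) /\
  forall x : R, inI x -> conv k u x = lambda * u x.

Definition eigenfunction (k : R -> C) (lambda : C) (u : R -> C) : Prop :=
  in_eigenspace k lambda u /\ nonzero_on_I u.

Definition eigenspace_le1 (k : R -> C) (lambda : C) : Prop :=
  forall u v : R -> C, eigenfunction k lambda u -> in_eigenspace k lambda v ->
    exists a : C, forall x : R, inI x -> v x = a * u x.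

Definition diff_eigenfunction (A : (R -> C) -> (R -> C)) (nu : C) (u : R -> C)
  : Prop :=
  smooth_on (-1) 1 u /\ nonzero_on_I u /\
  forall x : R, intI x -> A u x = nu * u x.

Definition orthonormal (es : list (R -> C)) : Prop :=
  List.ForallOrdPairs (fun e f => inner e f = 0) es /\
  List.Forall (fun e => inner e e = 1) es.

(* Main.v *)
Require Import Defs.
From Stdlib Require Import Lra Lia FunctionalExtensionality Classical.

(** With z = x - y and kb = conj k, sesquicommutation reduces by integration by
    parts (b vanishes at the end points) to the pointwise identity
      b(x) k''(z) + b'(x) k'(z) + c(x) k(z) = b(y) kb''(z) - b'(y) kb'(z) + c(y) kb(z).
    In each family k solves, up to elementary corrections, an equation D k = N, where
    D and N have constant-coefficient second order equations; differentiating it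
    twice and applying addition formulas to b(x) - b(y), b'(x) + b'(y) gives the
    identity without ever dividing at z = 0.  Conjugating [Kbar L = L K] yields
    [K L^* = L^* Kbar], hence [K L^* L = L^* Kbar L = L^* L K].

    For lambda <> 0 the eigenspace of K is finite dimensional by Bessel's
    inequality, and the hermitian form (L^* L u, v) is diagonalised on it.  For a
    one-dimensional eigenspace, L^* L and (as lambda is real) the antilinear map
    u |-> conj (L u) preserve it, so both act as scalars. *)

(** * Complex-valued functions of class C^n on the line *)

(** Functions matter only on [-1,1] and kernels only on [-2,2], while [cDerive] is two-sided. So
    every object is first replaced by a C^n extension to the whole line. The analysis is done there
    and carried back along equality on (-1,1), the end points being recovered by continuity. The
    extension of the kernel depends on n, so the kernel identity is proved for an arbitrary C^2
    extension; the coefficients of L come from explicit formulas valid on the whole line.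

    The formulas of the list leave k(0) open. Only its reality is used, and this follows from k(-z)
    = conj k(z) at z = 0.

    Commutation alone does not make a vector of a multiple eigenspace an eigenfunction of L^*L, so
    in general the claim about eigenfunctions takes the form of a common orthonormal basis. The
    spectral theorem behind it uses no coordinates: dimension appears only as a bound on the length
    of orthonormal lists, and eigenvectors come from maximising the quadratic form. *)

Lemma C_ext (z w : C) : Re z = Re w -> Im z = Im w -> z = w.
Proof. destruct z, w; simpl; congruence. Qed.

Ltac creal := apply C_ext; unfold Re, Im; simpl; try ring.

Definition cder (f f' : R -> C) : Prop :=
  forall x : R, is_derive (fun t => Re (f t)) x (Re (f' x)) /\
                is_derive (fun t => Im (f t)) x (Im (f' x)).

(* Class C^n on the whole line, so that no one-sided derivatives occur. *)
Fixpoint CC (n : nat) (f : R -> C) : Prop :=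
  match n with
  | O => forall x : R, continuous (fun t => Re (f t)) x /\
                       continuous (fun t => Im (f t)) x
  | S m => exists f' : R -> C, cder f f' /\ CC m f'
  end.

Definition cont_on_R (f : R -> R) : Prop := forall x, continuous f x.

Lemma cont_plus (f g : R -> R) x :
  continuous f x -> continuous g x -> continuous (fun t => (f t + g t)%R) x.
Proof. intros; now apply (continuous_plus (K := R_AbsRing) (V := R_NormedModule) f g). Qed.

Lemma cont_minus (f g : R -> R) x :
  continuous f x -> continuous g x -> continuous (fun t => (f t - g t)%R) x.
Proof. intros; now apply (continuous_minus (K := R_AbsRing) (V := R_NormedModule) f g). Qed.

Lemma cont_mult (f g : R -> R) x :
  continuous f x -> continuous g x -> continuous (fun t => (f t * g t)%R) x.
Proof. intros; now apply (continuous_mult (K := R_AbsRing) f g). Qed.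

Lemma cont_opp (f : R -> R) x : continuous f x -> continuous (fun t => (- f t)%R) x.
Proof. intros; now apply (continuous_opp (K := R_AbsRing) (V := R_NormedModule) f). Qed.

Lemma deriv_continuous (f : R -> R) x l : is_derive f x l -> continuous f x.
Proof.
  intros H; apply (ex_derive_continuous (K := R_AbsRing) (V := R_NormedModule)); now exists l.
Qed.

Lemma deriv_plus (f g : R -> R) x a b :
  is_derive f x a -> is_derive g x b -> is_derive (fun t => (f t + g t)%R) x (a + b)%R.
Proof. intros; now apply (is_derive_plus (K := R_AbsRing) (V := R_NormedModule) f g). Qed.

Lemma deriv_opp (f : R -> R) x a :
  is_derive f x a -> is_derive (fun t => (- f t)%R) x (- a)%R.
Proof. intros; now apply (is_derive_opp (K := R_AbsRing) (V := R_NormedModule) f). Qed.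

Lemma deriv_minus (f g : R -> R) x a b :
  is_derive f x a -> is_derive g x b -> is_derive (fun t => (f t - g t)%R) x (a - b)%R.
Proof. intros; now apply (is_derive_minus (K := R_AbsRing) (V := R_NormedModule) f g). Qed.

Lemma deriv_mult (f g : R -> R) x a b :
  is_derive f x a -> is_derive g x b ->
  is_derive (fun t => (f t * g t)%R) x (a * g x + f x * b)%R.
Proof.
  intros Hf Hg; apply is_derive_Reals; apply (derivable_pt_lim_mult f g);
    now apply is_derive_Reals.
Qed.

Lemma deriv_eq (f : R -> R) x a b : is_derive f x a -> a = b -> is_derive f x b.
Proof. now intros H <-. Qed.

Lemma deriv_const (a x : R) : is_derive (fun _ : R => a) x 0%R.
Proof. apply (is_derive_const (K := R_AbsRing) (V := R_NormedModule) a). Qed.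

Lemma deriv_reflect (f : R -> R) x y a :
  is_derive f (x - y)%R a -> is_derive (fun t => f (x - t)%R) y (- a)%R.
Proof.
  intros H.
  apply deriv_eq with (scal (-1)%R a); [| change ((-1) * a = - a)%R; ring].
  apply (is_derive_comp f (fun t => (x - t)%R)); [exact H|].
  auto_derive; [trivial | ring].
Qed.

Lemma deriv_shift (f : R -> R) x y a :
  is_derive f (x - y)%R a -> is_derive (fun t => f (t - y)%R) x a.
Proof.
  intros H.
  apply deriv_eq with (scal 1%R a); [| change (1 * a = a)%R; ring].
  apply (is_derive_comp f (fun t => (t - y)%R)); [exact H|].
  auto_derive; [trivial | ring].
Qed.

Lemma cder_eq (f g h : R -> C) : cder f g -> (forall x, g x = h x) -> cder f h.
Proof. intros H E x; rewrite <- E; apply H. Qed.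

Lemma cder_unique (f f' : R -> C) : cder f f' -> cDerive f = f'.
Proof.
  intros H; apply functional_extensionality; intros x; destruct (H x) as [Hr Hi].
  apply C_ext; apply is_derive_unique; assumption.
Qed.

Lemma cder_plus (f f' g g' : R -> C) :
  cder f f' -> cder g g' -> cder (fun x => f x + g x) (fun x => f' x + g' x).
Proof.
  intros Hf Hg x; destruct (Hf x), (Hg x); split;
    [apply (deriv_plus (fun t => Re (f t)) (fun t => Re (g t)))
    |apply (deriv_plus (fun t => Im (f t)) (fun t => Im (g t)))]; assumption.
Qed.

Lemma cder_opp (f f' : R -> C) : cder f f' -> cder (fun x => - f x) (fun x => - f' x).
Proof.
  intros Hf x; destruct (Hf x); split;
    [apply (deriv_opp (fun t => Re (f t)))|apply (deriv_opp (fun t => Im (f t)))]; assumption.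
Qed.

Lemma cder_minus (f f' g g' : R -> C) :
  cder f f' -> cder g g' -> cder (fun x => f x - g x) (fun x => f' x - g' x).
Proof. intros Hf Hg; apply cder_plus; [|apply cder_opp]; assumption. Qed.

Lemma cder_mult (f f' g g' : R -> C) :
  cder f f' -> cder g g' ->
  cder (fun x => f x * g x) (fun x => f' x * g x + f x * g' x).
Proof.
  intros Hf Hg x; destruct (Hf x), (Hg x); split.
  - eapply deriv_eq; [apply (deriv_minus (fun t => Re (f t) * Re (g t))%R
      (fun t => Im (f t) * Im (g t))%R); apply deriv_mult; eassumption|].
    unfold Re, Im; simpl; ring.
  - eapply deriv_eq; [apply (deriv_plus (fun t => Re (f t) * Im (g t))%R
      (fun t => Im (f t) * Re (g t))%R); apply deriv_mult; eassumption|].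
    unfold Re, Im; simpl; ring.
Qed.

Lemma cder_const (a : C) : cder (fun _ => a) (fun _ => 0).
Proof. intros x; split; apply deriv_const. Qed.

Lemma cder_scal (a : C) (f f' : R -> C) :
  cder f f' -> cder (fun x => a * f x) (fun x => a * f' x).
Proof.
  intros H; eapply cder_eq; [exact (cder_mult _ _ _ _ (cder_const a) H)|].
  intros x; simpl; ring.
Qed.

Lemma cder_conj (f f' : R -> C) : cder f f' -> cder (cconj f) (cconj f').
Proof.
  intros H x; destruct (H x); split; [assumption|].
  now apply (deriv_opp (fun t => Im (f t))).
Qed.

Lemma cder_reflect (f f' : R -> C) (x : R) :
  cder f f' -> cder (fun y => f (x - y)%R) (fun y => - f' (x - y)%R).
Proof.
  intros H y; destruct (H (x - y)%R); split;
    [apply (deriv_reflect (fun t => Re (f t)))|apply (deriv_reflect (fun t => Im (f t)))];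
    assumption.
Qed.

Lemma cder_RtoC (f f' : R -> R) :
  (forall x, is_derive f x (f' x)) -> cder (fun x => RtoC (f x)) (fun x => RtoC (f' x)).
Proof. intros H x; split; [apply H | exact (deriv_const 0 x)]. Qed.

Lemma cder_CC0 (f f' : R -> C) : cder f f' -> CC 0 f.
Proof. intros H x; destruct (H x); split; eapply deriv_continuous; eassumption. Qed.

Lemma CC_S (n : nat) : forall f, CC (S n) f -> CC n f.
Proof.
  induction n as [|n IH]; intros f [f' [H H']].
  - exact (cder_CC0 _ _ H).
  - exists f'; split; [exact H | exact (IH f' H')].
Qed.

Lemma CC_le (m n : nat) f : (m <= n)%nat -> CC n f -> CC m f.
Proof.
  induction 1 as [|n _ IH]; [easy|]. intros H; apply IH, CC_S, H.
Qed.

Lemma CC_0 (n : nat) f : CC n f -> CC 0 f.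
Proof. apply CC_le; lia. Qed.

Lemma CC_cder (n : nat) f : CC (S n) f -> cder f (cDerive f).
Proof. intros [f' [H _]]; now rewrite (cder_unique _ _ H). Qed.

Lemma CC_cDerive (n : nat) f : CC (S n) f -> CC n (cDerive f).
Proof. intros [f' [H H']]; now rewrite (cder_unique _ _ H). Qed.

Lemma CC_intro (n : nat) f f' : cder f f' -> CC n f' -> CC (S n) f.
Proof. now exists f'. Qed.

Lemma CC_plus (n : nat) : forall f g, CC n f -> CC n g -> CC n (fun x => f x + g x).
Proof.
  induction n as [|n IH]; intros f g Hf Hg.
  - intros x; destruct (Hf x), (Hg x); split;
      [apply (cont_plus (fun t => Re (f t)) (fun t => Re (g t)))
      |apply (cont_plus (fun t => Im (f t)) (fun t => Im (g t)))]; assumption.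
  - destruct Hf as [f' [Hf Hf']], Hg as [g' [Hg Hg']].
    eapply CC_intro; [apply cder_plus; eassumption | now apply IH].
Qed.

Lemma CC_opp (n : nat) : forall f, CC n f -> CC n (fun x => - f x).
Proof.
  induction n as [|n IH]; intros f Hf.
  - intros x; destruct (Hf x); split;
      [apply (cont_opp (fun t => Re (f t)))|apply (cont_opp (fun t => Im (f t)))]; assumption.
  - destruct Hf as [f' [Hf Hf']].
    eapply CC_intro; [apply cder_opp; eassumption | now apply IH].
Qed.

Lemma CC_minus (n : nat) f g : CC n f -> CC n g -> CC n (fun x => f x - g x).
Proof. intros; apply CC_plus; [|apply CC_opp]; assumption. Qed.

Lemma CC_mult (n : nat) : forall f g, CC n f -> CC n g -> CC n (fun x => f x * g x).
Proof.
  induction n as [|n IH]; intros f g Hf Hg.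
  - intros x; destruct (Hf x), (Hg x); split;
      [apply (cont_minus (fun t => Re (f t) * Re (g t))%R (fun t => Im (f t) * Im (g t))%R)
      |apply (cont_plus (fun t => Re (f t) * Im (g t))%R (fun t => Im (f t) * Re (g t))%R)];
      apply cont_mult; assumption.
  - pose proof (CC_S _ _ Hf) as Hf0; pose proof (CC_S _ _ Hg) as Hg0.
    destruct Hf as [f' [Hf Hf']], Hg as [g' [Hg Hg']].
    eapply CC_intro; [apply cder_mult; eassumption|].
    apply CC_plus; now apply IH.
Qed.

Lemma CC_const (n : nat) : forall a : C, CC n (fun _ => a).
Proof.
  induction n as [|n IH]; intros a.
  - intros x; split; apply continuous_const.
  - eapply CC_intro; [apply cder_const | apply IH].
Qed.

Lemma CC_scal (n : nat) (a : C) f : CC n f -> CC n (fun x => a * f x).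
Proof. intros; apply CC_mult; [apply CC_const | assumption]. Qed.

Lemma CC_conj (n : nat) : forall f, CC n f -> CC n (cconj f).
Proof.
  induction n as [|n IH]; intros f Hf.
  - intros x; destruct (Hf x); split; [assumption|].
    now apply (cont_opp (fun t => Im (f t))).
  - destruct Hf as [f' [Hf Hf']].
    eapply CC_intro; [apply cder_conj; eassumption | now apply IH].
Qed.

Lemma CC_reflect (n : nat) (x : R) : forall f, CC n f -> CC n (fun y => f (x - y)%R).
Proof.
  induction n as [|n IH]; intros f Hf.
  - intros y; destruct (Hf (x - y)%R) as [Hr Hi].
    assert (Hc : continuous (fun t => x - t)%R y)
      by (apply cont_minus; [apply continuous_const | apply continuous_id]).
    split; [apply (continuous_comp (fun t => x - t)%R (fun t => Re (f t)))
           |apply (continuous_comp (fun t => x - t)%R (fun t => Im (f t)))]; assumption.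
  - destruct Hf as [f' [Hf Hf']].
    eapply CC_intro; [apply cder_reflect; eassumption | apply CC_opp; now apply IH].
Qed.

Lemma cDerive_n_shift (f : R -> R) (j : nat) (x : R) :
  Derive_n (Derive f) j x = Derive_n f (S j) x.
Proof.
  change (Derive f) with (Derive_n f 1).
  rewrite Derive_n_comp. now replace (j + 1)%nat with (S j) by lia.
Qed.

Lemma CC_derive_n (n : nat) : forall f, CC n f ->
  forall (j : nat) (x : R), (j <= n)%nat ->
    ex_derive_n (fun t => Re (f t)) j x /\ ex_derive_n (fun t => Im (f t)) j x /\
    continuous (Derive_n (fun t => Re (f t)) j) x /\
    continuous (Derive_n (fun t => Im (f t)) j) x.
Proof.
  induction n as [|n IH]; intros f Hf j x Hj.
  - replace j with O by lia; exact (conj I (conj I (Hf x))).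
  - destruct j as [|j].
    + destruct (CC_0 _ _ Hf x); simpl; repeat split; assumption.
    + pose proof (CC_cder _ _ Hf) as Hd.
      destruct (IH _ (CC_cDerive _ _ Hf) j x ltac:(lia)) as (A & B & A' & B').
      change (fun t => Re (cDerive f t)) with (Derive (fun t => Re (f t))) in *.
      change (fun t => Im (cDerive f t)) with (Derive (fun t => Im (f t))) in *.
      assert (Er : Derive_n (Derive (fun t => Re (f t))) j = Derive_n (fun t => Re (f t)) (S j))
        by (apply functional_extensionality; intros; apply cDerive_n_shift).
      assert (Ei : Derive_n (Derive (fun t => Im (f t))) j = Derive_n (fun t => Im (f t)) (S j))
        by (apply functional_extensionality; intros; apply cDerive_n_shift).
      rewrite Er in A'; rewrite Ei in B'.
      repeat split; try assumption.
      * destruct j as [|j]; [exists (Re (cDerive f x)); exact (proj1 (Hd x))|].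
        simpl in A |- *. eapply ex_derive_ext; [|exact A].
        intros t; simpl; exact (cDerive_n_shift (fun t => Re (f t)) j t).
      * destruct j as [|j]; [exists (Im (cDerive f x)); exact (proj2 (Hd x))|].
        simpl in B |- *. eapply ex_derive_ext; [|exact B].
        intros t; simpl; exact (cDerive_n_shift (fun t => Im (f t)) j t).
Qed.

Lemma derive_n_CC (n : nat) : forall f,
  (forall (j : nat) (x : R), (j <= n)%nat ->
    ex_derive_n (fun t => Re (f t)) j x /\ ex_derive_n (fun t => Im (f t)) j x /\
    continuous (Derive_n (fun t => Re (f t)) j) x /\
    continuous (Derive_n (fun t => Im (f t)) j) x) -> CC n f.
Proof.
  induction n as [|n IH]; intros f H.
  - intros x; destruct (H O x (le_n _)) as (_ & _ & A & B); now split.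
  - exists (cDerive f); split.
    + intros x; destruct (H 1%nat x ltac:(lia)) as (A & B & _).
      split; apply Derive_correct; assumption.
    + apply IH; intros j x Hj.
      destruct (H (S j) x ltac:(lia)) as (A & B & A' & B').
      change (fun t => Re (cDerive f t)) with (Derive (fun t => Re (f t))).
      change (fun t => Im (cDerive f t)) with (Derive (fun t => Im (f t))).
      assert (Er : Derive_n (Derive (fun t => Re (f t))) j = Derive_n (fun t => Re (f t)) (S j))
        by (apply functional_extensionality; intros; apply cDerive_n_shift).
      assert (Ei : Derive_n (Derive (fun t => Im (f t))) j = Derive_n (fun t => Im (f t)) (S j))
        by (apply functional_extensionality; intros; apply cDerive_n_shift).
      rewrite Er, Ei; repeat split; try assumption.
      * destruct j as [|j]; [exact I|].
        simpl in A |- *; eapply ex_derive_ext; [|exact A].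
        intros t; symmetry; exact (cDerive_n_shift (fun t => Re (f t)) j t).
      * destruct j as [|j]; [exact I|].
        simpl in B |- *; eapply ex_derive_ext; [|exact B].
        intros t; symmetry; exact (cDerive_n_shift (fun t => Im (f t)) j t).
Qed.

(** Trades iterated real derivatives of both components for the recursive class [CC], on which sums,
    products and reflections are handled by induction. *)
Lemma Cn_on_iff (n : nat) (a b : R) (f : R -> C) :
  Cn_on n a b f <-> exists g, (forall x : R, (a <= x <= b)%R -> g x = f x) /\ CC n g.
Proof.
  split; intros [g [E H]]; exists g; split; try assumption.
  - now apply derive_n_CC.
  - now apply CC_derive_n.
Qed.

(** Restricted to the open interval because a two-sided derivative at an end point sees values
    outside [-1,1]; on (-1,1) this relation passes to derivatives. *)
Definition agree (u v : R -> C) : Prop := forall x, intI x -> u x = v x.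

Lemma zero_limit_real (f : R -> R) (a b x : R) :
  (a < b)%R -> continuous f x -> (a <= x <= b)%R ->
  (forall t, (a < t < b)%R -> f t = 0%R) -> f x = 0%R.
Proof.
  intros Hab Hc Hx H0.
  destruct (Req_dec (f x) 0) as [|Hn]; [assumption|exfalso].
  assert (He : (0 < Rabs (f x))%R) by now apply Rabs_pos_lt.
  destruct (proj1 (filterlim_locally f (f x)) Hc (mkposreal _ He)) as [d Hd].
  (* A step of length e from x towards the midpoint of (a,b) stays inside (a,b) and inside the ball
     where f differs from f(x) by less than |f(x)|. There f vanishes, a contradiction. *)
  set (e := Rmin (pos d / 2) ((b - a) / 4)).
  pose proof (cond_pos d).
  assert (e <= pos d / 2)%R by apply Rmin_l.
  assert (e <= (b - a) / 4)%R by apply Rmin_r.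
  assert (0 < e)%R by (apply Rmin_glb_lt; lra).
  assert (Ht : exists t, (a < t < b)%R /\ (Rabs (t - x) < d)%R).
  { destruct (Rle_dec x ((a + b) / 2)).
    - exists (x + e)%R; split; [lra|]. rewrite Rabs_right; lra.
    - exists (x - e)%R; split; [lra|]. rewrite Rabs_left; lra. }
  destruct Ht as [t [Ht Htd]].
  pose proof (Hd t Htd) as Hb; rewrite (H0 t Ht) in Hb.
  change (Rabs (0 - f x) < Rabs (f x))%R in Hb.
  rewrite Rminus_0_l, Rabs_Ropp in Hb; lra.
Qed.

Lemma CC_zero_closure (f : R -> C) (a b x : R) :
  (a < b)%R -> CC 0 f -> (a <= x <= b)%R ->
  (forall t, (a < t < b)%R -> f t = 0) -> f x = 0.
Proof.
  intros Hab Hc Hx H0; destruct (Hc x) as [Hr Hi]; apply C_ext.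
  - apply (zero_limit_real (fun t => Re (f t)) a b); auto.
    intros t Ht; now rewrite (H0 t Ht).
  - apply (zero_limit_real (fun t => Im (f t)) a b); auto.
    intros t Ht; now rewrite (H0 t Ht).
Qed.

Lemma CC_eq_closure (f g : R -> C) (a b x : R) :
  (a < b)%R -> CC 0 f -> CC 0 g -> (a <= x <= b)%R ->
  (forall t, (a < t < b)%R -> f t = g t) -> f x = g x.
Proof.
  intros Hab Hf Hg Hx H.
  assert (f x - g x = 0).
  { apply (CC_zero_closure (fun t => f t - g t) a b x); auto using CC_minus.
    intros t Ht; rewrite (H t Ht); ring. }
  replace (f x) with (f x - g x + g x) by ring; rewrite H0; ring.
Qed.

Lemma locally_interval (a b x : R) (P : R -> Prop) :
  (a < x < b)%R -> (forall t, (a < t < b)%R -> P t) -> locally x P.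
Proof.
  intros Hx HP.
  assert (He : (0 < Rmin (x - a) (b - x))%R) by (apply Rmin_glb_lt; lra).
  exists (mkposreal _ He); intros t Ht.
  change (Rabs (t - x) < Rmin (x - a) (b - x))%R in Ht.
  pose proof (Rmin_l (x - a) (b - x)); pose proof (Rmin_r (x - a) (b - x)).
  apply Rabs_def2 in Ht; apply HP; lra.
Qed.

Lemma cDerive_agree (f g : R -> C) (a b x : R) :
  (a < x < b)%R -> (forall t, (a < t < b)%R -> f t = g t) -> cDerive f x = cDerive g x.
Proof.
  intros Hx H; apply C_ext; apply Derive_ext_loc; apply (locally_interval a b); auto;
    intros t Ht; now rewrite (H t Ht).
Qed.

(** * Integrals and convolutions *)

Ltac rring := match goal with |- ?a = ?b => change (@eq R a b) end; ring.

Lemma cont_ex_RInt (f : R -> R) a b : cont_on_R f -> ex_RInt f a b.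
Proof.
  intros H; apply (ex_RInt_continuous (V := R_CompleteNormedModule)); intros; apply H.
Qed.

Lemma CC0_re f : CC 0 f -> cont_on_R (fun t => Re (f t)).
Proof. intros H x; exact (proj1 (H x)). Qed.

Lemma CC0_im f : CC 0 f -> cont_on_R (fun t => Im (f t)).
Proof. intros H x; exact (proj2 (H x)). Qed.

Lemma cRInt_pair (f : R -> C) a b : CC 0 f ->
  cRInt f a b = (RInt (fun t => Re (f t)) a b, RInt (fun t => Im (f t)) a b).
Proof.
  intros H; apply (is_RInt_unique (V := C_R_CompleteNormedModule)).
  apply (is_RInt_fct_extend_pair (U := R_NormedModule) (V := R_NormedModule) f);
    apply (RInt_correct (V := R_CompleteNormedModule)), cont_ex_RInt;
    [exact (CC0_re _ H) | exact (CC0_im _ H)].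
Qed.

Lemma cRInt_ext (f g : R -> C) a b : (a <= b)%R ->
  (forall x, (a < x < b)%R -> f x = g x) -> cRInt f a b = cRInt g a b.
Proof.
  intros Hab H; apply (RInt_ext (V := C_R_CompleteNormedModule)).
  intros x; rewrite Rmin_left, Rmax_right by lra; apply H.
Qed.

Lemma cRInt_agree (f g : R -> C) : agree f g -> cRInt f (-1) 1 = cRInt g (-1) 1.
Proof. intros H; apply cRInt_ext; [lra | exact H]. Qed.

Lemma RInt_plus_cont (f g : R -> R) a b : cont_on_R f -> cont_on_R g ->
  RInt (fun t => (f t + g t)%R) a b = (RInt f a b + RInt g a b)%R.
Proof.
  intros Hf Hg; apply (RInt_plus (V := R_CompleteNormedModule) f g); now apply cont_ex_RInt.
Qed.

Lemma RInt_minus_cont (f g : R -> R) a b : cont_on_R f -> cont_on_R g ->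
  RInt (fun t => (f t - g t)%R) a b = (RInt f a b - RInt g a b)%R.
Proof.
  intros Hf Hg; apply (RInt_minus (V := R_CompleteNormedModule) f g); now apply cont_ex_RInt.
Qed.

Lemma RInt_scal_cont (l : R) (f : R -> R) a b : cont_on_R f ->
  RInt (fun t => (l * f t)%R) a b = (l * RInt f a b)%R.
Proof.
  intros Hf; apply (RInt_scal (V := R_CompleteNormedModule) f); now apply cont_ex_RInt.
Qed.

Lemma RInt_opp_cont (f : R -> R) a b : cont_on_R f ->
  RInt (fun t => (- f t)%R) a b = (- RInt f a b)%R.
Proof.
  intros Hf; apply (RInt_opp (V := R_CompleteNormedModule) f); now apply cont_ex_RInt.
Qed.

Lemma cRInt_plus (f g : R -> C) a b : CC 0 f -> CC 0 g ->
  cRInt (fun t => f t + g t) a b = cRInt f a b + cRInt g a b.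
Proof.
  intros Hf Hg; rewrite !cRInt_pair by auto using CC_plus.
  apply C_ext.
  - exact (RInt_plus_cont _ _ a b (CC0_re _ Hf) (CC0_re _ Hg)).
  - exact (RInt_plus_cont _ _ a b (CC0_im _ Hf) (CC0_im _ Hg)).
Qed.

Lemma cont_scal (l : R) (f : R -> R) : cont_on_R f -> cont_on_R (fun t => (l * f t)%R).
Proof. intros H x; apply cont_mult; [apply continuous_const | apply H]. Qed.

Lemma cRInt_scal (l : C) (f : R -> C) a b : CC 0 f ->
  cRInt (fun t => l * f t) a b = l * cRInt f a b.
Proof.
  intros Hf; rewrite !cRInt_pair by auto using CC_scal.
  assert (Hr := CC0_re _ Hf); assert (Hi := CC0_im _ Hf).
  apply C_ext; simpl; rewrite <- !RInt_scal_cont by assumption.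
  - apply (RInt_minus_cont (fun t => (fst l * Re (f t))%R) (fun t => (snd l * Im (f t))%R));
      now apply cont_scal.
  - apply (RInt_plus_cont (fun t => (fst l * Im (f t))%R) (fun t => (snd l * Re (f t))%R));
      now apply cont_scal.
Qed.

Lemma cRInt_conj (f : R -> C) a b : CC 0 f ->
  cRInt (cconj f) a b = Cconj (cRInt f a b).
Proof.
  intros Hf; rewrite !cRInt_pair by auto using CC_conj.
  apply C_ext; simpl; [reflexivity|].
  apply (RInt_opp_cont (fun t => Im (f t))), CC0_im, Hf.
Qed.

Lemma RInt_deriv (F f : R -> R) a b :
  (forall x, is_derive F x (f x)) -> cont_on_R f -> RInt f a b = (F b - F a)%R.
Proof.
  intros Hd Hc; apply (is_RInt_unique (V := R_CompleteNormedModule)).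
  apply (is_RInt_derive (V := R_CompleteNormedModule)); intros; auto.
Qed.

Lemma cRInt_deriv (F f : R -> C) a b : cder F f -> CC 0 f ->
  cRInt f a b = F b - F a.
Proof.
  intros Hd Hc; rewrite cRInt_pair by assumption.
  apply C_ext.
  - exact (RInt_deriv _ _ a b (fun x => proj1 (Hd x)) (CC0_re _ Hc)).
  - exact (RInt_deriv _ _ a b (fun x => proj2 (Hd x)) (CC0_im _ Hc)).
Qed.

(** The limits of integration are parameters because the proof of Fubini below differentiates in the
    upper one. *)
Definition rconv (a b : R) (p q : R -> R) (x : R) : R :=
  RInt (fun y => (p (x - y) * q y)%R) a b.

Lemma cont_reflect (p : R -> R) x : cont_on_R p -> cont_on_R (fun y => p (x - y)%R).
Proof.
  intros H y; apply (continuous_comp (fun t => x - t)%R p); [|apply H].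
  apply cont_minus; [apply continuous_const | apply continuous_id].
Qed.

Lemma cont_mult_on (p q : R -> R) : cont_on_R p -> cont_on_R q -> cont_on_R (fun y => (p y * q y)%R).
Proof. intros H H' y; now apply cont_mult. Qed.

Lemma continuity_2d_sub (p : R -> R) (x y : R) :
  cont_on_R p -> continuity_2d_pt (fun u v => p (u - v)%R) x y.
Proof.
  intros H; apply (continuity_1d_2d_pt_comp p (fun u v => (u - v)%R)).
  - apply continuity_pt_filterlim, H.
  - apply continuity_2d_pt_minus; [apply continuity_2d_pt_id1 | apply continuity_2d_pt_id2].
Qed.

Lemma rconv_deriv (a b : R) (p p' q : R -> R) :
  (forall x, is_derive p x (p' x)) -> cont_on_R p' -> cont_on_R q ->
  forall x, is_derive (rconv a b p q) x (rconv a b p' q x).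
Proof.
  intros Hp Hp' Hq x.
  assert (Hcp : cont_on_R p) by (intros t; eapply deriv_continuous; apply Hp).
  assert (Hd : forall u t, is_derive (fun z => (p (z - t) * q t)%R) u (p' (u - t) * q t)%R).
  { intros u t; eapply deriv_eq;
      [apply deriv_mult; [apply deriv_shift, Hp | apply deriv_const]|]; simpl; ring. }
  eapply deriv_eq; [apply (is_derive_RInt_param (fun z t => (p (z - t) * q t)%R) a b x)|].
  - apply filter_forall; intros u t _; eexists; apply Hd.
  - intros t _. apply continuity_2d_pt_ext with (fun u v => (p' (u - v) * q v)%R).
    { intros u v; symmetry; apply is_derive_unique, Hd. }
    apply continuity_2d_pt_mult; [now apply continuity_2d_sub|].
    apply (continuity_1d_2d_pt_comp q (fun u v => v)).
    + apply continuity_pt_filterlim, Hq.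
    + apply continuity_2d_pt_id2.
  - apply filter_forall; intros u; apply cont_ex_RInt, cont_mult_on;
      [now apply cont_reflect | assumption].
  - apply RInt_ext; intros t _; apply is_derive_unique, Hd.
Qed.

Lemma conv_integrand (k u : R -> C) x : CC 0 k -> CC 0 u -> CC 0 (fun y => k (x - y)%R * u y).
Proof. intros; apply CC_mult; [now apply (CC_reflect 0)|assumption]. Qed.

Lemma conv_re (k u : R -> C) x : CC 0 k -> CC 0 u ->
  Re (conv k u x) = (rconv (-1) 1 (fun t => Re (k t)) (fun t => Re (u t)) x
                     - rconv (-1) 1 (fun t => Im (k t)) (fun t => Im (u t)) x)%R.
Proof.
  intros Hk Hu; unfold conv; rewrite cRInt_pair by now apply conv_integrand.
  pose proof (cont_reflect _ x (CC0_re _ Hk)) as Hr; pose proof (cont_reflect _ x (CC0_im _ Hk)) as Hi.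
  exact (RInt_minus_cont _ _ _ _ (cont_mult_on _ _ Hr (CC0_re _ Hu))
           (cont_mult_on _ _ Hi (CC0_im _ Hu))).
Qed.

Lemma conv_im (k u : R -> C) x : CC 0 k -> CC 0 u ->
  Im (conv k u x) = (rconv (-1) 1 (fun t => Re (k t)) (fun t => Im (u t)) x
                     + rconv (-1) 1 (fun t => Im (k t)) (fun t => Re (u t)) x)%R.
Proof.
  intros Hk Hu; unfold conv; rewrite cRInt_pair by now apply conv_integrand.
  pose proof (cont_reflect _ x (CC0_re _ Hk)) as Hr; pose proof (cont_reflect _ x (CC0_im _ Hk)) as Hi.
  exact (RInt_plus_cont _ _ _ _ (cont_mult_on _ _ Hr (CC0_im _ Hu))
           (cont_mult_on _ _ Hi (CC0_re _ Hu))).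
Qed.

Lemma conv_cder (k k' u : R -> C) : cder k k' -> CC 0 k' -> CC 0 u ->
  cder (conv k u) (conv k' u).
Proof.
  intros Hk Hk' Hu x; pose proof (cder_CC0 _ _ Hk) as Hk0.
  pose proof (CC0_re _ Hk') as Hkr; pose proof (CC0_im _ Hk') as Hki.
  pose proof (CC0_re _ Hu) as Hur; pose proof (CC0_im _ Hu) as Hui.
  pose proof (fun y => proj1 (Hk y)) as Hdr; pose proof (fun y => proj2 (Hk y)) as Hdi.
  split.
  - rewrite conv_re by assumption.
    eapply is_derive_ext; [intros t; symmetry; now apply conv_re|].
    exact (deriv_minus _ _ _ _ _ (rconv_deriv _ _ _ _ _ Hdr Hkr Hur x)
             (rconv_deriv _ _ _ _ _ Hdi Hki Hui x)).
  - rewrite conv_im by assumption.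
    eapply is_derive_ext; [intros t; symmetry; now apply conv_im|].
    exact (deriv_plus _ _ _ _ _ (rconv_deriv _ _ _ _ _ Hdr Hkr Hui x)
             (rconv_deriv _ _ _ _ _ Hdi Hki Hur x)).
Qed.

(** All derivatives fall on the kernel, so u need only be continuous. One order is given away in the
    base case, where continuity of the convolution is read off from its differentiability. *)
Lemma conv_CC (n : nat) : forall k u, CC (S n) k -> CC 0 u -> CC n (conv k u).
Proof.
  induction n as [|n IH]; intros k u Hk Hu.
  - eapply cder_CC0; apply conv_cder; [eapply CC_cder, Hk | now apply CC_cDerive | assumption].
  - eapply CC_intro; [apply conv_cder|].
    + eapply CC_cder, Hk.
    + eapply CC_0, CC_cDerive, Hk.
    + assumption.
    + apply IH; [now apply CC_cDerive | assumption].
Qed.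

Lemma conv_agree (k k' u u' : R -> C) x : inI x ->
  (forall z, (-2 < z < 2)%R -> k z = k' z) -> agree u u' -> conv k u x = conv k' u' x.
Proof.
  intros Hx Hk Hu; apply cRInt_ext; [lra|]; intros y Hy.
  rewrite (Hu y Hy), Hk; [reflexivity | unfold inI in Hx; lra].
Qed.

Lemma RInt_plus_upper (f : R -> R) t : cont_on_R f ->
  is_derive (fun s => RInt f (-1) s) t (f t).
Proof.
  intros H; apply (is_derive_RInt (V := R_NormedModule) f _ (-1)); [|apply H].
  apply filter_forall; intros s; apply (RInt_correct (V := R_CompleteNormedModule)).
  now apply cont_ex_RInt.
Qed.

Lemma deriv_zero_const (f : R -> R) a b : (a < b)%R ->
  (forall t, is_derive f t 0%R) -> f a = f b.
Proof.
  intros Hab H; apply (eq_is_derive (V := R_NormedModule) f a b); [intros; apply H|assumption].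
Qed.

(** Fubini by differentiation: let the upper limit t of the q-integral vary on both sides. The
    difference [Phi] vanishes at t = -1 and both sides have t-derivative q(t) times the integral of
    p(t-y) r(y), so [Phi] is constant. *)
Lemma rconv_fubini (p p' q r : R -> R) :
  (forall x, is_derive p x (p' x)) -> cont_on_R p' -> cont_on_R q -> cont_on_R r ->
  RInt (fun x => q x * rconv (-1) 1 p r x)%R (-1) 1
  = RInt (fun y => r y * rconv (-1) 1 (fun z => p (- z)%R) q y)%R (-1) 1.
Proof.
  intros Hp Hp' Hq Hr.
  assert (Hpc : cont_on_R p) by (intros t; eapply deriv_continuous; apply Hp).
  assert (Hc : cont_on_R (rconv (-1) 1 p r))
    by (intros x; eapply deriv_continuous; now apply rconv_deriv).
  set (G := fun t y => rconv (-1) t (fun z => p (- z)%R) q y).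
  assert (Hn : forall x, is_derive (fun z => p (- z)%R) x (- p' (- x))%R).
  { intros x; apply is_derive_ext with (fun z => p (0 - z)%R).
    - intros t; f_equal; ring.
    - replace (- x)%R with (0 - x)%R by ring. apply deriv_reflect, Hp. }
  assert (Hn' : cont_on_R (fun x => - p' (- x))%R).
  { intros x; apply continuous_ext with (fun x => - p' (0 - x))%R.
    - intros t; do 2 f_equal; ring.
    - apply (cont_opp (fun x => p' (0 - x)%R)), (cont_reflect p' 0), Hp'. }
  assert (HGc : forall t, cont_on_R (fun y => r y * G t y)%R).
  { intros t; apply cont_mult_on; [assumption|].
    intros y; eapply deriv_continuous; apply rconv_deriv with (1 := Hn); assumption. }
  assert (HG : forall t y, is_derive (fun s => r y * G s y)%R t (r y * (p (t - y) * q t))%R).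
  { intros t y; eapply deriv_eq; [apply deriv_mult; [apply deriv_const|]|].
    - apply RInt_plus_upper, cont_mult_on; [|assumption].
      intros x. apply (cont_reflect (fun z => p (- z)%R)).
      intros z; eapply deriv_continuous; apply Hn.
    - simpl. replace (- (y - t))%R with (t - y)%R by ring. ring. }
  set (Phi := fun t => (RInt (fun x => q x * rconv (-1) 1 p r x)%R (-1) t
                        - RInt (fun y => r y * G t y)%R (-1) 1)%R).
  assert (HPhi : forall t, is_derive Phi t 0%R).
  { intros t; eapply deriv_eq; [apply deriv_minus|].
    - apply RInt_plus_upper. apply cont_mult_on; assumption.
    - apply (is_derive_RInt_param (fun t y => (r y * G t y)%R) (-1) 1 t).
      + apply filter_forall; intros u y _; eexists; apply HG.
      + intros y _.
        apply continuity_2d_pt_ext with (fun u v => (r v * (p (u - v) * q u))%R).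
        { intros u v; symmetry; apply is_derive_unique, HG. }
        apply continuity_2d_pt_mult; [|apply continuity_2d_pt_mult].
        * apply (continuity_1d_2d_pt_comp r (fun u v => v)).
          -- apply continuity_pt_filterlim, Hr.
          -- apply continuity_2d_pt_id2.
        * now apply continuity_2d_sub.
        * apply (continuity_1d_2d_pt_comp q (fun u v => u)).
          -- apply continuity_pt_filterlim, Hq.
          -- apply continuity_2d_pt_id1.
      + apply filter_forall; intros u; apply cont_ex_RInt, HGc.
    - rewrite (RInt_ext _ (fun y => q t * (p (t - y) * r y))%R).
      + rewrite RInt_scal_cont; [exact (Rminus_diag_eq _ _ eq_refl)|].
        apply cont_mult_on; [now apply cont_reflect | assumption].
      + intros y _; etransitivity; [exact (is_derive_unique _ _ _ (HG t y))|].
        change (r y * (p (t - y) * q t) = q t * (p (t - y) * r y))%R; ring. }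
  assert (E : Phi (-1)%R = Phi 1%R) by (apply deriv_zero_const; [lra | assumption]).
  unfold Phi in E; rewrite RInt_point in E.
  rewrite (RInt_ext (fun y => r y * G (-1) y)%R (fun _ => 0%R)) in E.
  - rewrite RInt_const in E. change zero with 0%R in E.
    change (scal (1 - -1)%R 0%R) with ((1 - -1) * 0)%R in E.
    apply Rminus_diag_uniq. unfold G in E. rewrite <- E; ring.
  - intros y _; unfold G, rconv; rewrite RInt_point; exact (Rmult_0_r (r y)).
Qed.

(** For the pairing without conjugation, the transpose of convolution by k is convolution by k(-z).
    Real and imaginary parts split into real double integrals [T], each of which is swapped by
    [rconv_fubini]. *)
Lemma conv_fubini (k u v : R -> C) : CC 1 k -> CC 0 u -> CC 0 v ->
  cRInt (fun x => v x * conv k u x) (-1) 1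
  = cRInt (fun y => u y * conv (fun z => k (- z)%R) v y) (-1) 1.
Proof.
  intros Hk Hu Hv.
  assert (Hk' : CC 1 (fun z => k (- z)%R)).
  { replace (fun z => k (- z)%R) with (fun z => k (0 - z)%R)
      by (apply functional_extensionality; intros; f_equal; ring).
    now apply (CC_reflect 1). }
  pose proof (CC_cder _ _ Hk) as Hd; pose proof (CC_cDerive _ _ Hk) as Hd0.
  pose proof (CC_cder _ _ Hk') as Hd'; pose proof (CC_cDerive _ _ Hk') as Hd0'.
  assert (Hur := CC0_re _ Hu); assert (Hui := CC0_im _ Hu).
  assert (Hvr := CC0_re _ Hv); assert (Hvi := CC0_im _ Hv).
  rewrite !cRInt_pair by (apply CC_mult; [assumption | now apply conv_CC]).
  assert (Hterm : forall p p' q r, (forall x, is_derive p x (p' x)) -> cont_on_R p' ->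
            cont_on_R q -> cont_on_R r -> cont_on_R (fun x => q x * rconv (-1) 1 p r x)%R).
  { intros p p' q r Hp Hp' Hq Hr; apply cont_mult_on; [assumption|].
    intros x; eapply deriv_continuous; now apply rconv_deriv with (1 := Hp). }
  assert (Hpl : forall f g, cont_on_R f -> cont_on_R g -> cont_on_R (fun x => f x + g x)%R)
    by (intros f g Hf Hg x; now apply cont_plus).
  assert (Hmi : forall f g, cont_on_R f -> cont_on_R g -> cont_on_R (fun x => f x - g x)%R)
    by (intros f g Hf Hg x; now apply cont_minus).
  pose (T := fun p q r => fun x : R => (q x * rconv (-1) 1 p r x)%R).
  pose (kr := fun t => Re (k t)); pose (ki := fun t => Im (k t)).
  pose (lr := fun t => Re (k (- t)%R)); pose (li := fun t => Im (k (- t)%R)).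
  pose (ur := fun t => Re (u t)); pose (ui := fun t => Im (u t)).
  pose (vr := fun t => Re (v t)); pose (vi := fun t => Im (v t)).
  assert (Tkr : forall q r, cont_on_R q -> cont_on_R r -> cont_on_R (T kr q r))
    by (intros q r; exact (Hterm _ _ q r (fun x => proj1 (Hd x)) (CC0_re _ Hd0))).
  assert (Tki : forall q r, cont_on_R q -> cont_on_R r -> cont_on_R (T ki q r))
    by (intros q r; exact (Hterm _ _ q r (fun x => proj2 (Hd x)) (CC0_im _ Hd0))).
  assert (Tlr : forall q r, cont_on_R q -> cont_on_R r -> cont_on_R (T lr q r))
    by (intros q r; exact (Hterm _ _ q r (fun x => proj1 (Hd' x)) (CC0_re _ Hd0'))).
  assert (Tli : forall q r, cont_on_R q -> cont_on_R r -> cont_on_R (T li q r))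
    by (intros q r; exact (Hterm _ _ q r (fun x => proj2 (Hd' x)) (CC0_im _ Hd0'))).
  assert (Fr : forall q r, cont_on_R q -> cont_on_R r ->
            RInt (T kr q r) (-1) 1 = RInt (T lr r q) (-1) 1)
    by (intros q r; exact (rconv_fubini _ _ q r (fun x => proj1 (Hd x)) (CC0_re _ Hd0))).
  assert (Fi : forall q r, cont_on_R q -> cont_on_R r ->
            RInt (T ki q r) (-1) 1 = RInt (T li r q) (-1) 1)
    by (intros q r; exact (rconv_fubini _ _ q r (fun x => proj2 (Hd x)) (CC0_im _ Hd0))).
  pose proof (CC_S _ _ Hk) as Hk0; pose proof (CC_S _ _ Hk') as Hk0'.
  apply C_ext; cbn [Re Im fst snd].
  - rewrite (RInt_ext _ (fun x => (T kr vr ur x - T ki vr ui x)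
                                  - (T kr vi ui x + T ki vi ur x))%R).
    2: { intros x _; change (Re (v x * conv k u x))
           with (Re (v x) * Re (conv k u x) - Im (v x) * Im (conv k u x))%R.
         rewrite conv_re, conv_im by assumption.
         unfold T, vr, vi, kr, ki, ur, ui; rring. }
    rewrite (RInt_ext (fun t => Re (u t * conv (fun z => k (- z)%R) v t))
              (fun x => (T lr ur vr x - T li ur vi x) - (T lr ui vi x + T li ui vr x))%R).
    2: { intros x _; change (Re (u x * conv (fun z => k (- z)%R) v x))
           with (Re (u x) * Re (conv (fun z => k (- z)%R) v x)
                 - Im (u x) * Im (conv (fun z => k (- z)%R) v x))%R.
         rewrite conv_re, conv_im by assumption.
         unfold T, vr, vi, lr, li, ur, ui; rring. }
    rewrite !RInt_minus_cont, !RInt_plus_cont by auto 6.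
    rewrite !Fr, !Fi by assumption; rring.
  - rewrite (RInt_ext _ (fun x => (T kr vr ui x + T ki vr ur x)
                                  + (T kr vi ur x - T ki vi ui x))%R).
    2: { intros x _; change (Im (v x * conv k u x))
           with (Re (v x) * Im (conv k u x) + Im (v x) * Re (conv k u x))%R.
         rewrite conv_re, conv_im by assumption.
         unfold T, vr, vi, kr, ki, ur, ui; rring. }
    rewrite (RInt_ext (fun t => Im (u t * conv (fun z => k (- z)%R) v t))
              (fun x => (T lr ur vi x + T li ur vr x) + (T lr ui vr x - T li ui vi x))%R).
    2: { intros x _; change (Im (u x * conv (fun z => k (- z)%R) v x))
           with (Re (u x) * Im (conv (fun z => k (- z)%R) v x)
                 + Im (u x) * Re (conv (fun z => k (- z)%R) v x))%R.
         rewrite conv_re, conv_im by assumption.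
         unfold T, vr, vi, lr, li, ur, ui; rring. }
    rewrite !RInt_plus_cont, !RInt_minus_cont by auto 6.
    rewrite !Fr, !Fi by assumption; rring.
Qed.

Lemma conv_conj (k u : R -> C) x : CC 0 k -> CC 0 u ->
  conv (cconj k) (cconj u) x = Cconj (conv k u x).
Proof.
  intros Hk Hu; unfold conv; rewrite <- cRInt_conj by now apply conv_integrand.
  f_equal; apply functional_extensionality; intros y; unfold cconj.
  now rewrite Cmult_conj.
Qed.

(** K is symmetric because transposing and conjugating the kernel cancel; a symmetric operator has a
    real quadratic form, and this makes the eigenvalues real. *)
Lemma inner_conv_real (k u : R -> C) :
  CC 1 k -> CC 0 u -> (forall z, (-2 < z < 2)%R -> k (- z)%R = Cconj (k z)) ->
  inner (conv k u) u = Cconj (inner (conv k u) u).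
Proof.
  intros Hk Hu Hh.
  pose proof (CC_S _ _ Hk) as Hk0.
  pose proof (conv_CC 0 k u Hk Hu) as Hc.
  unfold inner; rewrite <- cRInt_conj by (apply CC_mult; [assumption | now apply (CC_conj 0)]).
  rewrite (cRInt_agree (cconj _) (fun y => u y * conv (fun z => k (- z)%R) (cconj u) y)).
  - rewrite <- conv_fubini by (assumption || now apply CC_conj).
    apply cRInt_agree; intros x _; unfold cconj; ring.
  - intros x Hx. unfold cconj at 1. rewrite Cmult_conj, Cconj_conj, <- conv_conj by assumption.
    rewrite Cmult_comm; f_equal.
    apply conv_agree; [unfold inI, intI in *; lra| |easy].
    intros z Hz; symmetry; now apply Hh.
Qed.

(** * The differential operator and the kernel identity *)

Notation D := cDerive.

Lemma cDerive_conj (f : R -> C) : D (cconj f) = cconj (D f).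
Proof.
  apply functional_extensionality; intros x; apply C_ext; [reflexivity|].
  exact (Derive_opp (fun t => Im (f t)) x).
Qed.

Lemma diffop_conj (b c u : R -> C) :
  cconj (diffop b c u) = diffop (cconj b) (cconj c) (cconj u).
Proof.
  apply functional_extensionality; intros x; unfold diffop.
  rewrite cDerive_conj.
  replace (fun t => cconj b t * cconj (D u) t) with (cconj (fun t => b t * D u t)).
  - rewrite cDerive_conj; unfold cconj; now rewrite Cplus_conj, Cmult_conj.
  - apply functional_extensionality; intros t; unfold cconj; apply Cmult_conj.
Qed.

Lemma cconj_cconj (f : R -> C) : cconj (cconj f) = f.
Proof. apply functional_extensionality; intros t; apply Cconj_conj. Qed.

Lemma diffop_CC (n : nat) (b c u : R -> C) :
  CC (S n) b -> CC n c -> CC (S (S n)) u -> CC n (diffop b c u).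
Proof.
  intros Hb Hc Hu; apply (CC_plus n (D (fun t => b t * D u t)) (fun t => c t * u t)).
  - apply CC_cDerive, CC_mult; [assumption | now apply CC_cDerive].
  - apply CC_mult; [assumption | now apply CC_S, CC_S].
Qed.

Lemma diffop_expand (b c u : R -> C) x : CC 1 b -> CC 2 u ->
  diffop b c u x = b x * D (D u) x + D b x * D u x + c x * u x.
Proof.
  intros Hb Hu; unfold diffop.
  rewrite (cder_unique _ _ (cder_mult _ _ _ _ (CC_cder _ _ Hb)
             (CC_cder _ _ (CC_cDerive _ _ Hu)))); ring.
Qed.

Lemma cDerive_agree_I (f g : R -> C) : agree f g -> agree (D f) (D g).
Proof. intros H x Hx; exact (cDerive_agree f g (-1) 1 x Hx H). Qed.

Lemma diffop_agree (b b' c c' u u' : R -> C) :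
  agree b b' -> agree c c' -> agree u u' -> agree (diffop b c u) (diffop b' c' u').
Proof.
  intros Hb Hc Hu x Hx; unfold diffop; rewrite Hc, Hu by assumption; f_equal.
  apply cDerive_agree_I; [|assumption].
  intros t Ht; rewrite Hb by assumption; f_equal; now apply cDerive_agree_I.
Qed.

Lemma agree_conj (f g : R -> C) : agree f g -> agree (cconj f) (cconj g).
Proof. intros H x Hx; unfold cconj; now rewrite H. Qed.

Lemma diffop_comb (b c u v : R -> C) (a : C) x : CC 1 b -> CC 2 u -> CC 2 v ->
  diffop b c (fun t => u t + a * v t) x = diffop b c u x + a * diffop b c v x.
Proof.
  intros Hb Hu Hv.
  pose proof (CC_cder _ _ Hu) as Hu1; pose proof (CC_cder _ _ Hv) as Hv1.
  pose proof (CC_cder _ _ (CC_cDerive _ _ Hu)) as Hu2.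
  pose proof (CC_cder _ _ (CC_cDerive _ _ Hv)) as Hv2.
  rewrite !diffop_expand by auto using CC_plus, CC_scal.
  rewrite (cder_unique _ _ (cder_plus _ _ _ _ Hu1 (cder_scal a _ _ Hv1))).
  rewrite (cder_unique _ _ (cder_plus _ _ _ _ Hu2 (cder_scal a _ _ Hv2))); ring.
Qed.

(** The function b (u' v - u v') is a primitive of the difference of the two integrands; it vanishes
    at both end points together with b, so u and v need no boundary conditions. *)
Lemma diffop_parts (b c u v : R -> C) :
  CC 1 b -> CC 0 c -> b (-1)%R = 0 -> b 1%R = 0 -> CC 2 u -> CC 2 v ->
  cRInt (fun x => diffop b c u x * v x) (-1) 1
  = cRInt (fun x => u x * diffop b c v x) (-1) 1.
Proof.
  intros Hb Hc Hbm Hbp Hu Hv.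
  pose proof (CC_cder _ _ Hb) as Hb'.
  pose proof (CC_cder _ _ Hu) as Hu1; pose proof (CC_cder _ _ Hv) as Hv1.
  pose proof (CC_cder _ _ (CC_cDerive _ _ Hu)) as Hu2.
  pose proof (CC_cder _ _ (CC_cDerive _ _ Hv)) as Hv2.
  pose proof (cder_minus _ _ _ _
    (cder_mult _ _ _ _ (cder_mult _ _ _ _ Hb' Hu2) Hv1)
    (cder_mult _ _ _ _ Hu1 (cder_mult _ _ _ _ Hb' Hv2))) as HF.
  assert (Hlu : CC 0 (diffop b c u)) by now apply diffop_CC.
  assert (Hlv : CC 0 (diffop b c v)) by now apply diffop_CC.
  assert (Hu0 : CC 0 u) by now apply CC_0 in Hu.
  assert (Hv0 : CC 0 v) by now apply CC_0 in Hv.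
  assert (E : cRInt (fun x => diffop b c u x * v x + (-1) * (u x * diffop b c v x)) (-1) 1 = 0).
  { etransitivity; [eapply cRInt_deriv; [eapply cder_eq; [exact HF|]|]|].
    - intros x; cbv beta; rewrite !diffop_expand by assumption; ring.
    - apply CC_plus; [|apply CC_scal]; now apply CC_mult.
    - cbv beta; rewrite Hbm, Hbp; ring. }
  rewrite cRInt_plus, cRInt_scal in E by (try apply CC_scal; now apply CC_mult).
  match goal with |- ?a = ?b => replace a with (a + (-1) * b + b) by ring end.
  rewrite E; ring.
Qed.

(* [L_x k(x-y) = (L_y)^T kbar(x-y)] written out, with [d/dy kbar(x-y) = - kbar'(x-y)]. *)
Definition kernel_identity (b c k : R -> C) : Prop :=
  forall x y : R, intI x -> intI y ->
    b x * D (D k) (x - y)%R + D b x * D k (x - y)%R + c x * k (x - y)%R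
    = b y * Cconj (D (D k) (x - y)%R) - D b y * Cconj (D k (x - y)%R)
      + c y * Cconj (k (x - y)%R).

Section Commutation.
Variables b c k : R -> C.
Hypothesis Hb : forall n, CC n b.
Hypothesis Hc : forall n, CC n c.
Hypothesis Hk : CC 5 k.
Hypothesis Hbm : b (-1)%R = 0.
Hypothesis Hbp : b 1%R = 0.
Hypothesis Hid : kernel_identity b c k.

Lemma sesquicommute (u : R -> C) x : CC 2 u -> intI x ->
  conv (cconj k) (diffop b c u) x = diffop b c (conv k u) x.
Proof.
  intros Hu Hx.
  pose proof (CC_0 _ _ Hu) as Hu0; pose proof (CC_0 _ _ Hk) as Hk0.
  pose proof (CC_cder _ _ Hk) as Hk1.
  pose proof (CC_cDerive _ _ Hk) as Hk1'; pose proof (CC_cder _ _ Hk1') as Hk2.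
  pose proof (CC_cDerive _ _ Hk1') as Hk2'.
  pose proof (CC_0 _ _ Hk1') as Hk10; pose proof (CC_0 _ _ Hk2') as Hk20.
  set (q := fun y => cconj k (x - y)%R).
  assert (Hq : CC 2 q).
  { apply (CC_reflect 2 x (cconj k)), CC_conj; apply (CC_le 2 5); [lia | assumption]. }
  unfold conv at 1.
  rewrite (cRInt_ext _ (fun y => q y * diffop b c u y)) by (lra || reflexivity).
  rewrite <- (diffop_parts b c q u (Hb 1) (Hc 0) Hbm Hbp Hq Hu).
  rewrite diffop_expand; [|apply Hb|apply conv_CC; [apply (CC_le 3 5); [lia|]|]; assumption].
  rewrite (cder_unique _ _ (conv_cder _ _ _ Hk1 Hk10 Hu0)).
  rewrite (cder_unique _ _ (conv_cder _ _ _ Hk2 Hk20 Hu0)).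
  unfold conv; rewrite <- !cRInt_scal by now apply conv_integrand.
  rewrite <- !cRInt_plus by
    (try apply CC_plus; apply CC_scal; now apply conv_integrand).
  apply cRInt_ext; [lra|]; intros y Hy.
  rewrite diffop_expand; [|apply Hb|assumption].
  (* As a function of y the reflected kernel changes sign with each derivative; this yields the
     minus sign at b'(y) in [kernel_identity]. *)
  unfold q at 1 2; rewrite (cder_unique _ _ (cder_reflect _ _ x (cder_conj _ _ Hk1))).
  rewrite (cder_unique _ _ (cder_opp _ _ (cder_reflect _ _ x (cder_conj _ _ Hk2)))).
  unfold q, cconj.
  match goal with |- _ = ?r => replace r with
    ((b x * D (D k) (x - y)%R + D b x * D k (x - y)%R + c x * k (x - y)%R) * u y) by ring end.
  rewrite (Hid x y Hx Hy); ring.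
Qed.

Lemma sesquicommute_adj (v : R -> C) x : CC 2 v -> intI x ->
  conv k (diffop_adj b c v) x = diffop_adj b c (conv (cconj k) v) x.
Proof.
  intros Hv Hx; unfold diffop_adj.
  pose proof (CC_0 _ _ Hv) as Hv0; pose proof (CC_0 _ _ Hk) as Hk0.
  assert (E : conv (cconj k) v = cconj (conv k (cconj v))).
  { apply functional_extensionality; intros t; unfold cconj at 2.
    rewrite <- conv_conj by auto using CC_conj; now rewrite cconj_cconj. }
  rewrite E, <- diffop_conj; unfold cconj at 3.
  rewrite <- sesquicommute by auto using CC_conj.
  rewrite <- (cconj_cconj v) at 1; rewrite <- diffop_conj.
  rewrite <- conv_conj; [now rewrite cconj_cconj | now apply (CC_conj 0) |].
  apply (diffop_CC 0); auto using CC_conj.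
Qed.

Lemma LL_commute (u : R -> C) x : CC 4 u -> intI x ->
  conv k (diffop_adj b c (diffop b c u)) x
  = diffop_adj b c (diffop b c (conv k u)) x.
Proof.
  intros Hu Hx.
  rewrite sesquicommute_adj by (try assumption; now apply (diffop_CC 2)).
  apply diffop_agree; try easy.
  intros t Ht; apply sesquicommute; [apply (CC_le 2 4); [lia|] |]; assumption.
Qed.

Lemma diffop_adj_CC (n : nat) u : CC (S (S n)) u -> CC n (diffop_adj b c u).
Proof. intros; apply diffop_CC; try assumption; now apply CC_conj. Qed.

Lemma LL_CC (n : nat) u : CC (4 + n) u -> CC n (diffop_adj b c (diffop b c u)).
Proof. intros; now apply diffop_adj_CC, diffop_CC. Qed.

(** The bilinear integration by parts, applied with the conjugate coefficients to conj v, produces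
    conj (L v). This is the sense in which [diffop_adj] is the adjoint, and the symmetry of L^*L
    follows since the right-hand side is hermitian in u and v. *)
Lemma LL_inner (u v : R -> C) : CC 4 u -> CC 2 v ->
  inner (diffop_adj b c (diffop b c u)) v = inner (diffop b c u) (diffop b c v).
Proof.
  intros Hu Hv; unfold inner.
  change (fun y => ?f y * Cconj (v y)) with (fun y => f y * cconj v y).
  unfold diffop_adj at 1; rewrite diffop_parts.
  - rewrite <- diffop_conj; reflexivity.
  - now apply (CC_conj 1).
  - now apply (CC_conj 0).
  - unfold cconj; rewrite Hbm; creal.
  - unfold cconj; rewrite Hbp; creal.
  - now apply (diffop_CC 2).
  - now apply (CC_conj 2).
Qed.

Lemma inner_sym (u v : R -> C) : CC 0 u -> CC 0 v -> inner u v = Cconj (inner v u).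
Proof.
  intros Hu Hv; unfold inner; rewrite <- cRInt_conj.
  - f_equal; apply functional_extensionality; intros x; unfold cconj.
    rewrite Cmult_conj, Cconj_conj; ring.
  - now apply (CC_mult 0 v (cconj u)); [|apply CC_conj].
Qed.

Lemma LL_selfadjoint (u v : R -> C) : CC 4 u -> CC 4 v ->
  inner (diffop_adj b c (diffop b c u)) v = inner u (diffop_adj b c (diffop b c v)).
Proof.
  intros Hu Hv.
  assert (CC 2 u /\ CC 2 v) as [Hu2 Hv2] by (split; apply (CC_le 2 4); auto).
  assert (CC 0 u /\ CC 0 v) as [Hu0 Hv0] by (split; eapply CC_0; eassumption).
  rewrite LL_inner, (inner_sym u), LL_inner, inner_sym; auto; try now apply (diffop_CC 0).
  now apply (LL_CC 0).
Qed.

End Commutation.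

(** * The hyperbolic family *)

Definition Csmooth (f : R -> C) : Prop := forall n, CC n f.

Lemma smooth_cder (f f' : R -> C) : cder f f' -> Csmooth f' -> Csmooth f.
Proof. intros H H' n; apply CC_S; exists f'; auto. Qed.

Lemma smooth_eq (f g : R -> C) : Csmooth f -> (forall x, g x = f x) -> Csmooth g.
Proof. intros H E; now replace g with f by (apply functional_extensionality; auto). Qed.

Lemma cder_ext (f g f' : R -> C) : cder f f' -> (forall x, g x = f x) -> cder g f'.
Proof. intros H E; now replace g with f by (apply functional_extensionality; auto). Qed.

Lemma smooth_id : Csmooth (fun x => RtoC x).
Proof.
  apply smooth_cder with (fun _ => 1); [|intros n; apply CC_const].
  apply cder_RtoC; intros x; apply (is_derive_id (K := R_AbsRing) x).
Qed.

Lemma cder_id : cder (fun x => RtoC x) (fun _ => 1).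
Proof. apply cder_RtoC; intros x; apply (is_derive_id (K := R_AbsRing) x). Qed.

Lemma Ceq_minus (z w : C) : z - w = 0 -> z = w.
Proof. intros H; replace z with (z - w + w) by ring; rewrite H; ring. Qed.

Lemma Cmult_cancel (a z w : C) : a <> 0 -> a * z = a * w -> z = w.
Proof.
  intros Ha H; replace z with (/ a * (a * z)) by (field; assumption).
  rewrite H; field; assumption.
Qed.

Lemma Cconj_R (x : R) : Cconj (RtoC x) = RtoC x.
Proof. creal. Qed.

Lemma cexp_plus (z w : C) : cexp (z + w) = cexp z * cexp w.
Proof.
  unfold cexp; destruct z as [a b], w as [c d]; simpl.
  rewrite exp_plus, cos_plus, sin_plus; creal.
Qed.

Lemma cexp_0 : cexp 0 = 1.
Proof. unfold cexp; simpl; rewrite exp_0, cos_0, sin_0; creal. Qed.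

Lemma cexp_conj (z : C) : Cconj (cexp z) = cexp (Cconj z).
Proof.
  unfold cexp; destruct z as [a b]; simpl; rewrite cos_neg, sin_neg; creal.
Qed.

Lemma cexp_Ci (t : R) : cexp (Ci * t) = RtoC (cos t) + Ci * sin t.
Proof.
  unfold cexp; cbn [Re Im Ci Cmult RtoC fst snd].
  replace (0 * t - 1 * 0)%R with 0%R by ring.
  replace (0 * 0 + 1 * t)%R with t by ring.
  rewrite exp_0; creal.
Qed.

Lemma cexp_cder (w : C) : cder (fun x : R => cexp (w * x)) (fun x : R => w * cexp (w * x)).
Proof.
  destruct w as [a b]; intros x.
  assert (E : forall t : R, cexp ((a, b) * t)
              = (exp (a * t) * cos (b * t), exp (a * t) * sin (b * t))%R).
  { intros t; unfold cexp; cbn [Re Im Cmult RtoC fst snd].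
    replace (a * t - b * 0)%R with (a * t)%R by ring.
    replace (a * 0 + b * t)%R with (b * t)%R by ring. creal. }
  rewrite E; split.
  - apply is_derive_ext with (fun t => exp (a * t) * cos (b * t))%R.
    { intros t; now rewrite E. }
    auto_derive; [trivial|]; unfold Re; simpl; ring.
  - apply is_derive_ext with (fun t => exp (a * t) * sin (b * t))%R.
    { intros t; now rewrite E. }
    auto_derive; [trivial|]; unfold Im; simpl; ring.
Qed.

Lemma cexp_smooth (w : C) : Csmooth (fun x : R => cexp (w * x)).
Proof.
  intros n; induction n as [|n IH].
  - exact (cder_CC0 _ _ (cexp_cder w)).
  - eapply CC_intro; [apply cexp_cder | now apply CC_scal].
Qed.

Definition ccosh (mu : C) (z : R) : C := (cexp (mu * z) + cexp (- mu * z)) / 2.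

Lemma C2_neq_0 : RtoC 2 <> 0.
Proof. intros H; apply (f_equal fst) in H; simpl in H; lra. Qed.

Lemma csinh_cder (mu : C) : cder (fun z : R => csinh (mu * z)) (fun z => mu * ccosh mu z).
Proof.
  apply cder_ext with (fun z : R => / 2 * (cexp (mu * z) - cexp (- mu * z))).
  - eapply cder_eq; [apply cder_scal, cder_minus; apply cexp_cder|].
    intros z; unfold ccosh; simpl; field.
  - intros z; unfold csinh. replace (- (mu * z)) with (- mu * z) by ring. field.
Qed.

(** With [ccosh_cder] this gives a differential system closed uniformly in mu. The limit mu = 0 is
    included, so the families need no separate degenerate cases. *)
Lemma sinh_over_cder (mu : C) : cder (sinh_over mu) (ccosh mu).
Proof.
  destruct (Ceq_dec mu 0) as [->|H].
  - apply cder_ext with (fun z => RtoC z);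
      [|intros z; unfold sinh_over; now destruct (Ceq_dec 0 0)].
    eapply cder_eq; [apply cder_id|].
    intros z; unfold ccosh.
    replace (0 * z) with (RtoC 0) by ring; replace (- 0 * z) with (RtoC 0) by ring.
    rewrite cexp_0; field.
  - apply cder_ext with (fun z : R => / mu * csinh (mu * z)).
    + eapply cder_eq; [apply cder_scal, csinh_cder|]; intros z; simpl; field; assumption.
    + intros z; unfold sinh_over; destruct (Ceq_dec mu 0); [contradiction|]; field; assumption.
Qed.

Lemma mu_sinh_over (mu : C) (z : R) : mu * sinh_over mu z = csinh (mu * z).
Proof.
  unfold sinh_over; destruct (Ceq_dec mu 0) as [->|H]; [|field; assumption].
  unfold csinh; replace (0 * z) with (RtoC 0) by ring; replace (- 0) with (RtoC 0) by ring.
  field.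
Qed.

Lemma ccosh_cder (mu : C) : cder (ccosh mu) (fun z => mu * mu * sinh_over mu z).
Proof.
  apply cder_ext with (fun z : R => / 2 * (cexp (mu * z) + cexp (- mu * z))).
  - eapply cder_eq; [apply cder_scal, cder_plus; apply cexp_cder|].
    intros z; rewrite <- Cmult_assoc, mu_sinh_over; unfold csinh.
    replace (- (mu * z)) with (- mu * z) by ring; field.
  - intros z; unfold ccosh; field.
Qed.

Lemma sinh_over_smooth (mu : C) : Csmooth (sinh_over mu).
Proof.
  eapply smooth_cder; [apply sinh_over_cder|]. intros n.
  apply CC_mult; [|apply CC_const].
  apply CC_plus; [apply cexp_smooth | apply (cexp_smooth (- mu))].
Qed.

Lemma sinh_over_0 (mu : C) : sinh_over mu 0 = 0.
Proof.
  unfold sinh_over; destruct (Ceq_dec mu 0); [reflexivity|].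
  unfold csinh; replace (mu * 0) with (RtoC 0) by ring; replace (- 0) with (RtoC 0) by ring.
  field; assumption.
Qed.

Lemma csinh_opp (w : C) : csinh (- w) = - csinh w.
Proof. unfold csinh; replace (- - w) with w by ring; field. Qed.

Lemma csinh_conj (w : C) : Cconj (csinh w) = csinh (Cconj w).
Proof.
  unfold csinh; rewrite Cdiv_conj by apply C2_neq_0.
  now rewrite Cminus_conj, !cexp_conj, Copp_conj, Cconj_R.
Qed.

(** For real mu this is clear; for imaginary mu conjugation replaces mu by -mu, and sinh(mu z)/mu is
    even in mu. *)
Lemma sinh_over_real (mu : C) (z : R) :
  real_or_imaginary mu -> Cconj (sinh_over mu z) = sinh_over mu z.
Proof.
  intros H; unfold sinh_over; destruct (Ceq_dec mu 0) as [_|Hmu]; [apply Cconj_R|].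
  rewrite Cdiv_conj, csinh_conj, Cmult_conj, Cconj_R by assumption.
  destruct H as [H|H].
  - replace (Cconj mu) with mu; [reflexivity|].
    destruct mu; simpl in *; subst; creal.
  - replace (Cconj mu) with (- mu).
    + replace (- mu * z) with (- (mu * z)) by ring. rewrite csinh_opp; field; assumption.
    + destruct mu; simpl in *; subst; creal.
Qed.

Lemma csinh_R (t : R) : csinh t = sinh t.
Proof.
  unfold csinh, cexp, sinh; simpl. rewrite Ropp_0, cos_0, sin_0.
  rewrite RtoC_div, RtoC_minus by lra. f_equal; creal.
Qed.

Lemma sinh_over_R (g z : R) : g <> 0%R -> sinh_over g z = RtoC (sinh (g * z) / g).
Proof.
  intros Hg; unfold sinh_over; destruct (Ceq_dec g 0) as [H|_].
  - apply (f_equal fst) in H; simpl in H; contradiction.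
  - rewrite <- RtoC_mult, csinh_R, RtoC_div by assumption; reflexivity.
Qed.

Lemma sinh_over_R_neq_0 (g z : R) : z <> 0%R -> sinh_over g z <> 0.
Proof.
  intros Hz H; destruct (Req_dec g 0) as [->|Hg].
  - unfold sinh_over in H; destruct (Ceq_dec 0 0) as [_|n]; [|now apply n].
    now apply (f_equal fst) in H.
  - rewrite sinh_over_R in H by assumption; apply (f_equal fst) in H; simpl in H.
    assert (E : (sinh (g * z) = 0)%R).
    { replace (sinh (g * z))%R with (sinh (g * z) / g * g)%R by (field; assumption).
      rewrite H; ring. }
    unfold sinh in E.
    assert (exp (g * z) = exp (- (g * z)))%R as E' by lra.
    apply exp_inv in E'. assert (g * z = 0)%R as E2 by lra.
    apply Rmult_integral in E2; tauto.
Qed.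

(** This is cosh 2gx - cosh 2gy = 2 sinh g(x+y) sinh g(x-y). The factor in x - y is exactly the
    denominator of the kernel, which is what cancels the singularity at x = y. *)
Lemma b_hyp_diff (g x y : R) :
  RtoC (b_hyp g x) = RtoC (b_hyp g y) + sinh_over g (x + y) * sinh_over g (x - y).
Proof.
  unfold b_hyp; destruct (Req_dec_T g 0) as [->|Hg].
  - unfold sinh_over; destruct (Ceq_dec 0 0) as [_|n]; [|now contradiction n].
    rewrite <- RtoC_mult, <- RtoC_plus; f_equal; ring.
  - rewrite !sinh_over_R by assumption.
    rewrite <- RtoC_mult, <- RtoC_plus; f_equal.
    unfold cosh, sinh.
    replace (2 * g * x)%R with (g * x + g * x)%R by ring.
    replace (2 * g * y)%R with (g * y + g * y)%R by ring.
    replace (g * (x + y))%R with (g * x + g * y)%R by ring.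
    replace (g * (x - y))%R with (g * x + - (g * y))%R by ring.
    rewrite !Ropp_plus_distr, !exp_plus, Ropp_involutive, !exp_Ropp.
    assert (exp (g * x) <> 0)%R by apply Rgt_not_eq, exp_pos.
    assert (exp (g * y) <> 0)%R by apply Rgt_not_eq, exp_pos.
    field; repeat split; try assumption; apply Rgt_not_eq, exp_pos.
Qed.

Lemma cDerive2_eq (f g : R -> C) (a b x : R) :
  (forall t, (a < t < b)%R -> f t = g t) -> (a < x < b)%R ->
  D f x = D g x /\ D (D f) x = D (D g) x.
Proof.
  intros H Hx.
  assert (H1 : forall t, (a < t < b)%R -> D f t = D g t)
    by (intros t Ht; now apply (cDerive_agree f g a b)).
  split; [now apply H1 | now apply (cDerive_agree (D f) (D g) a b)].
Qed.

Lemma cDerive2_real (k : R -> C) (x : R) :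
  (forall z, (-2 < z < 2)%R -> Cconj (k z) = k z) -> (-2 < x < 2)%R ->
  Cconj (D k x) = D k x /\ Cconj (D (D k) x) = D (D k) x.
Proof.
  intros H Hx; destruct (cDerive2_eq (cconj k) k (-2) 2 x H Hx) as [A B].
  rewrite !cDerive_conj in B; rewrite cDerive_conj in A; now split.
Qed.

Lemma D2_mult (f f1 f2 g g1 g2 : R -> C) x :
  cder f f1 -> cder f1 f2 -> cder g g1 -> cder g1 g2 ->
  D (D (fun t => f t * g t)) x = f2 x * g x + 2 * (f1 x * g1 x) + f x * g2 x.
Proof.
  intros Hf Hf1 Hg Hg1.
  rewrite (cder_unique _ _ (cder_mult _ _ _ _ Hf Hg)).
  rewrite (cder_unique _ _ (cder_plus _ _ _ _ (cder_mult _ _ _ _ Hf1 Hg)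
             (cder_mult _ _ _ _ Hf Hg1))); ring.
Qed.

Lemma intI_sub x y : intI x -> intI y -> (-2 < x - y < 2)%R.
Proof. unfold intI; lra. Qed.

(** The point y is a free parameter: taking for it the other variable of the kernel gives b'
    directly in terms of x + y and x - y. *)
Lemma b_hyp_cder (g y : R) : cder (fun x => RtoC (b_hyp g x))
  (fun x => ccosh g (x + y) * sinh_over g (x - y) + sinh_over g (x + y) * ccosh g (x - y)).
Proof.
  assert (Hp : forall f f' s, cder f f' -> cder (fun x => f (x + s)%R) (fun x => f' (x + s)%R)).
  { intros f f' s H x. replace (x + s)%R with (x - (- s))%R by ring.
    destruct (H (x - - s)%R) as [A B]; split.
    - eapply is_derive_ext; [|apply (deriv_shift _ _ _ _ A)].
      intros t; simpl; do 2 f_equal; ring.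
    - eapply is_derive_ext; [|apply (deriv_shift _ _ _ _ B)].
      intros t; simpl; do 2 f_equal; ring. }
  eapply cder_ext; [|intros x; apply (b_hyp_diff g x y)].
  eapply cder_eq; [apply cder_plus; [apply cder_const|];
    apply cder_mult; [eapply Hp, sinh_over_cder | eapply (Hp _ _ (- y)%R), sinh_over_cder]|].
  intros x; simpl; unfold Rminus; ring.
Qed.

(** Adding the two instances of [b_hyp_cder], the terms odd in x - y cancel. The sum b'(x) + b'(y)
    is the coefficient of k' in the kernel identity when k is real. *)
Lemma b_hyp_deriv_sum (g x y : R) :
  D (fun x => RtoC (b_hyp g x)) x + D (fun x => RtoC (b_hyp g x)) y
  = 2 * (sinh_over g (x + y) * ccosh g (x - y)).
Proof.
  pose proof (equal_f (cder_unique _ _ (b_hyp_cder g y)) x) as E1.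
  pose proof (equal_f (cder_unique _ _ (b_hyp_cder g x)) y) as E2.
  cbv beta in E1, E2; rewrite E1, E2; clear E1 E2.
  replace (y + x)%R with (x + y)%R by ring.
  assert (Hs : sinh_over g (y - x) = - sinh_over g (x - y)).
  { unfold sinh_over; destruct (Ceq_dec g 0).
    - rewrite <- RtoC_opp; f_equal; ring.
    - replace (g * (y - x)%R) with (- (g * (x - y)%R)).
      + rewrite csinh_opp; field; assumption.
      + rewrite !RtoC_minus; ring. }
  assert (Hc : ccosh g (y - x) = ccosh g (x - y)).
  { unfold ccosh.
    replace (g * (y - x)%R) with (- g * (x - y)%R) by (rewrite !RtoC_minus; ring).
    replace (- g * (y - x)%R) with (g * (x - y)%R) by (rewrite !RtoC_minus; ring).
    field. }
  rewrite Hs, Hc; ring.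
Qed.

(** Collects what the commutation argument asks of a pair (L, K), so that the three families and the
    gauge transformation can be treated one at a time. *)
Definition good_operator (b c k : R -> C) : Prop :=
  Csmooth b /\ Csmooth c /\ b (-1)%R = 0 /\ b 1%R = 0 /\ kernel_identity b c k.

(** Write S_g for [sinh_over g]. As k is real, the identity reads (b(x)-b(y)) k'' + (b'(x)+b'(y)) k'
    + (c(x)-c(y)) k = 0. Each coefficient contains S_g(x+y), and the cofactor is (k S_g)'' - mu^2 k
    S_g, which vanishes because k S_g = S_mu. The value c(x)-c(y) = (g^2-mu^2)(b(x)-b(y)) is what
    completes the second derivative. *)
Lemma hyp_good (k0 b c k : R -> C) : family_hyp k0 b c -> CC 2 k ->
  (forall z, (-2 < z < 2)%R -> z <> 0%R -> k z = k0 z) -> Cconj (k 0%R) = k 0%R ->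
  good_operator b c k.
Proof.
  intros (g & mu & c0 & Hmu & Hk0 & Hb & Hc) Hk Hkk0 Hreal.
  apply functional_extensionality in Hb; apply functional_extensionality in Hc; subst b c.
  assert (Hbs : Csmooth (fun x => RtoC (b_hyp g x))).
  { intros n; eapply smooth_cder; [apply (b_hyp_cder g 0)|]; clear n; intros n.
    assert (forall m, CC m (fun x => ccosh g (x + 0)%R)
                      /\ CC m (fun x => ccosh g (x - 0)%R)
                      /\ CC m (fun x => sinh_over g (x + 0)%R)
                      /\ CC m (fun x => sinh_over g (x - 0)%R)) as Hm.
    { intros m.
      assert (Hcs : CC m (ccosh g)).
      { pose proof (sinh_over_smooth g (S m)) as H; apply CC_cDerive in H.
        now rewrite (cder_unique _ _ (sinh_over_cder g)) in H. }
      assert (E1 : forall f : R -> C, (fun x => f (x + 0)%R) = f)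
        by (intros f; apply functional_extensionality; intros; f_equal; ring).
      assert (E2 : forall f : R -> C, (fun x => f (x - 0)%R) = f)
        by (intros f; apply functional_extensionality; intros; f_equal; ring).
      rewrite !E1, !E2; repeat split; try assumption; apply sinh_over_smooth. }
    destruct (Hm n) as (A & B & A' & B').
    apply CC_plus; apply CC_mult; assumption. }
  assert (HbE : forall y, (y ^ 2 = 1)%R -> RtoC (b_hyp g y) = 0).
  { intros y Hy.
    assert (y = 1 \/ y = -1)%R as [-> | ->].
    { destruct (Rmult_integral (y - 1) (y + 1)) as [H|H]; [ring_simplify; lra|left; lra|right; lra]. }
    - f_equal; unfold b_hyp; destruct (Req_dec_T g 0); [ring|].
      rewrite Rmult_1_r; field; assumption.
    - f_equal; unfold b_hyp; destruct (Req_dec_T g 0); [ring|].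
      replace (2 * g * -1)%R with (- (2 * g))%R by ring.
      unfold cosh; rewrite Ropp_involutive; field; assumption. }
  (* Cleared of its denominator the formula for the kernel holds at z = 0 as well, both sides being
     zero there; only this form is differentiated. *)
  assert (HkS : forall z, (-2 < z < 2)%R -> k z * sinh_over g z = sinh_over mu z).
  { intros z Hz; destruct (Req_dec z 0) as [->|Hz0].
    - rewrite !sinh_over_0; ring.
    - rewrite Hkk0, Hk0 by (try assumption; unfold in2I; lra).
      field; now apply sinh_over_R_neq_0. }
  assert (Hg : real_or_imaginary g) by (left; reflexivity).
  assert (Hkr : forall z, (-2 < z < 2)%R -> Cconj (k z) = k z).
  { intros z Hz; destruct (Req_dec z 0) as [->|Hz0]; [assumption|].
    apply Cmult_cancel with (sinh_over g z); [now apply sinh_over_R_neq_0|].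
    rewrite (Cmult_comm _ (k z)), HkS by assumption.
    rewrite <- (sinh_over_real g z Hg) at 1.
    rewrite <- Cmult_conj, (Cmult_comm _ (k z)), HkS by assumption.
    now apply sinh_over_real. }
  pose proof (CC_cder _ _ Hk) as Hk1; pose proof (CC_cder _ _ (CC_cDerive _ _ Hk)) as Hk2.
  repeat split.
  - assumption.
  - intros n. apply CC_plus; [|apply CC_const]. apply CC_scal, Hbs.
  - apply HbE; ring.
  - apply HbE; ring.
  - intros x y Hx Hy; pose proof (intI_sub x y Hx Hy) as Hz.
    destruct (cDerive2_real k _ Hkr Hz) as [E1 E2]; rewrite E1, E2, Hkr by assumption.
    pose proof (D2_mult _ _ _ _ _ _ (x - y)%R Hk1 Hk2 (sinh_over_cder g) (ccosh_cder g)) as HD.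
    rewrite (proj2 (cDerive2_eq _ _ _ _ _ HkS Hz)) in HD.
    rewrite (cder_unique _ _ (sinh_over_cder mu)), (cder_unique _ _ (ccosh_cder mu)) in HD.
    rewrite <- HkS in HD by assumption.
    pose proof (b_hyp_deriv_sum g x y) as Hsum.
    rewrite (b_hyp_diff g x y).
    set (z := (x - y)%R) in *; set (bx := D _ x) in *; set (by_ := D _ y) in *.
    replace bx with (2 * (sinh_over g (x + y) * ccosh g z) - by_) by (rewrite <- Hsum; ring).
    apply Ceq_minus.
    transitivity (sinh_over g (x + y)
      * (D (D k) z * sinh_over g z + 2 * (D k z * ccosh g z)
         + k z * (g * g * sinh_over g z) - mu * mu * (k z * sinh_over g z))); [simpl; ring|].
    rewrite <- HD; ring.
Qed.

(** * The other two families *)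

Lemma cder_sin (w : R) : cder (fun x : R => RtoC (sin (w * x))) (fun x => RtoC (w * cos (w * x))).
Proof. apply cder_RtoC; intros x; auto_derive; [trivial | ring]. Qed.

Lemma cder_cos (w : R) : cder (fun x : R => RtoC (cos (w * x))) (fun x => RtoC (- (w * sin (w * x)))).
Proof. apply cder_RtoC; intros x; auto_derive; [trivial | ring]. Qed.

Lemma trig_smooth (w : R) :
  Csmooth (fun x : R => RtoC (sin (w * x))) /\ Csmooth (fun x : R => RtoC (cos (w * x))).
Proof.
  assert (H : forall n, CC n (fun x : R => RtoC (sin (w * x))) /\
                        CC n (fun x : R => RtoC (cos (w * x)))).
  { induction n as [|n [IHs IHc]].
    - split; [exact (cder_CC0 _ _ (cder_sin w)) | exact (cder_CC0 _ _ (cder_cos w))].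
    - split; [exists (fun x => RtoC w * cos (w * x)) | exists (fun x => RtoC (- w) * sin (w * x))];
        split; try (now apply CC_scal).
      + eapply cder_eq; [apply cder_sin|]; intros x; simpl; now rewrite RtoC_mult.
      + eapply cder_eq; [apply cder_cos|]; intros x; simpl; rewrite <- RtoC_mult; f_equal; ring. }
  split; intros n; apply H.
Qed.

(** Split k = alpha E + s with E = e^{-i mu z} and s real, z s = sin(mu z). The part i mu b' + mu^2
    b of c is made so that L without its constant term annihilates E in x, and likewise conj E on
    the y side. For s there remain (x+y)((z s)'' + mu^2 z s) = 0 and 2 i mu z s. The constant
    mu/alpha multiplies k - conj k = -2 i alpha sin(mu z) and removes the latter. *)
Lemma sinc_good (k0 b c k : R -> C) : family_sinc k0 b c -> CC 2 k ->
  (forall z, (-2 < z < 2)%R -> z <> 0%R -> k z = k0 z) -> Cconj (k 0%R) = k 0%R ->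
  good_operator b c k.
Proof.
  intros (al & mu & Hal & Hk0 & Hb & Hc) Hk Hkk0 Hreal.
  assert (HDb : forall y, Derive b_quad y = (2 * y)%R).
  { intros y; apply is_derive_unique; unfold b_quad; auto_derive; [trivial | ring]. }
  assert (Hbc : b = fun y : R => y * y - 1).
  { apply functional_extensionality; intros y; rewrite Hb; unfold b_quad.
    rewrite <- RtoC_mult, <- RtoC_minus; f_equal; ring. }
  assert (Hcc : c = fun y : R => Ci * mu * (2 * y) + RtoC mu * mu * (y * y - 1) + mu / al).
  { apply functional_extensionality; intros y; rewrite Hc, HDb; unfold b_quad.
    rewrite !RtoC_minus, !RtoC_mult, RtoC_div, RtoC_pow by assumption; simpl; ring. }
  subst b c; clear Hb Hc.
  assert (Hb1 : cder (fun y : R => y * y - 1) (fun y : R => 2 * y)).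
  { eapply cder_eq; [apply cder_minus; [apply cder_mult; apply cder_id | apply cder_const]|].
    intros x; simpl; ring. }
  assert (Hbs : Csmooth (fun y : R => y * y - 1)).
  { intros n; apply CC_minus; [apply CC_mult; apply smooth_id | apply CC_const]. }
  pose proof (CC_cder _ _ Hk) as Hk1; pose proof (CC_cder _ _ (CC_cDerive _ _ Hk)) as Hk2.
  pose (E := fun z : R => cexp (- Ci * mu * z)).
  assert (HE1 : cder E (fun z => - Ci * mu * E z)) by apply cexp_cder.
  assert (HE2 : cder (fun z => - Ci * mu * E z) (fun z => - Ci * mu * (- Ci * mu * E z)))
    by (apply cder_scal, HE1).
  pose (s := fun z : R => k z - al * E z).
  pose proof (cder_minus _ _ _ _ Hk1 (cder_scal al _ _ HE1)) as Hs1.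
  pose proof (cder_minus _ _ _ _ Hk2 (cder_scal al _ _ HE2)) as Hs2.
  cbv beta in Hs1, Hs2; change (cder s (fun x => D k x - al * (- Ci * mu * E x))) in Hs1.
  assert (HsF : forall z, (-2 < z < 2)%R -> z <> 0%R -> s z = RtoC (sin (mu * z) / z)).
  { intros z Hz Hz0; unfold s; rewrite Hkk0, Hk0 by (try assumption; unfold in2I; lra).
    unfold E; ring. }
  assert (Hsr : forall z, (-2 < z < 2)%R -> Cconj (s z) = s z).
  { intros z Hz; destruct (Req_dec z 0) as [->|Hz0].
    - unfold s, E; replace (- Ci * mu * 0) with (RtoC 0) by ring.
      rewrite Cminus_conj, Hreal, cexp_0, Cmult_1_r, Cconj_R; reflexivity.
    - rewrite HsF by assumption; apply Cconj_R. }
  assert (Hzs : forall z, (-2 < z < 2)%R -> RtoC z * s z = RtoC (sin (mu * z))).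
  { intros z Hz; destruct (Req_dec z 0) as [->|Hz0].
    - rewrite Rmult_0_r, sin_0; ring.
    - rewrite HsF, <- RtoC_mult by assumption; f_equal; field; assumption. }
  repeat split.
  - assumption.
  - intros n; apply CC_plus; [apply CC_plus|apply CC_const].
    + apply CC_scal, CC_scal, smooth_id.
    + apply CC_scal, Hbs.
  - rewrite <- RtoC_mult, <- RtoC_minus; f_equal; ring.
  - rewrite <- RtoC_mult, <- RtoC_minus; f_equal; ring.
  - intros x y Hx Hy; pose proof (intI_sub x y Hx Hy) as Hz.
    rewrite (cder_unique _ _ Hb1).
    destruct (cDerive2_real s _ Hsr Hz) as [E1 E2].
    pose proof (D2_mult _ _ _ s _ _ (x - y)%R cder_id (cder_const 1) Hs1 Hs2) as HD.
    cbv beta in HD.     rewrite (proj2 (cDerive2_eq _ _ _ _ _ Hzs Hz)) in HD.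
    rewrite (cder_unique _ _ (cder_sin mu)) in HD.
    assert (Hcos : cder (fun z : R => RtoC (mu * cos (mu * z)))
              (fun z : R => RtoC (- mu * mu * sin (mu * z))))
      by (apply cder_RtoC; intros t; auto_derive; [trivial | ring]).
    rewrite (cder_unique _ _ Hcos) in HD; cbv beta in HD.
    rewrite (cder_unique _ _ Hs1) in E1, E2; rewrite (cder_unique _ _ Hs2) in E2.
    cbv beta in E1, E2.
    pose proof (Hsr _ Hz) as E0; pose proof (Hzs _ Hz) as Hs.
    assert (HEE : cexp (Ci * RtoC (- mu * (x - y))) = E (x - y)%R).
    { unfold E; f_equal. rewrite RtoC_mult, RtoC_opp; ring. }
    rewrite cexp_Ci in HEE.
    replace (- mu * (x - y))%R with (- (mu * (x - y)))%R in HEE by ring.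
    rewrite cos_neg, sin_neg in HEE.
    set (z := (x - y)%R) in *.
    (* Eliminates conj E in favour of E and sin(mu z) = z s, so that the identity becomes polynomial
       in E, s and the derivatives of s. *)
    assert (HEc : Cconj (E z) = E z + 2 * (Ci * sin (mu * z)))
      by (rewrite <- HEE; creal).
    assert (Hxy : RtoC z = x - y) by (unfold z; apply RtoC_minus).
    set (k2 := D (D k) z) in *; set (k1 := D k z) in *; set (kz := k z) in *.
    set (s2 := k2 - al * (- Ci * mu * (- Ci * mu * E z))) in *.
    set (s1 := k1 - al * (- Ci * mu * E z)) in *.
    assert (Ci * Ci = -1) as HCi by creal.
    replace k2 with (s2 - al * mu * mu * E z).
    2: { unfold s2; apply Ceq_minus; transitivity (- al * mu * mu * E z * (Ci * Ci + 1));
         [ring | rewrite HCi; ring]. }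
    replace k1 with (s1 - Ci * al * mu * E z) by (unfold s1, k1; ring).
    replace kz with (s z + al * E z) by (unfold s, kz; ring).
    rewrite !Cminus_conj, !Cplus_conj, !Cmult_conj, !Cconj_R, E0, E1, E2, HEc.
    replace (Cconj Ci) with (- Ci) by creal.
    rewrite !RtoC_mult, RtoC_opp, <- Hs in HD.
    assert (HD' : RtoC z * s2 + 2 * s1 + RtoC mu * mu * (z * s z) = 0)
      by (transitivity (0 * s z + 2 * (1 * s1) + z * s2 - - RtoC mu * mu * (z * s z));
          [ring | rewrite <- HD; ring]).
    rewrite <- Hs; apply Ceq_minus.
    transitivity ((x + y) * (RtoC z * s2 + 2 * s1 + RtoC mu * mu * (z * s z)));
      [|rewrite HD'; ring].
    rewrite Hxy; field.
    intros H; apply Hal; now apply (f_equal fst) in H.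
Qed.

(** * The trigonometric family and its exceptional summand *)

Definition sin_over (m z : R) : R := if Req_dec_T m 0 then z else (sin (m * z) / m)%R.

Lemma mu_sin_over (m z : R) : (m * sin_over m z = sin (m * z))%R.
Proof.
  unfold sin_over; destruct (Req_dec_T m 0) as [->|H].
  - now rewrite !Rmult_0_l, sin_0.
  - field; assumption.
Qed.

Lemma sinh_over_Ci (m z : R) : sinh_over (Ci * m) z = sin_over m z.
Proof.
  assert (Ci * Ci = -1) as HCi by creal.
  unfold sinh_over, sin_over; destruct (Ceq_dec (Ci * m) 0) as [H|H], (Req_dec_T m 0) as [H'|H'].
  - reflexivity.
  - apply (f_equal snd) in H; simpl in H; contradict H'; lra.
  - contradict H; rewrite H'; ring.
  - assert (RtoC m <> 0) by (intros E; apply H'; now apply (f_equal fst) in E).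
    assert (Ci <> 0) by (intros E; apply (f_equal snd) in E; simpl in E; lra).
    rewrite RtoC_div by assumption.
    apply Cmult_cancel with (Ci * m); [assumption|].
    replace (Ci * m * (csinh (Ci * m * z) / (Ci * m))) with (csinh (Ci * m * z))
      by (field; auto).
    replace (Ci * m * (RtoC (sin (m * z)) / m)) with (Ci * sin (m * z)) by (field; auto).
    unfold csinh; replace (Ci * m * z) with (Ci * (m * z)%R) by (rewrite RtoC_mult; ring).
    replace (- (Ci * (m * z)%R)) with (Ci * (- (m * z))%R) by (rewrite RtoC_opp; ring).
    rewrite !cexp_Ci, cos_neg, sin_neg, RtoC_opp; field.
Qed.

Lemma RtoC_neq_0 (x : R) : x <> 0%R -> RtoC x <> 0.
Proof. intros H E; apply H; now apply (f_equal fst) in E. Qed.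

(** A summand of c has order zero, so it enters the identity without derivatives of the kernel; the
    exceptional summand of the third family can thus be treated alone. *)
Lemma kernel_identity_plus (b c e k : R -> C) :
  kernel_identity b c k ->
  (forall x y, intI x -> intI y -> e x * k (x - y)%R = e y * Cconj (k (x - y)%R)) ->
  kernel_identity b (fun t => c t + e t) k.
Proof.
  intros H He x y Hx Hy; specialize (H x y Hx Hy); specialize (He x y Hx Hy).
  rewrite !Cmult_plus_distr_r, He, !Cplus_assoc, H; ring.
Qed.

(* The left-hand side is, up to sign, the imaginary part of the numerator of the kernel
   times [exp (- i (pi/4 + s m) z)] in the special case in which [c] has an extra summand. *)
Lemma trig_special (m s z : R) : (s = 1 \/ s = -1)%R ->
  let m2 := (m + s * PI / 2)%R in
  let a := (sin_over m2 2 * sin_over m z)%R in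
  let b := (sin_over m 2 * sin_over m2 z)%R in
  (a * sin (2 * (PI / 4 * z) + s * m * z) + b * sin (s * m * z) = 0)%R.
Proof.
  intros Hs m2 a b.
  assert (E1 : (sin (2 * (PI / 4 * z) + s * m * z) = s * sin (m2 * z))%R).
  { unfold m2; destruct Hs as [-> | ->].
    - rewrite !Rmult_1_l; f_equal; field.
    - replace (-1 * sin ((m + -1 * PI / 2) * z))%R
        with (- sin ((m + -1 * PI / 2) * z))%R by ring.
      rewrite <- sin_neg; f_equal; field. }
  assert (E2 : (sin (s * m * z) = s * sin (m * z))%R).
  { destruct Hs as [-> | ->].
    - now rewrite !Rmult_1_l.
    - replace (-1 * m * z)%R with (- (m * z))%R by ring. rewrite sin_neg; ring. }
  (* The shift of the parameter by s pi/2 becomes a half period at z = 2; this makes sin(2 m2) +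
     sin(2 m) vanish and singles out the special case. *)
  assert (E3 : (sin (m2 * 2) = - sin (m * 2))%R).
  { unfold m2; destruct Hs as [-> | ->].
    - replace ((m + 1 * PI / 2) * 2)%R with (m * 2 + PI)%R by field. apply neg_sin.
    - replace ((m + -1 * PI / 2) * 2)%R with (- (- (m * 2) + PI))%R by field.
      rewrite sin_neg, neg_sin, sin_neg; ring. }
  rewrite E1, E2; unfold a, b; rewrite <- !mu_sin_over.
  rewrite <- !mu_sin_over in E3.
  transitivity (s * sin_over m z * sin_over m2 z
    * (m2 * sin_over m2 2 + m * sin_over m 2))%R; [ring|].
  rewrite E3; ring.
Qed.

(** Since sin(pi z/2) = 2 [sn] [cs], the kernel is U/(2 [sn]) + V/(2 [cs]) with U real and V
    imaginary. So P = k + conj k and M = k - conj k satisfy the separate equations [sn] P = U and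
    [cs] M = V, whose second derivatives are known. With b evaluated by addition formulas around
    pi(x+y)/4, the identity splits into a coefficient of the sine and one of the cosine of that
    angle, and each follows from these two equations. *)
Lemma trig_good (k0 b c k : R -> C) : family_trig k0 b c -> CC 2 k ->
  (forall z, (-2 < z < 2)%R -> z <> 0%R -> k z = k0 z) -> Cconj (k 0%R) = k 0%R ->
  good_operator b c k.
Proof.
  intros (mu1 & mu2 & Hmu1 & Hmu2 & Hk0 & Hb & e & He & Hc) Hk Hkk0 Hreal.
  assert (HDb : forall y, Derive b_trig y = (PI / 2 * sin (PI / 2 * y))%R).
  { intros y; apply is_derive_unique; unfold b_trig; auto_derive; [trivial|].
    replace (PI * y * / 2)%R with (PI / 2 * y)%R by field; field. }
  pose (c1 := Ci * (mu2 * mu2 - mu1 * mu1) / PI).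
  pose (c2 := RtoC PI * PI / 16 + (mu1 * mu1 + mu2 * mu2) / 2).
  assert (Hbc : b = fun y : R => - RtoC (cos (PI / 2 * y))).
  { apply functional_extensionality; intros y; rewrite Hb; unfold b_trig.
    rewrite RtoC_opp; do 3 f_equal; field. }
  pose (b1 := fun y : R => RtoC (PI / 2) * sin (PI / 2 * y)).
  pose (c' := fun y : R => c1 * b1 y + c2 * cos (PI / 2 * y)).
  assert (Hcc : c = fun y : R => c' y + e y).
  { apply functional_extensionality; intros y; rewrite Hc, HDb; unfold b_trig, c', c1, c2, b1.
    replace (PI * y / 2)%R with (PI / 2 * y)%R by field.
    rewrite RtoC_opp, RtoC_mult; simpl; field. apply RtoC_neq_0, PI_neq0. }
  subst b c; clear Hb Hc.
  assert (Hb1 : cder (fun y : R => - RtoC (cos (PI / 2 * y))) b1).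
  { eapply cder_eq; [apply cder_opp, cder_cos|].
    intros x; unfold b1; rewrite RtoC_opp, RtoC_mult; ring. }
  destruct (trig_smooth (PI / 2)) as [Hsin Hcos].
  assert (Hes : Csmooth e).
  { destruct He as [He|(m & s & beta & _ & _ & _ & He)];
      (eapply smooth_eq; [|exact He]); intros n; [apply CC_const|].
    apply CC_scal, cexp_smooth. }
  pose (A := sinh_over mu2 2); pose (B := sinh_over mu1 2).
  pose (S1 := sinh_over mu1); pose (S2 := sinh_over mu2).
  pose (sn := fun z : R => sin (PI / 4 * z)); pose (cs := fun z : R => cos (PI / 4 * z)).
  assert (Hcs : forall z, (-2 < z < 2)%R -> cs z <> 0%R).
  { intros z Hz; unfold cs; pose proof PI_RGT_0.
    apply Rgt_not_eq, cos_gt_0; nra. }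
  assert (Hsn : forall z, (-2 < z < 2)%R -> z <> 0%R -> sn z <> 0%R).
  { intros z Hz Hz0; unfold sn; pose proof PI_RGT_0.
    destruct (Rtotal_order z 0) as [Hl|[Hl|Hl]]; [|contradiction|].
    - apply Rlt_not_eq, sin_lt_0_var; nra.
    - apply Rgt_not_eq, sin_gt_0; nra. }
  assert (HS1r : forall z, Cconj (S1 z) = S1 z) by (intros; now apply sinh_over_real).
  assert (HS2r : forall z, Cconj (S2 z) = S2 z) by (intros; now apply sinh_over_real).
  assert (HAr : Cconj A = A) by apply (HS2r 2%R).
  assert (HBr : Cconj B = B) by apply (HS1r 2%R).
  (* Expanding the exponentials e^{-i pi z/4} and e^{i pi z/4} turns the numerator of the kernel
     into [cs] U + [sn] V. *)
  pose (U := fun z => A * S1 z + B * S2 z); pose (V := fun z => Ci * (B * S2 z - A * S1 z)).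
  assert (HN : forall z, (-2 < z < 2)%R -> z <> 0%R ->
            2 * (RtoC (sn z) * cs z) * k z = cs z * U z + sn z * V z).
  { intros z Hz Hz0; rewrite Hkk0 by assumption.
    assert (Hs2 : sin (PI * z / 2) = (2 * sn z * cs z)%R).
    { unfold sn, cs; rewrite <- sin_2a; f_equal; field. }
    assert (sin (PI * z / 2) <> 0)%R as Hnz.
    { rewrite Hs2; apply Rmult_integral_contrapositive_currified; [|now apply Hcs].
      apply Rmult_integral_contrapositive_currified; [lra | now apply Hsn]. }
    rewrite Hk0 by (try assumption; unfold in2I; lra).
    replace (- Ci * PI * z / 4) with (Ci * RtoC (- (PI / 4 * z)))
      by (rewrite RtoC_opp, RtoC_mult, RtoC_div by lra; field).
    replace (Ci * PI * z / 4) with (Ci * RtoC (PI / 4 * z))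
      by (rewrite RtoC_mult, RtoC_div by lra; field).
    rewrite !cexp_Ci, cos_neg, sin_neg, RtoC_opp.
    fold (sn z) (cs z) A B (S1 z) (S2 z).
    apply RtoC_neq_0 in Hnz; rewrite Hs2, !RtoC_mult in Hnz |- *.
    unfold U, V; field. repeat split; intros E0; apply Hnz; rewrite E0; ring. }
  assert (HNc : forall z, (-2 < z < 2)%R -> z <> 0%R ->
            2 * (RtoC (sn z) * cs z) * Cconj (k z) = cs z * U z - sn z * V z).
  { intros z Hz Hz0; pose proof (f_equal Cconj (HN z Hz Hz0)) as E; unfold U, V in *.
    rewrite !Cplus_conj, !Cmult_conj, !Cplus_conj, !Cminus_conj, !Cmult_conj, !Cconj_R,
      HAr, HBr, HS1r, HS2r in E.
    rewrite E; replace (Cconj Ci) with (- Ci) by creal; ring. }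
  pose (P := fun z => k z + cconj k z); pose (M := fun z => k z - cconj k z).
  assert (HP : forall z, (-2 < z < 2)%R -> RtoC (sn z) * P z = U z).
  { intros z Hz; destruct (Req_dec z 0) as [->|Hz0].
    - unfold sn, U, S1, S2; rewrite Rmult_0_r, sin_0, !sinh_over_0; ring.
    - apply Cmult_cancel with (2 * RtoC (cs z)).
      + apply Cmult_neq_0; [apply C2_neq_0 | apply RtoC_neq_0; auto].
      + unfold P, cconj.
        transitivity (2 * (RtoC (sn z) * cs z) * k z + 2 * (RtoC (sn z) * cs z) * Cconj (k z));
          [ring|]. rewrite HN, HNc by assumption; ring. }
  (* At z = 0 the right side vanishes, and the left one does because k(0) is real; the formula for
     the kernel gives no information there. *)
  assert (HM : forall z, (-2 < z < 2)%R -> RtoC (cs z) * M z = V z).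
  { intros z Hz; destruct (Req_dec z 0) as [->|Hz0].
    - unfold M, V, S1, S2, cconj; rewrite !sinh_over_0, Hreal; ring.
    - apply Cmult_cancel with (2 * RtoC (sn z)).
      + apply Cmult_neq_0; [apply C2_neq_0 | apply RtoC_neq_0; auto].
      + unfold M, cconj.
        transitivity (2 * (RtoC (sn z) * cs z) * k z - 2 * (RtoC (sn z) * cs z) * Cconj (k z));
          [ring|]. rewrite HN, HNc by assumption; ring. }
  pose proof (CC_cder _ _ Hk) as Hk1; pose proof (CC_cder _ _ (CC_cDerive _ _ Hk)) as Hk2.
  repeat split.
  - intros n; apply CC_opp, Hcos.
  - intros n; apply CC_plus; [|apply Hes]. apply CC_plus; [|now apply CC_scal].
    now apply CC_scal, CC_scal.
  - replace (PI / 2 * -1)%R with (- (PI / 2))%R by ring. rewrite cos_neg, cos_PI2; ring.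
  - rewrite Rmult_1_r, cos_PI2; ring.
  - apply kernel_identity_plus.
    + intros x y Hx Hy; pose proof (intI_sub x y Hx Hy) as Hz.
      rewrite (cder_unique _ _ Hb1).
      pose proof (cder_conj _ _ Hk1) as Hk1c; pose proof (cder_conj _ _ Hk2) as Hk2c.
      pose proof (cder_plus _ _ _ _ Hk1 Hk1c) as HP1; pose proof (cder_plus _ _ _ _ Hk2 Hk2c) as HP2.
      pose proof (cder_minus _ _ _ _ Hk1 Hk1c) as HM1; pose proof (cder_minus _ _ _ _ Hk2 Hk2c) as HM2.
      assert (Hsn2 : cder (fun z : R => RtoC (PI / 4 * cos (PI / 4 * z)))
                (fun z : R => RtoC (- (PI / 4 * (PI / 4 * sin (PI / 4 * z))))))
        by (apply cder_RtoC; intros t; auto_derive; [trivial | field]).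
      assert (Hcs2 : cder (fun z : R => RtoC (- (PI / 4 * sin (PI / 4 * z))))
                (fun z : R => RtoC (- (PI / 4 * (PI / 4 * cos (PI / 4 * z))))))
        by (apply cder_RtoC; intros t; auto_derive; [trivial | field]).
      pose proof (D2_mult _ _ _ P _ _ (x - y)%R (cder_sin (PI / 4)) Hsn2 HP1 HP2) as HDP.
      pose proof (D2_mult _ _ _ M _ _ (x - y)%R (cder_cos (PI / 4)) Hcs2 HM1 HM2) as HDM.
      cbv beta in HDP, HDM.
      match type of HDP with _ = ?r =>
        change (D (D (fun t : R => RtoC (sn t) * P t)) (x - y)%R = r) in HDP end.
      match type of HDM with _ = ?r =>
        change (D (D (fun t : R => RtoC (cs t) * M t)) (x - y)%R = r) in HDM end.
      rewrite (proj2 (cDerive2_eq _ _ _ _ _ HP Hz)) in HDP.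
      rewrite (proj2 (cDerive2_eq _ _ _ _ _ HM Hz)) in HDM.
      assert (HU : D (D U) (x - y)%R
                = A * (mu1 * mu1 * S1 (x - y)%R) + B * (mu2 * mu2 * S2 (x - y)%R)).
      { unfold U, S1, S2.
        rewrite (cder_unique _ _ (cder_plus _ _ _ _ (cder_scal A _ _ (sinh_over_cder mu1))
                   (cder_scal B _ _ (sinh_over_cder mu2)))).
        now rewrite (cder_unique _ _ (cder_plus _ _ _ _ (cder_scal A _ _ (ccosh_cder mu1))
                   (cder_scal B _ _ (ccosh_cder mu2)))). }
      assert (HV : D (D V) (x - y)%R
                = Ci * (B * (mu2 * mu2 * S2 (x - y)%R) - A * (mu1 * mu1 * S1 (x - y)%R))).
      { unfold V, S1, S2.
        rewrite (cder_unique _ _ (cder_scal Ci _ _ (cder_minus _ _ _ _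
                   (cder_scal B _ _ (sinh_over_cder mu2)) (cder_scal A _ _ (sinh_over_cder mu1))))).
        now rewrite (cder_unique _ _ (cder_scal Ci _ _ (cder_minus _ _ _ _
                   (cder_scal B _ _ (ccosh_cder mu2)) (cder_scal A _ _ (ccosh_cder mu1))))). }
      rewrite HU in HDP; rewrite HV in HDM; clear HU HV.
      pose proof (HP _ Hz) as HPz; pose proof (HM _ Hz) as HMz.
      unfold c', b1.
      (* Half the sum of the arguments pi x/2 and pi y/2 of b; their half difference is the argument
         pi z/4 of [sn] and [cs]. *)
      set (th := (PI / 4 * (x + y))%R).
      replace (PI / 2 * x)%R with (th + PI / 4 * (x - y))%R by (unfold th; field).
      replace (PI / 2 * y)%R with (th - PI / 4 * (x - y))%R by (unfold th; field).
      set (z := (x - y)%R) in *.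
      rewrite cos_plus, sin_plus, cos_minus, sin_minus.
      fold (sn z) (cs z).
      unfold U, V, P, M, cconj in HDP, HDM, HPz, HMz.
      set (k2 := D (D k) z) in *; set (k1 := D k z) in *; set (k_ := k z) in *.
      set (l2 := Cconj k2) in *; set (l1 := Cconj k1) in *; set (l_ := Cconj k_) in *.
      repeat rewrite RtoC_opp in HDP; repeat rewrite RtoC_opp in HDM;
      repeat rewrite RtoC_mult in HDP; repeat rewrite RtoC_mult in HDM.
      rewrite !RtoC_plus, !RtoC_minus, !RtoC_mult.
      fold (sn z) (cs z) in HDP, HDM.
      set (ct := RtoC (cos th)); set (st := RtoC (sin th)).
      set (f := RtoC (sn z)) in *; set (g := RtoC (cs z)) in *.
      set (s1 := S1 z) in *; set (s2 := S2 z) in *.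
      rewrite !RtoC_div in * by lra.
      clearbody k2 k1 k_ l2 l1 l_ ct st f g s1 s2.
      assert (Hc1 : forall v, c1 * (RtoC PI / 2) * (Ci * v)
                = (mu1 * mu1 - mu2 * mu2) / 2 * v).
      { intros v; unfold c1.
        transitivity ((mu2 * mu2 - mu1 * mu1) / 2 * v * (Ci * Ci)).
        - field; apply RtoC_neq_0, PI_neq0.
        - replace (Ci * Ci) with (- (1)) by creal; field. }
      assert (Hc1' : c1 * (RtoC PI / 2) = Ci * ((mu2 * mu2 - mu1 * mu1) / 2))
        by (unfold c1; field; apply RtoC_neq_0, PI_neq0).
      (* In U'' and V'' the two terms carry mu1^2 and mu2^2. The constant [c2] removes their mean,
         together with the pi^2/16 from differentiating [sn] twice; [c1] couples P to M and removes
         the half difference. *)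
      assert (HX : f * (k2 + l2) + RtoC PI / 2 * g * (k1 + l1) - c2 * (f * (k_ + l_))
                   + c1 * (RtoC PI / 2) * (g * (k_ - l_)) = 0).
      { rewrite HMz, Hc1.
        transitivity (- (RtoC PI / 4 * (RtoC PI / 4 * f)) * (k_ + l_)
          + 2 * (RtoC PI / 4 * g * (k1 + l1)) + f * (k2 + l2)
          + (RtoC PI / 4 * (RtoC PI / 4) - c2) * (f * (k_ + l_))
          + (mu1 * mu1 - mu2 * mu2) / 2 * (B * s2 - A * s1)); [field|].
        rewrite <- HDP, HPz; unfold c2; field. }
      assert (HY : - (g * (k2 - l2)) + RtoC PI / 2 * f * (k1 - l1) + c2 * (g * (k_ - l_))
                   + c1 * (RtoC PI / 2) * (f * (k_ + l_)) = 0).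
      { rewrite HPz, Hc1'.
        transitivity (- (- (RtoC PI / 4 * (RtoC PI / 4 * g)) * (k_ - l_)
          + 2 * (- (RtoC PI / 4 * f) * (k1 - l1)) + g * (k2 - l2))
          - (RtoC PI / 4 * (RtoC PI / 4) - c2) * (g * (k_ - l_))
          + Ci * ((mu2 * mu2 - mu1 * mu1) / 2) * (A * s1 + B * s2)); [field|].
        rewrite <- HDM, HMz; unfold c2; field. }
      apply Ceq_minus.
      match type of HX with ?X = _ => match type of HY with ?Y = _ =>
        transitivity (st * X + ct * Y); [field | rewrite HX, HY; ring] end end.
    + intros x y Hx Hy; pose proof (intI_sub x y Hx Hy) as Hz.
      destruct He as [He|(m & s & beta & Hs & Hm1 & Hm2 & He)]; [rewrite !He; ring|].
      destruct (Req_dec (x - y) 0) as [E|Hz0].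
      { rewrite E, Hreal; replace y with x by lra; reflexivity. }
      assert (Hm2' : mu2 = Ci * RtoC (m + s * PI / 2))
        by (rewrite Hm2, RtoC_plus, RtoC_div, RtoC_mult by lra; reflexivity).
      (* Both e(x) and e(y) contain the factor e^{-i om (x+y)}. Dropping it, the claim is that e^{-i
         om z} k(z) is real, and [trig_special] says that the imaginary part of its numerator
         vanishes. *)
      pose (om := (PI / 4 + s * m)%R).
      assert (He' : forall t, e t = beta * cexp (Ci * (- (2 * om * t))%R)).
      { intros t; rewrite He; do 2 f_equal; unfold om.
        rewrite RtoC_opp, !RtoC_mult, RtoC_plus, RtoC_mult, RtoC_div by lra; ring. }
      rewrite !He'.
      replace (- (2 * om * x))%R with (- (om * (x + y)) + - (om * (x - y)))%R by ring.
      replace (- (2 * om * y))%R with (- (om * (x + y)) + (om * (x - y)))%R by ring.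
      rewrite !RtoC_plus, !Cmult_plus_distr_l, !cexp_plus, !cexp_Ci.
      set (z := (x - y)%R) in *.
      repeat rewrite cos_neg; repeat rewrite sin_neg; repeat rewrite RtoC_opp.
      apply Cmult_cancel with (2 * (RtoC (sn z) * cs z)).
      { repeat apply Cmult_neq_0; [apply C2_neq_0 | |]; apply RtoC_neq_0; auto. }
      match goal with |- ?q * (beta * (?r * ?w) * _) = _ * (beta * (_ * ?w') * _) =>
        transitivity (beta * r * (w * (q * k z)));
        [ring | transitivity (beta * r * (w' * (q * Cconj (k z)))); [|ring]] end.
      rewrite HN, HNc by assumption; f_equal.
      unfold U, V, A, B, S1, S2; rewrite Hm1, Hm2', !sinh_over_Ci.
      pose proof (trig_special m s z Hs) as HT; cbv zeta in HT.
      replace (2 * (PI / 4 * z) + s * m * z)%R with (om * z + PI / 4 * z)%R in HT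
        by (unfold om; field).
      replace (s * m * z)%R with (om * z - PI / 4 * z)%R in HT by (unfold om; field).
      rewrite sin_plus, sin_minus in HT; fold (sn z) (cs z) in HT.
      set (a1 := (sin_over (m + s * PI / 2) 2 * sin_over m z)%R) in HT.
      set (a2 := (sin_over m 2 * sin_over (m + s * PI / 2) z)%R) in HT.
      rewrite <- !RtoC_mult; fold a1 a2.
      clearbody a1 a2.
      apply Ceq_minus.
      match type of HT with ?T = _ =>
        transitivity (- (2) * Ci * RtoC T); [|rewrite HT; ring] end.
      creal.
Qed.

(** * Hermitian forms *)

Definition comb (u : R -> C) (a : C) (v : R -> C) : R -> C := fun x => u x + a * v x.
Definition zf : R -> C := fun _ => 0.

Definition subspace (E : (R -> C) -> Prop) : Prop :=
  E zf /\ forall u a v, E u -> E v -> E (comb u a v).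

Definition hermitian (E : (R -> C) -> Prop) (H : (R -> C) -> (R -> C) -> C) : Prop :=
  (forall u a v w, E u -> E v -> E w -> H (comb u a v) w = H u w + a * H v w) /\
  (forall u v, E u -> E v -> H u v = Cconj (H v u)).

Definition psd (E : (R -> C) -> Prop) (H : (R -> C) -> (R -> C) -> C) : Prop :=
  forall u, E u -> (0 <= Re (H u u))%R.

Definition posdef (E : (R -> C) -> Prop) (H : (R -> C) -> (R -> C) -> C) : Prop :=
  psd E H /\ forall u, E u -> H u u = 0 -> u = zf.

Definition proj (H : (R -> C) -> (R -> C) -> C) (fs : list (R -> C)) (u : R -> C) : R -> C :=
  fold_right (fun f acc => comb acc (H u f) f) zf fs.

Definition orthonormal_for (H : (R -> C) -> (R -> C) -> C) (fs : list (R -> C)) : Prop :=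
  List.ForallOrdPairs (fun e f => H e f = 0) fs /\ List.Forall (fun e => H e e = 1) fs.

Lemma fext (u v : R -> C) : (forall x, u x = v x) -> u = v.
Proof. apply functional_extensionality. Qed.

(** Replaces dimension counting: with lengths bounded, a longest orthonormal list exists, and it
    must span because a nonzero residual would lengthen it. *)
Lemma exists_longest {T : Type} (P : list T -> Prop) (N : nat) :
  P [] -> (forall l, P l -> (length l <= N)%nat) ->
  exists l, P l /\ forall l', P l' -> (length l' <= length l)%nat.
Proof.
  intros H0; induction N as [|N IH]; intros HN.
  - exists []; split; [assumption|]; intros l Hl; apply HN, Hl.
  - destruct (classic (exists l, P l /\ length l = S N)) as [[l [Hl El]]|Hno].
    + exists l; split; [assumption|]; intros l' Hl'; rewrite El; now apply HN.
    + apply IH; intros l Hl; specialize (HN l Hl).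
      assert (length l <> S N) by (intros E; apply Hno; now exists l). lia.
Qed.

Section Form.
Variables (E : (R -> C) -> Prop) (H : (R -> C) -> (R -> C) -> C).
Hypothesis HE : subspace E.
Hypothesis HH : hermitian E H.

Lemma form_lin_r u v w a : E u -> E v -> E w ->
  H w (comb u a v) = H w u + Cconj a * H w v.
Proof.
  intros Hu Hv Hw; destruct HE as [_ Ec], HH as [Hl Hs].
  rewrite (Hs w), Hl by auto. rewrite Cplus_conj, Cmult_conj.
  now rewrite <- (Hs w u), <- (Hs w v) by assumption.
Qed.

Lemma form_zero w : E w -> H zf w = 0.
Proof.
  intros Hw; destruct HE as [E0 _], HH as [Hl _].
  assert (Ez : zf = comb zf (-1) zf) by (apply fext; intros x; unfold comb, zf; ring).
  rewrite Ez, Hl by assumption; ring.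
Qed.

Lemma form_real u : E u -> H u u = RtoC (Re (H u u)).
Proof.
  intros Hu; destruct HH as [_ Hs]; pose proof (Hs u u Hu Hu) as Hc.
  apply C_ext; simpl; [reflexivity|].
  apply (f_equal Im) in Hc; simpl in Hc; unfold Im in *; lra.
Qed.

Lemma form_comb u a v : E u -> E v ->
  H (comb u a v) (comb u a v)
  = H u u + a * Cconj (H u v) + Cconj a * H u v + a * Cconj a * H v v.
Proof.
  intros Hu Hv; destruct HE as [_ Ec]; destruct HH as [Hl Hs].
  rewrite Hl by auto; rewrite !form_lin_r by assumption.
  rewrite (Hs v u) by assumption; ring.
Qed.

(** Stated for semidefinite forms because it is later applied to a null vector, which it shows to be
    orthogonal to the whole space. The form is expanded at u - t H(u,v) v with real t. *)
Lemma cauchy_schwarz u v : psd E H -> E u -> E v ->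
  (Cmod (H u v) ^ 2 <= Re (H u u) * Re (H v v))%R.
Proof.
  intros Hp Hu Hv; pose proof (proj2 HE) as Ec.
  assert (Ht : forall t : R, (0 <= Re (H u u) - 2 * t * Cmod (H u v) ^ 2
                              + t ^ 2 * Cmod (H u v) ^ 2 * Re (H v v))%R).
  { intros t; pose proof (Hp _ (Ec u (- t * H u v) v Hu Hv)) as Hpos.
    rewrite form_comb in Hpos by assumption.
    rewrite (form_real u Hu), (form_real v Hv) in Hpos.
    match type of Hpos with (0 <= Re ?z)%R => replace z with
      (RtoC (Re (H u u) - 2 * t * Cmod (H u v) ^ 2
             + t ^ 2 * Cmod (H u v) ^ 2 * Re (H v v))) in Hpos end; [exact Hpos|].
    assert (Em : RtoC (Cmod (H u v) ^ 2) = H u v * Cconj (H u v)) by apply Cmod2_conj.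
    rewrite RtoC_plus, RtoC_minus, !RtoC_mult, Em, RtoC_pow; simpl Cpow.
    rewrite Cmult_conj, Copp_conj.
    replace (Cconj t) with (RtoC t) by creal. ring. }
  set (n := (Cmod (H u v) ^ 2)%R) in *; set (p := Re (H u u)) in *; set (q := Re (H v v)) in *.
  assert (Hn : (0 <= n)%R) by apply pow2_ge_0.
  assert (Hq : (0 <= q)%R) by (now apply Hp).
  destruct (Rle_lt_or_eq_dec 0 q Hq) as [Hq'|Hq'].
  - specialize (Ht (/ q)%R).
    replace (p - 2 * / q * n + (/ q) ^ 2 * n * q)%R with ((p * q - n) / q)%R in Ht by (field; lra).
    assert (0 <= (p * q - n) / q * q)%R by (apply Rmult_le_pos; lra).
    replace ((p * q - n) / q * q)%R with (p * q - n)%R in * by (field; lra). lra.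
  - rewrite <- Hq' in *. destruct (Rle_lt_or_eq_dec 0 n Hn) as [Hn'|Hn']; [|lra].
    (* If H(v,v) = 0 the polynomial p - 2 t n is affine in t; this t makes it equal to -p - 2, which
       is negative. *)
    specialize (Ht ((p + 1) / n)%R).
    replace (p - 2 * ((p + 1) / n) * n + ((p + 1) / n) ^ 2 * n * 0)%R
      with (- p - 2)%R in Ht by (field; lra).
    assert (0 <= p)%R by (now apply Hp). lra.
Qed.

Lemma proj_in fs u : List.Forall E fs -> E (proj H fs u).
Proof.
  destruct HE as [E0 Ec]; induction 1; simpl; [assumption|]; now apply Ec.
Qed.

Lemma form_proj_zero fs u w : List.Forall E fs -> E w ->
  (forall f, In f fs -> H f w = 0) -> H (proj H fs u) w = 0.
Proof.
  intros Hfs Hw; induction Hfs as [|f fs Hf Hfs IH]; intros Hz; simpl.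
  - now apply form_zero.
  - rewrite (proj1 HH) by (auto using proj_in).
    rewrite IH, Hz by (simpl in *; auto); ring.
Qed.

Lemma form_proj fs u f : List.Forall E fs -> orthonormal_for H fs -> In f fs ->
  H (proj H fs u) f = H u f.
Proof.
  intros Hfs; induction Hfs as [|g fs Hg Hfs IH]; intros [Ho Hn] Hin; [easy|].
  inversion Ho as [|? ? Hog Ho']; subst; inversion Hn as [|? ? Hng Hn']; subst.
  rewrite Forall_forall in Hog.
  assert (HfsE : forall h, In h fs -> E h) by now apply Forall_forall.
  simpl; destruct Hin as [->|Hin].
  - rewrite (proj1 HH) by (auto using proj_in). rewrite Hng.
    rewrite form_proj_zero; [ring | assumption | assumption |].
    intros h Hh; rewrite (proj2 HH), Hog by auto; creal.
  - rewrite (proj1 HH) by (auto using proj_in).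
    rewrite IH, (Hog f) by (try split; auto); ring.
Qed.

Definition residual fs u := comb u (-1) (proj H fs u).

Lemma residual_in fs u : List.Forall E fs -> E u -> E (residual fs u).
Proof. intros; apply HE; auto using proj_in. Qed.

Lemma residual_ortho fs u f : List.Forall E fs -> orthonormal_for H fs -> E u -> In f fs ->
  H (residual fs u) f = 0.
Proof.
  intros Hfs Ho Hu Hf. pose proof (proj1 (Forall_forall _ _) Hfs f Hf).
  unfold residual; rewrite (proj1 HH), form_proj by (auto using proj_in); ring.
Qed.

Lemma residual_zero fs u : residual fs u = zf -> u = proj H fs u.
Proof.
  intros Hr; apply fext; intros x; pose proof (equal_f Hr x) as Hx.
  unfold residual, comb, zf in Hx.
  replace (u x) with (u x + -1 * proj H fs u x + proj H fs u x) by ring; rewrite Hx; ring.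
Qed.

Lemma proj_comb fs u a v : List.Forall E fs -> E u -> E v ->
  proj H fs (comb u a v) = comb (proj H fs u) a (proj H fs v).
Proof.
  intros Hfs Hu Hv; induction Hfs as [|f fs Hf Hfs IH]; simpl.
  - apply fext; intros x; unfold comb, zf; ring.
  - rewrite IH, (proj1 HH) by assumption. apply fext; intros x; unfold comb; ring.
Qed.

Lemma proj_zf fs : List.Forall E fs -> proj H fs zf = zf.
Proof.
  induction 1 as [|f fs Hf Hfs IH]; simpl; [reflexivity|].
  rewrite IH, form_zero by assumption; apply fext; intros x; unfold comb, zf; ring.
Qed.

Definition normalize u := comb zf (RtoC (/ sqrt (Re (H u u)))) u.

Lemma normalize_in u : E u -> E (normalize u).
Proof. intros; apply HE; [apply HE | assumption]. Qed.

Lemma form_normalize u w : E u -> E w ->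
  H (normalize u) w = RtoC (/ sqrt (Re (H u u))) * H u w.
Proof.
  intros; unfold normalize; rewrite (proj1 HH), form_zero by (auto; apply HE); ring.
Qed.

Lemma form_normalize_r u w : E u -> E w ->
  H w (normalize u) = RtoC (/ sqrt (Re (H u u))) * H w u.
Proof.
  intros; rewrite (proj2 HH), form_normalize, Cmult_conj by (auto using normalize_in).
  rewrite <- (proj2 HH) by assumption; f_equal; creal.
Qed.

Lemma normalize_unit u : E u -> (0 < Re (H u u))%R -> H (normalize u) (normalize u) = 1.
Proof.
  intros Hu Hp; rewrite form_normalize, form_normalize_r by (auto using normalize_in).
  rewrite (form_real u Hu) at 3; rewrite <- !RtoC_mult; f_equal.
  rewrite <- (sqrt_sqrt (Re (H u u))) at 3 by lra.
  field. now apply Rgt_not_eq, sqrt_lt_R0.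
Qed.

Lemma posdef_pos u : posdef E H -> E u -> u <> zf -> (0 < Re (H u u))%R.
Proof.
  intros [Hp Hd] Hu Hz; destruct (Rle_lt_or_eq_dec _ _ (Hp u Hu)) as [|Hx]; [assumption|].
  contradict Hz; apply Hd; [assumption|]. now rewrite form_real, <- Hx.
Qed.

Lemma orthonormal_cons fs r : List.Forall E fs -> orthonormal_for H fs -> E r ->
  (0 < Re (H r r))%R -> (forall f, In f fs -> H r f = 0) ->
  orthonormal_for H (normalize r :: fs).
Proof.
  intros Hfs [Ho Hn] Hr Hp Hrf; split; constructor; try assumption.
  - apply Forall_forall; intros f Hf. pose proof (proj1 (Forall_forall _ _) Hfs f Hf).
    rewrite form_normalize, (Hrf f) by assumption; ring.
  - now apply normalize_unit.
Qed.

(** Being in the span is encoded as g = [proj] H fs g. This survives adding the normalised residual,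
    to which everything already spanned is orthogonal. *)
Lemma gram_schmidt gs : posdef E H -> List.Forall E gs ->
  exists fs, List.Forall E fs /\ orthonormal_for H fs /\ forall g, In g gs -> g = proj H fs g.
Proof.
  intros Hpd; induction 1 as [|g gs Hg Hgs IH].
  - exists []; repeat split; try constructor; easy.
  - destruct IH as (fs & Hfs & Ho & Hsp).
    destruct (classic (residual fs g = zf)) as [Hr|Hr].
    + exists fs; repeat split; try apply Ho; try assumption.
      intros h [<-|Hh]; [now apply residual_zero | now apply Hsp].
    + pose proof (residual_in fs g Hfs Hg) as HrE.
      set (r := residual fs g) in *.
      assert (Hrf : forall f, In f fs -> H r f = 0) by (intros; now apply residual_ortho).
      pose proof (posdef_pos r Hpd HrE Hr) as Hpos.
      assert (Hpr : forall u, H (proj H fs u) r = 0).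
      { intros u; apply form_proj_zero; try assumption; intros f Hf.
        pose proof (proj1 (Forall_forall _ _) Hfs f Hf).
        rewrite (proj2 HH), Hrf by assumption; creal. }
      exists (normalize r :: fs); split; [|split].
      * constructor; [now apply normalize_in | assumption].
      * now apply orthonormal_cons.
      * intros h [<-|Hh]; simpl.
        -- assert (Eg : g = comb (proj H fs g) 1 r).
           { apply fext; intros x; unfold r, residual, comb; ring. }
           assert (Hgr : H g r = H r r).
           { rewrite Eg at 1; rewrite (proj1 HH), Hpr by (auto using proj_in); ring. }
           rewrite form_normalize_r, Hgr by assumption.
           assert (Ec : RtoC (/ sqrt (Re (H r r))) * H r r * RtoC (/ sqrt (Re (H r r))) = 1).
           { rewrite (form_real r HrE) at 2; rewrite <- !RtoC_mult; f_equal.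
             rewrite <- (sqrt_sqrt (Re (H r r))) at 2 by lra.
             field; now apply Rgt_not_eq, sqrt_lt_R0. }
           rewrite Eg at 1; apply fext; intros x; unfold comb, normalize, zf, comb.
           f_equal; rewrite <- Ec at 1; ring.
        -- pose proof (proj1 (Forall_forall _ _) Hgs h Hh) as HhE.
           rewrite form_normalize_r by assumption.
           assert (Hhr : H h r = 0) by (rewrite (Hsp h Hh); apply Hpr).
           rewrite Hhr.
           rewrite (Hsp h Hh) at 1; apply fext; intros x; unfold comb; ring.
Qed.

Lemma orthonormal_basis (N : nat) : posdef E H ->
  (forall fs, List.Forall E fs -> orthonormal_for H fs -> (length fs <= N)%nat) ->
  exists fs, List.Forall E fs /\ orthonormal_for H fs /\ forall u, E u -> u = proj H fs u.
Proof.
  intros Hpd HN.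
  destruct (exists_longest (fun fs => List.Forall E fs /\ orthonormal_for H fs) N)
    as (fs & [Hfs Ho] & Hmax).
  - repeat split; constructor.
  - intros l [A B]; now apply HN.
  - exists fs; split; [assumption|]; split; [assumption|]; intros u Hu.
    apply residual_zero; apply NNPP; intros Hr.
    pose proof (residual_in fs u Hfs Hu) as HrE.
    pose proof (Hmax (normalize (residual fs u) :: fs)) as Hlen; simpl in Hlen.
    enough (S (length fs) <= length fs)%nat by lia. apply Hlen; split.
    + constructor; [now apply normalize_in | assumption].
    + apply orthonormal_cons; try assumption; [now apply posdef_pos|].
      intros f Hf; now apply residual_ortho.
Qed.

(** The residual is orthogonal to the projection, so its square is H(u,u) minus the sum of squared
    coefficients, and it is nonnegative. *)
Lemma bessel fs u : psd E H -> List.Forall E fs -> orthonormal_for H fs -> E u ->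
  (fold_right (fun f acc => acc + Cmod (H u f) ^ 2)%R 0%R fs <= Re (H u u))%R.
Proof.
  intros Hp Hfs Ho Hu.
  pose proof (residual_in fs u Hfs Hu) as HrE; pose proof (proj_in fs u Hfs) as HpE.
  assert (E1 : H (residual fs u) (proj H fs u) = 0).
  { rewrite (proj2 HH), form_proj_zero; try assumption; [creal|].
    intros f Hf. pose proof (proj1 (Forall_forall _ _) Hfs f Hf).
    rewrite (proj2 HH), residual_ortho by assumption; creal. }
  assert (E2 : H (proj H fs u) u = RtoC (fold_right (fun f acc => acc + Cmod (H u f) ^ 2)%R 0%R fs)).
  { clear - HE HH Hfs Hu; induction Hfs as [|f fs Hf Hfs IH]; simpl.
    - now apply form_zero.
    - rewrite (proj1 HH), IH by (auto using proj_in). rewrite RtoC_plus; f_equal.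
      rewrite (proj2 HH f u) by assumption. symmetry; apply (Cmod2_conj (H u f)). }
  pose proof (Hp _ HrE) as H0.
  unfold residual at 2 in H0; rewrite form_lin_r, E1 in H0 by assumption.
  unfold residual in H0; rewrite (proj1 HH), E2 in H0 by assumption.
  match type of H0 with context [fold_right ?f ?a ?l] => set (S := fold_right f a l) in * end.
  rewrite (form_real u Hu) in H0; simpl in H0; lra.
Qed.

End Form.

(** By Cauchy-Schwarz each coefficient H(u,f) against a unit vector f is at most sqrt(H(u,u)). On a
    spanned space any other form is thus controlled by H; this comparison stands in for equivalence
    of norms. *)
Lemma form_proj_bound (E : (R -> C) -> Prop) (H G : (R -> C) -> (R -> C) -> C) fs u w :
  subspace E -> hermitian E H -> hermitian E G -> psd E H ->
  List.Forall E fs -> orthonormal_for H fs -> E u -> E w ->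
  (Cmod (G (proj H fs u) w)
   <= sqrt (Re (H u u)) * fold_right (fun f acc => acc + Cmod (G f w)) 0 fs)%R.
Proof.
  intros HE HH HG Hp Hfs [_ Ho] Hu Hw; revert Ho.
  induction Hfs as [|f fs Hf Hfs IH]; intros Ho; simpl.
  - rewrite (form_zero E G) by assumption; rewrite Cmod_0; lra.
  - inversion Ho as [|? ? Hn Ho']; subst.
    rewrite (proj1 HG) by (try apply (proj_in E); assumption).
    eapply Rle_trans; [apply Cmod_triangle|]; rewrite Cmod_mult.
    rewrite Rmult_plus_distr_l; apply Rplus_le_compat; [now apply IH|].
    apply Rmult_le_compat_r; [apply Cmod_ge_0|].
    pose proof (cauchy_schwarz E H HE HH u f Hp Hu Hf) as Hcs.
    rewrite Hn in Hcs; simpl Re in Hcs; rewrite Rmult_1_r in Hcs.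
    rewrite <- (sqrt_pow2 (Cmod (H u f))) by apply Cmod_ge_0.
    now apply sqrt_le_1_alt.
Qed.

Lemma proj_spanned (E : (R -> C) -> Prop) (H G : (R -> C) -> (R -> C) -> C) fs gs u :
  subspace E -> hermitian E H -> List.Forall E fs -> List.Forall E gs ->
  (forall g, In g gs -> g = proj H fs g) -> proj G gs u = proj H fs (proj G gs u).
Proof.
  intros HE HH Hfs Hgs; induction Hgs as [|g gs Hg Hgs IH]; intros Hsp; simpl.
  - symmetry; now apply proj_zf with E.
  - rewrite (proj_comb E H) by (try assumption; now apply proj_in).
    rewrite <- IH, <- (Hsp g) by (simpl in *; auto); reflexivity.
Qed.

(* The supremum [M] of [B] on the [G]-unit sphere is attained, without any compactness:
   otherwise [M G - B] is positive definite, and expanding in a basis orthonormal for it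
   shows that it dominates a multiple of [G], so that [M] could be lowered. *)
Lemma exists_eigenvector (E : (R -> C) -> Prop) (G B : (R -> C) -> (R -> C) -> C) gs u0 :
  subspace E -> hermitian E G -> posdef E G -> hermitian E B ->
  List.Forall E gs -> orthonormal_for G gs -> (forall u, E u -> u = proj G gs u) ->
  E u0 -> u0 <> zf ->
  exists (e : R -> C) (nu : R), E e /\ G e e = 1 /\ forall w, E w -> B e w = nu * G e w.
Proof.
  intros HE HG Hpd HB Hgs Ho Hsp Hu0 Hnz.
  set (X := fun r : R => exists u, E u /\ G u u = 1 /\ r = Re (B u u)).
  set (bnd := fold_right (fun g acc => acc
                + fold_right (fun f acc => acc + Cmod (B f g)) 0 gs)%R 0%R gs).
  assert (Hbd : bound X).
  { exists bnd; intros r (u & Hu & Hun & ->).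
    eapply Rle_trans; [apply Rle_abs|]; eapply Rle_trans; [apply re_le_Cmod|].
    rewrite (Hsp u Hu) at 1.
    eapply Rle_trans; [now apply (form_proj_bound E G B gs u u); try apply Hpd|].
    rewrite Hun; simpl Re; rewrite sqrt_1, Rmult_1_l.
    unfold bnd. assert (Hsub : incl gs gs) by apply incl_refl. revert Hsub.
    (* Only the outer sum and the sum being estimated are inducted on; the inner sum keeps running
       over the full basis. *)
    generalize gs at 1 3 5 as l; induction l as [|g l IH]; intros Hsub; simpl; [lra|].
    assert (Hg : E g) by (apply (proj1 (Forall_forall _ _) Hgs), Hsub; now left).
    apply Rplus_le_compat; [apply IH; intros h Hh; apply Hsub; now right|].
    rewrite (proj2 HB), Cmod_conj by assumption. rewrite (Hsp u Hu) at 1.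
    eapply Rle_trans; [now apply (form_proj_bound E G B gs u g); try apply Hpd|].
    rewrite Hun; simpl Re; rewrite sqrt_1, Rmult_1_l; apply Rle_refl. }
  assert (Hne : exists r, X r).
  { exists (Re (B (normalize G u0) (normalize G u0))), (normalize G u0).
    split; [now apply normalize_in|]; split; [|reflexivity].
    apply (normalize_unit E); try assumption; now apply (posdef_pos E). }
  destruct (completeness X Hbd Hne) as [M [Hub Hlub]].
  (* M is the supremum on unit vectors, so Q is semidefinite by homogeneity; a nonzero null vector
     of Q is an eigenvector for M. *)
  set (Q := fun u v => RtoC M * G u v - B u v).
  assert (HQ : hermitian E Q).
  { split.
    - intros u a v w Hu Hv Hw; unfold Q; rewrite (proj1 HG), (proj1 HB) by assumption; ring.
    - intros u v Hu Hv; unfold Q; rewrite (proj2 HG u), (proj2 HB u) by assumption.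
      rewrite Cminus_conj, Cmult_conj; f_equal; f_equal; creal. }
  assert (HQp : psd E Q).
  { intros u Hu; destruct (classic (u = zf)) as [->|Hz].
    - rewrite (form_zero E Q) by assumption; simpl; lra.
    - pose proof (posdef_pos E G HG u Hpd Hu Hz) as Hpos.
      pose proof (normalize_in E G HE u Hu) as Hn.
      assert (HM : (Re (B (normalize G u) (normalize G u)) <= M)%R).
      { apply Hub; exists (normalize G u); split; [assumption|]; split; [|reflexivity].
        now apply (normalize_unit E). }
      assert (En : B (normalize G u) (normalize G u)
                = RtoC (/ sqrt (Re (G u u)) * / sqrt (Re (G u u)) * Re (B u u))).
      { unfold normalize at 1; rewrite (proj1 HB), (form_zero E B) by (try assumption; apply HE).
        rewrite (proj2 HB u) by assumption; unfold normalize at 1.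
        rewrite (proj1 HB), (form_zero E B) by (try assumption; apply HE).
        rewrite (form_real E B HB u Hu) at 1; creal. }
      rewrite En in HM; simpl Re in HM.
      rewrite <- Rinv_mult, sqrt_sqrt in HM by lra.
      unfold Q; rewrite (form_real E G HG u Hu), (form_real E B HB u Hu); simpl.
      apply Rmult_le_compat_l with (r := Re (G u u)) in HM; [|lra].
      replace (Re (G u u) * (/ Re (G u u) * Re (B u u)))%R with (Re (B u u)) in HM
        by (field; lra).
      lra. }
  destruct (classic (exists u, E u /\ u <> zf /\ Q u u = 0)) as [(u & Hu & Hz & Hq)|Hno].
  - pose proof (posdef_pos E G HG u Hpd Hu Hz) as Hpos.
    exists (normalize G u), M; split; [now apply normalize_in|].
    split; [now apply (normalize_unit E)|]. intros w Hw.
    pose proof (cauchy_schwarz E Q HE HQ u w HQp Hu Hw) as Hcs.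
    rewrite Hq in Hcs; simpl Re in Hcs; rewrite Rmult_0_l in Hcs.
    assert (Hq0 : Q u w = 0).
    { apply Cmod_eq_0. pose proof (Cmod_ge_0 (Q u w)). nra. }
    rewrite (form_normalize E G) by assumption.
    unfold normalize; rewrite (proj1 HB), (form_zero E B) by (try assumption; apply HE).
    unfold Q in Hq0.
    transitivity (RtoC (/ sqrt (Re (G u u))) * (RtoC M * G u w - (RtoC M * G u w - B u w)));
      [ring | rewrite Hq0; ring].
  - exfalso.
    assert (HQd : posdef E Q).
    { split; [assumption|]; intros u Hu Hq; apply NNPP; intros Hz; apply Hno; now exists u. }
    destruct (gram_schmidt E Q HE HQ gs HQd Hgs) as (fs & Hfs & Hfo & Hfsp).
    assert (HspQ : forall u, E u -> u = proj Q fs u).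
    { intros u Hu; rewrite (Hsp u Hu); now apply (proj_spanned E). }
    (* The comparison constant between Q and G: expanding a G-unit vector in the Q-orthonormal list
       gives Q(u,u) >= 1/S^2, so M - 1/S^2 would still be an upper bound. *)
    set (S := fold_right (fun f acc => acc + sqrt (Re (G f f)))%R 0%R fs).
    assert (HS : forall u, E u -> G u u = 1 -> (1 <= sqrt (Re (Q u u)) * S)%R).
    { intros u Hu Hun.
      replace 1%R with (Cmod (G (proj Q fs u) u))
        by (rewrite <- (HspQ u Hu), Hun; apply Cmod_1).
      eapply Rle_trans; [now apply (form_proj_bound E Q G fs u u)|].
      apply Rmult_le_compat_l; [apply sqrt_pos|].
      unfold S; clear - Hfs HE HG Hpd Hu Hun.
      induction Hfs as [|f fs Hf Hfs IH]; simpl; [lra|].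
      apply Rplus_le_compat; [assumption|].
      pose proof (cauchy_schwarz E G HE HG f u (proj1 Hpd) Hf Hu) as Hcs.
      rewrite Hun in Hcs; simpl Re in Hcs; rewrite Rmult_1_r in Hcs.
      rewrite <- (sqrt_pow2 (Cmod (G f u))) by apply Cmod_ge_0.
      now apply sqrt_le_1_alt. }
    assert (HSp : (0 < S)%R).
    { destruct Hne as (r & u & Hu & Hun & _); pose proof (HS u Hu Hun) as H1.
      pose proof (sqrt_pos (Re (Q u u))). nra. }
    assert (HM' : is_upper_bound X (M - / S ^ 2)%R).
    { intros r (u & Hu & Hun & ->). pose proof (HS u Hu Hun) as H1.
      assert (EQ : Re (Q u u) = (M - Re (B u u))%R).
      { unfold Q; rewrite Hun, (form_real E B HB u Hu); simpl; ring. }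
      rewrite <- EQ in H1 || rewrite EQ in H1.
      pose proof (HQp u Hu) as H2; rewrite EQ in H2.
      set (q := (M - Re (B u u))%R) in *.
      assert (H3 : (1 <= q * S ^ 2)%R).
      { rewrite <- (sqrt_sqrt q H2). pose proof (sqrt_pos q). nra. }
      assert (H4 : (/ S ^ 2 <= q)%R).
      { apply Rmult_le_reg_r with (S ^ 2)%R; [nra|]. rewrite Rinv_l by nra. assumption. }
      unfold q in H4; lra. }
    specialize (Hlub _ HM'). assert (0 < / S ^ 2)%R by (apply Rinv_0_lt_compat; nra). lra.
Qed.

(** Take a longest orthonormal list of eigenvectors. If it does not span, its orthogonal complement
    contains a nonzero residual, hence an eigenvector of B restricted to the complement, and this
    one lengthens the list. *)
Theorem hermitian_diagonalization (E : (R -> C) -> Prop) (G B : (R -> C) -> (R -> C) -> C) N :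
  subspace E -> hermitian E G -> posdef E G -> hermitian E B ->
  (forall fs, List.Forall E fs -> orthonormal_for G fs -> (length fs <= N)%nat) ->
  exists es, List.Forall E es /\ orthonormal_for G es /\
    (forall e, In e es -> exists nu : R, forall w, E w -> B e w = nu * G e w) /\
    forall u, E u -> u = proj G es u.
Proof.
  intros HE HG Hpd HB HN.
  set (P := fun es => List.Forall E es /\ orthonormal_for G es /\
    (forall e, In e es -> exists nu : R, forall w, E w -> B e w = nu * G e w)).
  destruct (exists_longest P N) as (es & (Hes & Ho & Hev) & Hmax).
  - repeat split; try constructor; easy.
  - intros l (A & A' & _); now apply HN.
  - exists es; repeat (split; [assumption|]); intros u Hu.
    apply (residual_zero G); apply NNPP; intros Hr.
    pose proof (residual_in E G HE es u Hes Hu) as HrE.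
    set (E' := fun w => E w /\ forall e, In e es -> G w e = 0).
    assert (HE' : subspace E').
    { split.
      - split; [apply HE|]; intros e He.
        apply (form_zero E); try assumption; now apply (proj1 (Forall_forall _ _) Hes).
      - intros w a v [Hw Hw'] [Hv Hv']; split; [now apply HE|]; intros e He.
        rewrite (proj1 HG), Hw', Hv' by (try assumption; now apply (proj1 (Forall_forall _ _) Hes)).
        ring. }
    assert (HG' : hermitian E' G) by (split; intros; apply HG; (apply H || apply H0 || apply H1)).
    assert (HB' : hermitian E' B) by (split; intros; apply HB; (apply H || apply H0 || apply H1)).
    assert (Hpd' : posdef E' G) by (split; [intros w [Hw _] | intros w [Hw _]]; now apply Hpd).
    assert (Hsub : forall l, List.Forall E' l -> List.Forall E l)
      by (intros l; apply Forall_impl; now intros w [Hw _]).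
    destruct (orthonormal_basis E' G HE' HG' N Hpd') as (gs & Hgs & Hgo & Hgsp).
    { intros fs Hfs; apply HN; now apply Hsub. }
    destruct (exists_eigenvector E' G B gs (residual G es u)) as (e & nu & [He He'] & Hn & Hnu);
      try assumption.
    { split; [assumption|]; intros f Hf; now apply (residual_ortho E). }
    assert (Hlen : (length (e :: es) <= length es)%nat); [|simpl in Hlen; lia].
    apply Hmax; split; [now constructor|]; split; [split; constructor; try apply Ho; try assumption|].
    + now apply Forall_forall.
    + intros f [<-|Hf]; [|now apply Hev]. exists nu; intros w Hw.
      pose proof (residual_in E G HE es w Hes Hw) as HwE.
      assert (Ew : w = comb (proj G es w) 1 (residual G es w))
        by (apply fext; intros x; unfold residual, comb; ring).
      pose proof (proj_in E G HE es w Hes) as Hpw.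
      (* The new vector e is so far an eigenvector only against the complement. Against an old
         eigenvector f, B(e,f) is the conjugate of a multiple of G(f,e), which is 0, so the equation
         extends to all of E. *)
      assert (Hz : forall l, incl l es -> B e (proj G l w) = 0 /\ G e (proj G l w) = 0).
      { induction l as [|f l IH]; intros Hl; simpl.
        - rewrite (proj2 HB), (proj2 HG), !(form_zero E) by (try assumption; apply HE).
          split; creal.
        - assert (Hf : In f es) by (apply Hl; now left).
          assert (HfE : E f) by (now apply (proj1 (Forall_forall _ _) Hes)).
          assert (Hl' : incl l es) by (intros h Hh; apply Hl; now right).
          assert (List.Forall E l)
            by (apply Forall_forall; intros h Hh; apply (proj1 (Forall_forall _ _) Hes); auto).
          destruct (IH Hl') as [A1 A2], (Hev f Hf) as [nf Hnf].
          pose proof (proj_in E G HE l w H).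
          assert (Hef : G e f = 0) by now apply He'.
          assert (Hbf : B e f = 0).
          { rewrite (proj2 HB), Hnf by assumption.
            rewrite (proj2 HG f e), Hef by assumption; creal. }
          rewrite !(form_lin_r E), A1, A2, Hef, Hbf by assumption.
          split; ring. }
      destruct (Hz es (incl_refl es)) as [Z1 Z2].
      rewrite Ew; rewrite !(form_lin_r E), Z1, Z2 by assumption.
      rewrite Hnu; [ring|].
      split; [assumption|]; intros f Hf; now apply (residual_ortho E).
Qed.

(** * The kernels of the list *)

Lemma good_of_family (k0 b c k : R -> C) :
  family_hyp k0 b c \/ family_sinc k0 b c \/ family_trig k0 b c -> CC 2 k ->
  (forall z, (-2 < z < 2)%R -> z <> 0%R -> k z = k0 z) -> Cconj (k 0%R) = k 0%R ->
  good_operator b c k.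
Proof.
  intros [H|[H|H]]; [eapply hyp_good | eapply sinc_good | eapply trig_good]; eassumption.
Qed.

(** As tau is imaginary, conj e^{tau z} = e^{-tau z}. Hence e^{-2 tau x} e^{tau(x-y)} on the left
    and e^{-2 tau y} e^{-tau(x-y)} on the right are both e^{-tau(x+y)}, and the new identity is the
    old one times kappa r e^{-tau(x+y)}. *)
Lemma gauge_good (k b c : R -> C) (r t : R) (kappa : C) :
  let tau := Ci * t in
  CC 2 k -> good_operator b c k ->
  good_operator (fun y : R => kappa * (cexp (- 2 * tau * y) * b y))
    (fun y : R => kappa * (cexp (- 2 * tau * y) * (c y - tau * D b y + tau ^ 2 * b y)))
    (fun z : R => r * k z * cexp (tau * z)).
Proof.
  intros tau Hk (Hb & Hc & Hbm & Hbp & Hid).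
  assert (Hbd : cder b (D b)) by (apply (CC_cder 0), Hb).
  assert (HE : Csmooth (fun y : R => cexp (- 2 * tau * y))) by apply cexp_smooth.
  repeat split.
  - intros n; apply CC_scal, CC_mult; [apply HE | apply Hb].
  - intros n; apply CC_scal, CC_mult; [apply HE|].
    apply CC_plus; [apply CC_minus; [apply Hc|] | apply CC_scal, Hb].
    apply CC_scal, CC_cDerive, Hb.
  - rewrite Hbm; ring.
  - rewrite Hbp; ring.
  - intros x y Hx Hy; specialize (Hid x y Hx Hy).
    pose proof (cexp_cder tau) as He; pose proof (cder_scal tau _ _ He) as He'.
    pose proof (CC_cder _ _ Hk) as Hk1; pose proof (CC_cder _ _ (CC_cDerive _ _ Hk)) as Hk2.
    assert (HK1 : cder (fun z : R => r * k z * cexp (tau * z))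
                    (fun z : R => r * (D k z + tau * k z) * cexp (tau * z))).
    { eapply cder_eq; [apply cder_mult; [apply cder_scal, Hk1 | exact He]|].
      intros z; simpl; ring. }
    assert (HK2 : cder (fun z : R => r * (D k z + tau * k z) * cexp (tau * z))
              (fun z : R => r * (D (D k) z + 2 * tau * D k z + tau * tau * k z) * cexp (tau * z))).
    { eapply cder_eq; [apply cder_mult; [apply cder_scal, cder_plus;
        [exact Hk2 | apply cder_scal, Hk1] | exact He]|].
      intros z; simpl; ring. }
    assert (HB : cder (fun y : R => kappa * (cexp (- 2 * tau * y) * b y))
              (fun y : R => kappa * (cexp (- 2 * tau * y) * (D b y - 2 * tau * b y)))).
    { eapply cder_eq; [apply cder_scal, cder_mult; [apply cexp_cder | exact Hbd]|].
      intros z; simpl; ring. }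
    rewrite (cder_unique _ _ HK1), (cder_unique _ _ HK2), (cder_unique _ _ HB).
    assert (E2 : forall w : R, cexp (- 2 * tau * w) = cexp (- tau * w) * cexp (- tau * w))
      by (intros w; rewrite <- cexp_plus; f_equal; ring).
    assert (Ez : cexp (tau * (x - y)%R) = cexp (tau * x) * cexp (- tau * y))
      by (rewrite <- cexp_plus; f_equal; rewrite RtoC_minus; ring).
    assert (Ezc : Cconj (cexp (tau * (x - y)%R)) = cexp (- tau * x) * cexp (tau * y)).
    { rewrite <- cexp_plus, cexp_conj; f_equal; unfold tau; rewrite RtoC_minus; creal. }
    assert (Einv : forall w : R, cexp (- tau * w) * cexp (tau * w) = 1).
    { intros w; rewrite <- cexp_plus, <- cexp_0; f_equal; ring. }
    assert (Etau : Cconj tau = - tau) by (unfold tau; creal).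
    rewrite !Cmult_conj, !Cplus_conj, !Cmult_conj, !Cconj_R, Ezc, Ez, !E2, Etau.
    pose proof (Einv x) as Ix; pose proof (Einv y) as Iy.
    set (p := cexp (- tau * x)) in *; set (q := cexp (- tau * y)) in *.
    set (p' := cexp (tau * x)) in *; set (q' := cexp (tau * y)) in *.
    match type of Hid with ?l = ?m =>
      transitivity (p * p' * (kappa * r * p * q * l)); [simpl Cpow; ring|];
      rewrite Ix, Hid; transitivity (q * q' * (kappa * r * p * q * m));
      [rewrite Iy; ring | simpl Cpow; ring] end.
Qed.

(** The smooth coefficients are chosen before the extension [kt]: one pair must serve for all orders
    n, while the extension of the kernel may change with n. *)
Lemma listT_good (k b c : R -> C) : listT k b c ->
  exists bt ct : R -> C, (forall y, inI y -> b y = bt y) /\ (forall y, inI y -> c y = ct y) /\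
    forall kt, CC 2 kt -> (forall z, in2I z -> kt z = k z) -> good_operator bt ct kt.
Proof.
  intros (_ & _ & _ & Hh & _ & k0 & b0 & c0 & r & kappa & t & Hfam & Hr & _ & HT).
  cbv zeta in HT; destruct HT as (Hk & Hb & Hc).
  eexists; eexists; split; [exact Hb | split; [exact Hc|]].
  intros kt Hkt Hkk.
  assert (Hr' : RtoC r <> 0) by now apply RtoC_neq_0.
  (* Undoes the gauge on the whole line, so that [kt] is literally a gauge transform and not only on
     [-2,2]. *)
  pose (kt0 := fun z : R => / r * (kt z * cexp (- (Ci * t) * z))).
  assert (E1 : forall z : R, cexp (- (Ci * t) * z) * cexp (Ci * t * z) = 1).
  { intros z; rewrite <- cexp_plus, <- cexp_0; f_equal; ring. }
  assert (Ekt : kt = fun z : R => r * kt0 z * cexp (Ci * t * z)).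
  { apply fext; intros z; unfold kt0.
    transitivity (kt z * (cexp (- (Ci * t) * z) * cexp (Ci * t * z)) * (r * / r)).
    - rewrite E1, Cinv_r by assumption; ring.
    - ring. }
  assert (Hkt0 : CC 2 kt0) by (apply CC_scal, CC_mult; [assumption | apply cexp_smooth]).
  rewrite Ekt; apply gauge_good; [assumption|].
  apply (good_of_family k0); [assumption | assumption | |].
  - intros z Hz Hz0; unfold kt0; rewrite Hkk, Hk by (unfold in2I; lra).
    transitivity (k0 z * (cexp (- (Ci * t) * z) * cexp (Ci * t * z)) * (r * / r)).
    + ring.
    + rewrite E1, Cinv_r by assumption; ring.
  - unfold kt0; rewrite Hkk by (unfold in2I; lra).
    replace (- (Ci * t) * 0) with (RtoC 0) by ring.
    rewrite cexp_0, Cmult_1_r, Cmult_conj, <- Hh, Ropp_0 by (unfold in2I; lra).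
    rewrite <- RtoC_inv, Cconj_R by assumption; reflexivity.
Qed.

Lemma intI_inI x : intI x -> inI x.
Proof. unfold intI, inI; lra. Qed.

(** * The inner product on continuous functions *)

Lemma inner_agree (u u' v v' : R -> C) : agree u u' -> agree v v' -> inner u v = inner u' v'.
Proof.
  intros Hu Hv; apply cRInt_agree; intros x Hx; rewrite (Hu x Hx), (Hv x Hx); reflexivity.
Qed.

Lemma agree_on (u g : R -> C) : (forall x, (-1 <= x <= 1)%R -> g x = u x) -> agree u g.
Proof. intros H x Hx; symmetry; apply H, intI_inI, Hx. Qed.

Definition cont_fun (u : R -> C) : Prop := Cn_on 0 (-1) 1 u.

Lemma cont_fun_ext u : cont_fun u -> exists g, agree u g /\ CC 0 g.
Proof. intros H; apply Cn_on_iff in H; destruct H as [g [E H]]; exists g; split; auto using agree_on. Qed.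

Lemma CC_cont_fun u : CC 0 u -> cont_fun u.
Proof. intros H; apply Cn_on_iff; now exists u. Qed.

Lemma Cn_on_comb n a b u l v : Cn_on n a b u -> Cn_on n a b v -> Cn_on n a b (comb u l v).
Proof.
  rewrite !Cn_on_iff; intros [g [E H]] [h [E' H']].
  exists (comb g l h); split; [intros x Hx; unfold comb; now rewrite E, E'|].
  apply CC_plus; [assumption | now apply CC_scal].
Qed.

Lemma comb_agree u u' a v v' : agree u u' -> agree v v' -> agree (comb u a v) (comb u' a v').
Proof. intros Hu Hv x Hx; unfold comb; now rewrite Hu, Hv. Qed.

Lemma cont_subspace : subspace cont_fun.
Proof.
  split; [apply CC_cont_fun, (CC_const 0) | intros; now apply Cn_on_comb].
Qed.

Lemma inner_hermitian : hermitian cont_fun inner.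
Proof.
  split.
  - intros u a v w Hu Hv Hw.
    destruct (cont_fun_ext _ Hu) as (u' & Eu & Hu'), (cont_fun_ext _ Hv) as (v' & Ev & Hv'),
      (cont_fun_ext _ Hw) as (w' & Ew & Hw').
    rewrite (inner_agree _ _ _ _ (comb_agree _ _ a _ _ Eu Ev) Ew),
      (inner_agree _ _ _ _ Eu Ew), (inner_agree _ _ _ _ Ev Ew).
    pose proof (CC_conj 0 _ Hw') as Hwc; unfold inner.
    assert (Hp : forall f, CC 0 f -> CC 0 (fun y => f y * Cconj (w' y)))
      by (intros f Hf; exact (CC_mult 0 f (cconj w') Hf Hwc)).
    pose proof (Hp _ Hu') as Hpu; pose proof (Hp _ Hv') as Hpv.
    rewrite <- (cRInt_scal a _ _ _ Hpv), <- (cRInt_plus _ _ _ _ Hpu (CC_scal 0 a _ Hpv)).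
    f_equal; apply fext; intros x; unfold comb; ring.
  - intros u v Hu Hv.
    destruct (cont_fun_ext _ Hu) as (u' & Eu & Hu'), (cont_fun_ext _ Hv) as (v' & Ev & Hv').
    rewrite (inner_agree _ _ _ _ Eu Ev), (inner_agree _ _ _ _ Ev Eu); now apply inner_sym.
Qed.

Definition normsq (u : R -> C) (x : R) : R := (Re (u x) ^ 2 + Im (u x) ^ 2)%R.

Lemma normsq_cont u : CC 0 u -> cont_on_R (normsq u).
Proof.
  intros H x; destruct (H x) as [Hr Hi].
  apply (cont_plus (fun t => Re (u t) ^ 2)%R (fun t => Im (u t) ^ 2)%R).
  - apply (cont_mult (fun t => Re (u t)) (fun t => (Re (u t) * 1)%R)); [assumption|].
    apply cont_mult; [assumption | apply continuous_const].
  - apply (cont_mult (fun t => Im (u t)) (fun t => (Im (u t) * 1)%R)); [assumption|].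
    apply cont_mult; [assumption | apply continuous_const].
Qed.

Lemma inner_self u : CC 0 u -> Re (inner u u) = RInt (normsq u) (-1) 1.
Proof.
  intros H; unfold inner; rewrite cRInt_pair by (exact (CC_mult 0 u (cconj u) H (CC_conj 0 _ H))).
  apply RInt_ext; intros x _; unfold normsq, Re, Im; simpl.
  match goal with |- ?a = ?b => change (@eq R a b) end; ring.
Qed.

Lemma normsq_ge_0 u x : (0 <= normsq u x)%R.
Proof. unfold normsq; nra. Qed.

Lemma inner_psd : psd cont_fun inner.
Proof.
  intros u Hu; destruct (cont_fun_ext _ Hu) as (u' & Eu & Hu').
  rewrite (inner_agree _ _ _ _ Eu Eu), inner_self by assumption.
  apply RInt_ge_0; [lra | apply cont_ex_RInt, normsq_cont, Hu' | intros; apply normsq_ge_0].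
Qed.

(** The integral from -1 to t lies between 0 and the full integral, so it is constantly 0; its
    derivative is f. *)
Lemma RInt_zero_nonneg (f : R -> R) : cont_on_R f -> (forall x, (0 <= f x)%R) ->
  RInt f (-1) 1 = 0%R -> forall x, intI x -> f x = 0%R.
Proof.
  intros Hf Hp H0 x Hx.
  assert (Hz : forall t, intI t -> RInt f (-1) t = 0%R).
  { intros t [Ht1 Ht2].
    pose proof (RInt_Chasles (V := R_CompleteNormedModule) f (-1) t 1
      (cont_ex_RInt f _ _ Hf) (cont_ex_RInt f _ _ Hf)) as HC.
    change (RInt f (-1) t + RInt f t 1 = RInt f (-1) 1)%R in HC.
    assert (0 <= RInt f (-1) t)%R by (apply RInt_ge_0; [lra | now apply cont_ex_RInt | auto]).
    assert (0 <= RInt f t 1)%R by (apply RInt_ge_0; [lra | now apply cont_ex_RInt | auto]).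
    lra. }
  pose proof (RInt_plus_upper f x Hf) as Hd.
  rewrite <- (is_derive_unique _ _ _ Hd).
  rewrite (Derive_ext_loc _ (fun _ => 0%R)); [apply Derive_const|].
  now apply (locally_interval (-1) 1).
Qed.

Lemma inner_definite u : cont_fun u -> inner u u = 0 -> forall x, inI x -> u x = 0.
Proof.
  intros Hu H0; apply Cn_on_iff in Hu; destruct Hu as (u' & Eu & Hu').
  pose proof (agree_on _ _ Eu) as Ea.
  rewrite (inner_agree _ _ _ _ Ea Ea) in H0; apply (f_equal Re) in H0.
  rewrite inner_self in H0 by assumption.
  pose proof (RInt_zero_nonneg _ (normsq_cont _ Hu') (normsq_ge_0 u') H0) as Hz.
  intros x Hx; rewrite <- Eu by assumption.
  apply (CC_zero_closure u' (-1) 1); try assumption; [lra|].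
  intros t Ht; specialize (Hz t Ht); unfold normsq in Hz; apply C_ext; simpl; nra.
Qed.

(** * Eigenspaces of the convolution operator *)

Lemma inI_closure (f g : R -> C) : CC 0 f -> CC 0 g -> agree f g -> forall x, inI x -> f x = g x.
Proof. intros Hf Hg H x Hx; apply (CC_eq_closure f g (-1) 1); auto; lra. Qed.

Section Eigenspaces.
Variable k : R -> C.
Hypothesis Hks : smooth_on (-2) 2 k.

Lemma kernel_ext (n : nat) : exists kt, CC n kt /\ forall z, in2I z -> kt z = k z.
Proof. destruct (proj1 (Cn_on_iff n _ _ _) (Hks n)) as (kt & E & H); now exists kt. Qed.

Lemma conv_ext kt u ut x : (forall z, in2I z -> kt z = k z) -> agree u ut -> inI x ->
  conv k u x = conv kt ut x.
Proof.
  intros Hk Hu Hx; apply conv_agree; try assumption.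
  intros z Hz; symmetry; apply Hk; unfold in2I; lra.
Qed.

Lemma conv_comb u a v x : cont_fun u -> cont_fun v -> inI x ->
  conv k (comb u a v) x = conv k u x + a * conv k v x.
Proof.
  intros Hu Hv Hx.
  destruct (cont_fun_ext _ Hu) as (u' & Eu & Hu'), (cont_fun_ext _ Hv) as (v' & Ev & Hv').
  destruct (kernel_ext 0) as (kt & Hkt & Ek).
  rewrite (conv_ext kt _ _ x Ek (comb_agree _ _ a _ _ Eu Ev) Hx),
    (conv_ext kt _ _ x Ek Eu Hx), (conv_ext kt _ _ x Ek Ev Hx).
  pose proof (conv_integrand kt u' x Hkt Hu') as Hpu.
  pose proof (conv_integrand kt v' x Hkt Hv') as Hpv; unfold conv.
  rewrite <- (cRInt_scal a _ _ _ Hpv), <- (cRInt_plus _ _ _ _ Hpu (CC_scal 0 a _ Hpv)).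
  f_equal; apply fext; intros y; unfold comb; ring.
Qed.

Lemma in_eigenspace_ext lambda u v :
  in_eigenspace k lambda u -> (forall x, inI x -> v x = u x) -> in_eigenspace k lambda v.
Proof.
  intros (H0 & H1 & H2) E.
  assert (Hn : forall n, Cn_on n (-1) 1 u -> Cn_on n (-1) 1 v).
  { intros n (g & Eg & Hg); exists g; split; [|assumption].
    intros x Hx; rewrite E by assumption; now apply Eg. }
  split; [now apply Hn|]; split; [intros Hl n; now apply Hn, H1|].
  intros x Hx; rewrite E, <- H2 by assumption.
  apply conv_agree; [assumption | easy |]. intros y Hy; now apply E, intI_inI.
Qed.

Lemma in_eigenspace_comb lambda u a v :
  in_eigenspace k lambda u -> in_eigenspace k lambda v -> in_eigenspace k lambda (comb u a v).
Proof.
  intros (H0 & H1 & H2) (G0 & G1 & G2).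
  split; [now apply Cn_on_comb|]; split;
    [intros Hl n; apply Cn_on_comb; [apply (H1 Hl n) | apply (G1 Hl n)]|].
  intros x Hx; rewrite conv_comb, H2, G2 by assumption; unfold comb; ring.
Qed.

Lemma in_eigenspace_zero lambda : in_eigenspace k lambda zf.
Proof.
  assert (Hn : forall n, Cn_on n (-1) 1 zf)
    by (intros n; apply Cn_on_iff; exists zf; split; [easy | exact (CC_const n 0)]).
  split; [apply Hn|]; split; [intros _ n; apply Hn|]. intros x Hx.
  pose proof (conv_comb zf (-1) zf x (Hn O) (Hn O) Hx) as E.
  replace (comb zf (-1) zf) with zf in E by (apply fext; intros; unfold comb, zf; ring).
  rewrite E; unfold zf; ring.
Qed.

(** For lambda <> 0, u is K u divided by lambda and inherits the regularity of the kernel; for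
    lambda = 0 smoothness is part of the definition. *)
Lemma eigenspace_smooth lambda u : in_eigenspace k lambda u -> smooth_on (-1) 1 u.
Proof.
  intros (H0 & H1 & H2); destruct (Ceq_dec lambda 0) as [El|Hl]; [now apply H1|].
  intros n; apply Cn_on_iff.
  destruct (kernel_ext (S n)) as (kt & Hkt & Ek), (cont_fun_ext _ H0) as (ut & Eu & Hut).
  exists (fun x => / lambda * conv kt ut x); split.
  - intros x Hx; rewrite <- (conv_ext kt u ut x Ek Eu Hx), H2 by assumption.
    field; assumption.
  - apply CC_scal, conv_CC; assumption.
Qed.

Lemma smooth_ext (n : nat) u : smooth_on (-1) 1 u ->
  exists ut, CC n ut /\ forall x, inI x -> ut x = u x.
Proof. intros H; destruct (proj1 (Cn_on_iff n _ _ _) (H n)) as (g & E & Hg); now exists g. Qed.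

(** T is left abstract to cover both L^*L and the antilinear map u -> conj (L u). Linearity is
    replaced by commutation with the single scalar lambda, which the antilinear map satisfies when
    lambda is real. *)
Lemma eigenspace_invariant (T : (R -> C) -> R -> C) (kt : R -> C) lambda u ut :
  (forall n f, CC (4 + n) f -> CC n (T f)) ->
  (forall f g, agree f g -> agree (T f) (T g)) ->
  (forall f, CC 4 f -> agree (conv kt (T f)) (T (conv kt f))) ->
  (forall f, CC 4 f -> agree (T (fun x => lambda * f x)) (fun x => lambda * T f x)) ->
  CC 5 kt -> (forall z, in2I z -> kt z = k z) ->
  in_eigenspace k lambda u -> CC 4 ut -> (forall x, inI x -> ut x = u x) ->
  in_eigenspace k lambda (T ut).
Proof.
  intros TC Ta Tk Tl Hkt Ek Hu Hut Eu.
  assert (HT : CC 0 (T ut)) by now apply (TC O).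
  split; [now apply CC_cont_fun|]; split.
  - intros Hl n; apply Cn_on_iff.
    destruct (smooth_ext (4 + n) u (eigenspace_smooth _ _ Hu)) as (un & Hun & En).
    exists (T un); split; [|now apply TC].
    (* For each n another extension [un] of u is needed; its image under T agrees with that of [ut]
       on (-1,1), and by continuity at the end points. *)
    intros x Hx; apply inI_closure; try assumption; [eapply CC_0, TC, Hun|].
    apply Ta; intros t Ht; rewrite En, Eu by (now apply intI_inI); reflexivity.
  - intros x Hx; rewrite (conv_ext kt (T ut) (T ut) x Ek) by easy.
    apply (inI_closure (conv kt (T ut)) (fun x => lambda * T ut x)); try assumption.
    + apply conv_CC; [apply (CC_le 1 5); [lia | assumption] | assumption].
    + now apply (CC_scal 0).
    + intros t Ht; rewrite Tk, <- Tl by assumption.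
      apply Ta; [|assumption]; intros s Hs.
      rewrite <- (conv_ext kt u ut s Ek); [|now apply agree_on|now apply intI_inI].
      rewrite Eu by (now apply intI_inI). apply Hu, intI_inI, Hs.
Qed.

Lemma in_eigenspace_cont lambda u : in_eigenspace k lambda u -> cont_fun u.
Proof. now intros (H & _). Qed.

Hypothesis Hherm : forall z, in2I z -> k (- z)%R = Cconj (k z).

Lemma eigenvalue_real lambda u : eigenfunction k lambda u -> Cconj lambda = lambda.
Proof.
  intros [Hu (x & Hx & Hux)].
  pose proof (in_eigenspace_cont _ _ Hu) as Hc.
  destruct (cont_fun_ext _ Hc) as (ut & Eu & Hut), (kernel_ext 1) as (kt & Hkt & Ek).
  assert (Hn : inner u u <> 0) by (intros H0; apply Hux; now apply (inner_definite u)).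
  assert (E : inner (conv kt ut) ut = lambda * inner u u).
  { rewrite (inner_agree u ut u ut Eu Eu); unfold inner.
    rewrite <- cRInt_scal by exact (CC_mult 0 ut (cconj ut) Hut (CC_conj 0 _ Hut)).
    apply cRInt_agree; intros y Hy.
    rewrite <- (conv_ext kt u ut y Ek Eu) by now apply intI_inI.
    rewrite (proj2 (proj2 Hu)), (Eu y) by (try apply intI_inI; assumption); ring. }
  pose proof (inner_conv_real kt ut Hkt Hut) as Hr.
  rewrite E, Cmult_conj in Hr.
  rewrite <- (proj2 inner_hermitian u u Hc Hc) in Hr.
  apply Cmult_cancel with (inner u u); [assumption|].
  rewrite !(Cmult_comm (inner u u)); symmetry; apply Hr.
  intros z Hz; rewrite !Ek by (unfold in2I; lra). apply Hherm; unfold in2I; lra.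
Qed.

(* Summing Bessel's inequality for [y |-> conj (k (x - y))] and integrating in [x]
   bounds [n |lambda|^2] by the Hilbert-Schmidt norm of the kernel. *)
Lemma orthonormal_length (lambda : C) : lambda <> 0 -> exists N : nat, forall fs,
  List.Forall (in_eigenspace k lambda) fs -> orthonormal_for inner fs -> (length fs <= N)%nat.
Proof.
  intros Hl; destruct (kernel_ext 0) as (kt & Hkt & Ek).
  assert (HM : exists M, (0 <= M)%R /\ forall z, in2I z -> (normsq kt z <= M)%R).
  { destruct (continuity_ab_maj (normsq kt) (-2) 2) as (z0 & Hz0 & _); [lra| |].
    - intros z _; apply continuity_pt_filterlim, normsq_cont, Hkt.
    - exists (normsq kt z0); split; [apply normsq_ge_0 | exact Hz0]. }
  destruct HM as (M & HM0 & HM).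
  assert (Hl2 : (0 < Cmod lambda ^ 2)%R) by (apply pow_lt, Cmod_gt_0, Hl).
  (* The square of side 2 has area 4, so 4 M bounds the squared Hilbert-Schmidt norm. *)
  destruct (INR_unbounded (4 * M / Cmod lambda ^ 2)) as [N HN].
  exists N; intros fs Hfs Ho.
  assert (Hfc : List.Forall cont_fun fs)
    by (revert Hfs; apply Forall_impl; exact (in_eigenspace_cont lambda)).
  assert (HB : forall x, inI x ->
    (fold_right (fun f acc => acc + Cmod lambda ^ 2 * normsq f x)%R 0%R fs <= 2 * M)%R).
  { intros x Hx.
    (* Chosen so that the inner product of h with an eigenfunction f is conj (K f (x)) = conj
       (lambda f(x)). *)
    pose (h := fun y : R => Cconj (kt (x - y)%R)).
    assert (Hh : CC 0 h) by exact (CC_reflect 0 x (cconj kt) (CC_conj 0 _ Hkt)).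
    pose proof (bessel cont_fun inner cont_subspace inner_hermitian fs h inner_psd Hfc Ho
      (CC_cont_fun _ Hh)) as Hbes.
    rewrite inner_self in Hbes by assumption.
    assert (Hint : (RInt (normsq h) (-1) 1 <= 2 * M)%R).
    { replace (2 * M)%R with (RInt (fun _ => M) (-1) 1)
        by (rewrite RInt_const; change ((1 - -1) * M = 2 * M)%R; ring).
      apply RInt_le; [lra | apply cont_ex_RInt, normsq_cont, Hh | apply ex_RInt_const |].
      intros y Hy; unfold normsq, h; rewrite re_conj, im_conj.
      replace (Re (kt (x - y)%R) ^ 2 + (- Im (kt (x - y)%R)) ^ 2)%R with (normsq kt (x - y))
        by (unfold normsq; ring).
      apply HM; unfold in2I, inI in *; lra. }
    eapply Rle_trans; [|eapply Rle_trans; [exact Hbes | exact Hint]].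
    apply Req_le; clear - Hfs Hfc Hx Ek Hkt Hh.
    induction Hfs as [|f fs Hf Hfs IH]; cbn [fold_right]; [reflexivity|].
    inversion Hfc as [|? ? Hfc0 Hfc']; subst; rewrite IH by assumption; f_equal.
    assert (E : inner h f = Cconj (lambda * f x)).
    { rewrite (proj2 inner_hermitian) by (try assumption; now apply CC_cont_fun).
      f_equal. rewrite <- (proj2 (proj2 Hf)) by assumption.
      rewrite (conv_ext kt f f x Ek) by easy.
      apply cRInt_agree; intros y Hy; unfold h; rewrite Cconj_conj; ring. }
    rewrite E, Cmod_conj, Cmod_mult.
    assert (Em : (Cmod (f x) * Cmod (f x) = normsq f x)%R).
    { unfold Cmod; rewrite sqrt_sqrt by nra. unfold normsq, Re, Im; reflexivity. }
    rewrite <- Em; ring. }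
  (* The members of fs are controlled only on [-1,1]; g is a globally continuous version of the sum,
     which the integration lemmas require. *)
  assert (HI : exists g, cont_on_R g /\
    (forall x, intI x -> g x = fold_right (fun f acc => acc + Cmod lambda ^ 2 * normsq f x)%R 0%R fs)
    /\ RInt g (-1) 1 = (Cmod lambda ^ 2 * INR (length fs))%R).
  { destruct Ho as [_ Hn]; clear - Hfc Hn.
    induction Hfc as [|f fs Hf Hfc IH].
    - exists (fun _ => 0%R); split; [intros x; apply continuous_const|]; split; [easy|].
      rewrite RInt_const; change ((1 - -1) * 0 = Cmod lambda ^ 2 * 0)%R; ring.
    - inversion Hn as [|? ? Hn0 Hn']; subst; destruct (IH Hn') as (g & Hg & Eg & Ig).
      destruct (cont_fun_ext _ Hf) as (ft & Ef & Hft).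
      exists (fun x => g x + Cmod lambda ^ 2 * normsq ft x)%R; split; [|split].
      + intros x; apply (cont_plus g (fun x => Cmod lambda ^ 2 * normsq ft x)%R); [apply Hg|].
        apply cont_scal, normsq_cont, Hft.
      + intros x Hx; simpl fold_right; rewrite Eg by assumption.
        unfold normsq; now rewrite (Ef x Hx).
      + pose proof (normsq_cont _ Hft) as Hnc.
        rewrite (RInt_plus_cont g (fun x => Cmod lambda ^ 2 * normsq ft x)%R)
          by (try apply cont_scal; assumption).
        rewrite RInt_scal_cont, Ig, <- inner_self by assumption.
        rewrite <- (inner_agree _ _ _ _ Ef Ef), Hn0.
        simpl length; rewrite S_INR; simpl Re.
        match goal with |- ?a = ?b => change (@eq R a b) end; ring. }
  destruct HI as (g & Hg & Eg & Ig).
  assert (Hle : (RInt g (-1) 1 <= RInt (fun _ => 2 * M) (-1) 1)%R).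
  { apply RInt_le; [lra | now apply cont_ex_RInt | apply ex_RInt_const |].
    intros x Hx; rewrite Eg by exact Hx; apply HB, intI_inI, Hx. }
  rewrite Ig, RInt_const in Hle; change (scal (1 - -1)%R (2 * M)%R) with ((1 - -1) * (2 * M))%R in Hle.
  apply INR_le, Rlt_le; eapply Rle_lt_trans; [|exact HN].
  apply Rmult_le_reg_l with (Cmod lambda ^ 2)%R; [assumption|].
  replace (Cmod lambda ^ 2 * (4 * M / Cmod lambda ^ 2))%R with (4 * M)%R
    by (field; now apply Rgt_not_eq, Cmod_gt_0).
  eapply Rle_trans; [exact Hle|]; apply Req_le; ring.
Qed.

End Eigenspaces.

(** * Commutation and eigenfunctions *)

Lemma diffop_scal (b c u : R -> C) (a : C) : CC 1 b -> CC 2 u ->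
  diffop b c (fun t => a * u t) = fun x => a * diffop b c u x.
Proof.
  intros Hb Hu; apply fext; intros x.
  pose proof (CC_cder _ _ Hu) as Hu1; pose proof (CC_cder _ _ (CC_cDerive _ _ Hu)) as Hu2.
  pose proof (CC_scal 2 a u Hu) as Hau.
  rewrite !diffop_expand by assumption.
  rewrite (cder_unique _ _ (cder_scal a _ _ Hu1)), (cder_unique _ _ (cder_scal a _ _ Hu2)); ring.
Qed.

Lemma proj_sum (H : (R -> C) -> (R -> C) -> C) es u x :
  proj H es u x = fold_right Cplus 0 (map (fun e => H u e * e x) es).
Proof. induction es as [|e es IH]; simpl; [reflexivity|]. unfold comb; rewrite IH; ring. Qed.

Lemma inI_dec (x : R) : {inI x} + {~ inI x}.
Proof.
  unfold inI; destruct (Rle_dec (-1) x); [destruct (Rle_dec x 1)|]; (left; lra) || (right; lra).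
Qed.

Definition cut_off (u : R -> C) (x : R) : C := if inI_dec x then u x else 0.

Lemma cut_off_in u x : inI x -> cut_off u x = u x.
Proof. intros Hx; unfold cut_off; now destruct (inI_dec x). Qed.

Lemma cut_off_out u x : ~ inI x -> cut_off u x = 0.
Proof. intros Hx; unfold cut_off; now destruct (inI_dec x). Qed.

Section Main.
Variables k b c bt ct : R -> C.
Hypothesis Hks : smooth_on (-2) 2 k.
Hypothesis Hherm : forall z, in2I z -> k (- z)%R = Cconj (k z).
Hypothesis Eb : forall y, inI y -> b y = bt y.
Hypothesis Ec : forall y, inI y -> c y = ct y.
Hypothesis Hgood : forall kt, CC 2 kt -> (forall z, in2I z -> kt z = k z) ->
  good_operator bt ct kt.

(** The given coefficients b and c are known only on [-1,1]. The operators built from [bt] and [ct]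
    are smooth on the line and agree with the given ones on (-1,1); regularity and algebra are
    proved for them and transferred by [L_agree] and [LL_agree]. *)
Let LL (u : R -> C) : R -> C := diffop_adj b c (diffop b c u).
Let Lt (u : R -> C) : R -> C := diffop bt ct u.
Let LLt (u : R -> C) : R -> C := diffop_adj bt ct (diffop bt ct u).

Lemma operator_smooth : Csmooth bt /\ Csmooth ct /\ bt (-1)%R = 0 /\ bt 1%R = 0.
Proof.
  destruct (kernel_ext k Hks 2) as (kt & Hkt & Ek).
  destruct (Hgood kt Hkt Ek) as (? & ? & ? & ? & _); auto.
Qed.

Let Hb : Csmooth bt := proj1 operator_smooth.
Let Hc : Csmooth ct := proj1 (proj2 operator_smooth).
Let Hbm : bt (-1)%R = 0 := proj1 (proj2 (proj2 operator_smooth)).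
Let Hbp : bt 1%R = 0 := proj2 (proj2 (proj2 operator_smooth)).

Lemma good_kernel : exists kt, CC 5 kt /\ (forall z, in2I z -> kt z = k z) /\
  kernel_identity bt ct kt.
Proof.
  destruct (kernel_ext k Hks 5) as (kt & Hkt & Ek); exists kt; repeat (split; [assumption|]).
  apply Hgood; [apply (CC_le 2 5); [lia | assumption] | assumption].
Qed.

Lemma L_agree u ut : agree u ut -> agree (diffop b c u) (Lt ut).
Proof.
  apply diffop_agree; intros x Hx; [apply Eb | apply Ec]; now apply intI_inI.
Qed.

Lemma LL_agree u ut : agree u ut -> agree (LL u) (LLt ut).
Proof.
  intros H; unfold LL, LLt, diffop_adj.
  apply diffop_agree; [| |exact (L_agree _ _ H)]; apply agree_conj;
    intros x Hx; [apply Eb | apply Ec]; now apply intI_inI.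
Qed.

Lemma LLt_agree u v : agree u v -> agree (LLt u) (LLt v).
Proof.
  intros H; unfold LLt, diffop_adj.
  apply diffop_agree; [easy | easy |]; apply diffop_agree; easy.
Qed.

Lemma LLt_CC n f : CC (4 + n) f -> CC n (LLt f).
Proof. exact (LL_CC bt ct Hb Hc n f). Qed.

Lemma LLt_scal (a : C) f : CC 4 f -> LLt (fun x => a * f x) = fun x => a * LLt f x.
Proof.
  intros Hf; unfold LLt, diffop_adj.
  rewrite diffop_scal; [|apply Hb|apply (CC_le 2 4); [lia|assumption]].
  apply diffop_scal; [apply CC_conj, Hb | now apply (diffop_CC 2)].
Qed.

Lemma LLt_comb u a v : CC 4 u -> CC 4 v -> LLt (comb u a v) = comb (LLt u) a (LLt v).
Proof.
  intros Hu Hv.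
  assert (Hu2 : CC 2 u) by (apply (CC_le 2 4); [lia | assumption]).
  assert (Hv2 : CC 2 v) by (apply (CC_le 2 4); [lia | assumption]).
  unfold LLt, diffop_adj.
  replace (diffop bt ct (comb u a v)) with (comb (diffop bt ct u) a (diffop bt ct v)).
  - apply fext; intros x; unfold comb at 1.
    rewrite diffop_comb; [reflexivity | apply (CC_conj 1), Hb | |]; now apply (diffop_CC 2).
  - apply fext; intros x; unfold comb at 2; now rewrite diffop_comb.
Qed.

Lemma sesquicommute_K u : Cn_on 2 (-1) 1 u -> forall x, intI x ->
  conv (cconj k) (diffop b c u) x = diffop b c (conv k u) x.
Proof.
  intros Hu x Hx; apply Cn_on_iff in Hu; destruct Hu as (ut & Eu & Hut).
  apply agree_on in Eu; destruct good_kernel as (kt & Hkt & Ek & Hid).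
  rewrite (conv_agree (cconj k) (cconj kt) _ (Lt ut)); [| now apply intI_inI | |now apply L_agree].
  - unfold Lt; rewrite sesquicommute by assumption; symmetry; apply L_agree; [|assumption].
    intros t Ht; apply conv_ext; [assumption | assumption | now apply intI_inI].
  - intros z Hz; unfold cconj; rewrite Ek; [reflexivity | unfold in2I; lra].
Qed.

Lemma LL_commute_K u : Cn_on 4 (-1) 1 u -> forall x, intI x ->
  conv k (LL u) x = LL (conv k u) x.
Proof.
  intros Hu x Hx; apply Cn_on_iff in Hu; destruct Hu as (ut & Eu & Hut).
  apply agree_on in Eu; destruct good_kernel as (kt & Hkt & Ek & Hid).
  rewrite (conv_ext k kt _ (LLt ut)); [|assumption | now apply LL_agree | now apply intI_inI].
  unfold LLt; rewrite LL_commute by assumption; symmetry; apply LL_agree; [|assumption].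
  intros t Ht; apply conv_ext; [assumption | assumption | now apply intI_inI].
Qed.

Lemma LL_symmetric u v : Cn_on 4 (-1) 1 u -> Cn_on 4 (-1) 1 v ->
  inner (LL u) v = inner u (LL v).
Proof.
  intros Hu Hv; apply Cn_on_iff in Hu, Hv.
  destruct Hu as (ut & Eu & Hut), Hv as (vt & Ev & Hvt); apply agree_on in Eu, Ev.
  rewrite (inner_agree _ _ _ _ (LL_agree _ _ Eu) Ev), (inner_agree _ _ _ _ Eu (LL_agree _ _ Ev)).
  exact (LL_selfadjoint bt ct Hb Hc Hbm Hbp ut vt Hut Hvt).
Qed.

Lemma LLt_eigenspace lambda u ut : in_eigenspace k lambda u -> CC 4 ut ->
  (forall x, inI x -> ut x = u x) -> in_eigenspace k lambda (LLt ut).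
Proof.
  intros Hu Hut Eu; destruct good_kernel as (kt & Hkt & Ek & Hid).
  apply (eigenspace_invariant k Hks LLt kt lambda u ut); try assumption.
  - exact LLt_CC.
  - exact LLt_agree.
  - intros f Hf x Hx; exact (LL_commute bt ct kt Hb Hc Hkt Hbm Hbp Hid f x Hf Hx).
  - intros f Hf x _; now rewrite LLt_scal.
Qed.

(** K (conj (L u)) = conj (Kbar L u) = conj (L K u) = conj (lambda L u), and reality of lambda takes
    it out unchanged. *)
Lemma conj_L_eigenspace lambda u ut : Cconj lambda = lambda ->
  in_eigenspace k lambda u -> CC 4 ut ->
  (forall x, inI x -> ut x = u x) -> in_eigenspace k lambda (cconj (Lt ut)).
Proof.
  intros Hl Hu Hut Eu; destruct good_kernel as (kt & Hkt & Ek & Hid).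
  assert (H2 : forall f, CC 4 f -> CC 2 f) by (intros f Hf; apply (CC_le 2 4); [lia | assumption]).
  apply (eigenspace_invariant k Hks (fun f => cconj (Lt f)) kt lambda u ut); try assumption.
  - intros n f Hf; apply CC_conj, diffop_CC;
      [apply Hb | apply Hc | apply (CC_le _ (4 + n)); [lia | assumption]].
  - intros f g Hfg; now apply agree_conj, diffop_agree.
  - intros f Hf x Hx; rewrite <- (cconj_cconj kt) at 1.
    rewrite conv_conj.
    + unfold cconj at 2; f_equal; apply sesquicommute; auto.
    + apply (CC_conj 0); now apply CC_0 in Hkt.
    + apply (diffop_CC 0); auto.
  - intros f Hf x _; unfold cconj, Lt; rewrite diffop_scal by auto.
    now rewrite Cmult_conj, Hl.
Qed.

Lemma eigenspace_simple_LL (lambda : C) u :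
  eigenfunction k lambda u -> eigenspace_le1 k lambda -> exists nu, diff_eigenfunction LL nu u.
Proof.
  intros Hu H1; pose proof (eigenspace_smooth k Hks _ _ (proj1 Hu)) as Hsm.
  destruct (smooth_ext 4 u Hsm) as (ut & Hut & Eu).
  destruct (H1 u _ Hu (LLt_eigenspace _ _ _ (proj1 Hu) Hut Eu)) as [nu Hnu].
  exists nu; split; [assumption|]; split; [apply Hu|]; intros x Hx.
  rewrite (LL_agree u ut (agree_on _ _ Eu) x Hx); now apply Hnu, intI_inI.
Qed.

Lemma eigenspace_simple_L (lambda : C) u :
  eigenfunction k lambda u -> eigenspace_le1 k lambda ->
  exists sigma : C, forall x, intI x -> diffop b c u x = sigma * Cconj (u x).
Proof.
  intros Hu H1; pose proof (eigenspace_smooth k Hks _ _ (proj1 Hu)) as Hsm.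
  destruct (smooth_ext 4 u Hsm) as (ut & Hut & Eu).
  pose proof (eigenvalue_real k Hks Hherm _ _ Hu) as Hl.
  destruct (H1 u _ Hu (conj_L_eigenspace _ _ _ Hl (proj1 Hu) Hut Eu)) as [a Ha].
  (* Simplicity gives conj (L u) = a u, hence the conjugate of a as sigma. *)
  exists (Cconj a); intros x Hx.
  rewrite (L_agree u ut (agree_on _ _ Eu) x Hx), <- (Cconj_conj (Lt ut x)).
  change (Cconj (Lt ut x)) with (cconj (Lt ut) x).
  rewrite Ha by (now apply intI_inI). apply Cmult_conj.
Qed.

Lemma eigenspace_basis (lambda : C) : lambda <> 0 ->
  exists es, orthonormal es /\
    (forall e, In e es -> eigenfunction k lambda e /\ exists nu, diff_eigenfunction LL nu e) /\
    forall u, in_eigenspace k lambda u -> forall x, inI x ->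
      u x = fold_right Cplus 0 (map (fun e => inner u e * e x) es).
Proof.
  intros Hl.
  (* Normalising the values outside [-1,1] turns "equal on [-1,1]" into equality. *)
  set (E := fun u => in_eigenspace k lambda u /\ forall x, ~ inI x -> u x = 0).
  assert (HEs : forall u, E u -> smooth_on (-1) 1 u)
    by (intros u [Hu _]; eapply eigenspace_smooth; eassumption).
  assert (HEc : forall u, E u -> cont_fun u) by (intros u [Hu _]; eapply in_eigenspace_cont, Hu).
  assert (HE : subspace E).
  { split.
    - split; [now apply in_eigenspace_zero | reflexivity].
    - intros u a v [Hu Zu] [Hv Zv]; split; [now apply in_eigenspace_comb|].
      intros x Hx; unfold comb; rewrite Zu, Zv by assumption; ring. }
  assert (HG : hermitian E inner).
  { split; intros; apply inner_hermitian; now apply HEc. }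
  assert (Hpd : posdef E inner).
  { split; [intros u Hu; now apply inner_psd, HEc|].
    intros u Hu H0; apply fext; intros x; destruct (inI_dec x) as [Hx|Hx].
    - now apply inner_definite; [apply HEc| |].
    - now apply Hu. }
  assert (HB : hermitian E (fun u v => inner (LL u) v)).
  { split.
    - intros u a v w Hu Hv Hw.
      destruct (smooth_ext 4 u (HEs u Hu)) as (ut & Hut & Eu),
        (smooth_ext 4 v (HEs v Hv)) as (vt & Hvt & Ev).
      apply agree_on in Eu, Ev.
      assert (Ew : agree w w) by easy.
      rewrite (inner_agree _ _ _ _ (LL_agree _ _ (comb_agree _ _ a _ _ Eu Ev)) Ew).
      rewrite LLt_comb by assumption.
      rewrite (inner_agree _ _ _ _ (LL_agree _ _ Eu) Ew), (inner_agree _ _ _ _ (LL_agree _ _ Ev) Ew).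
      apply inner_hermitian; [| |now apply HEc]; apply CC_cont_fun; now apply (LLt_CC 0).
    - intros u v Hu Hv; rewrite LL_symmetric by (now apply HEs).
      destruct (smooth_ext 4 v (HEs v Hv)) as (vt & Hvt & Ev); apply agree_on in Ev.
      assert (Eu : agree u u) by easy.
      rewrite (inner_agree _ _ _ _ Eu (LL_agree _ _ Ev)), (inner_agree _ _ _ _ (LL_agree _ _ Ev) Eu).
      apply inner_hermitian; [now apply HEc | apply CC_cont_fun; now apply (LLt_CC 0)]. }
  destruct (orthonormal_length k Hks lambda Hl) as [N HN].
  destruct (hermitian_diagonalization E inner _ N HE HG Hpd HB) as (es & Hes & Ho & Hev & Hsp).
  { intros fs Hfs; apply HN; revert Hfs; apply Forall_impl; now intros u [Hu _]. }
  exists es; split; [exact Ho|]; split.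
  - intros e He; pose proof (proj1 (Forall_forall _ _) Hes e He) as HeE.
    assert (Hnz : nonzero_on_I e).
    { apply NNPP; intros Hno.
      assert (Ez : e = zf).
      { apply fext; intros x; destruct (inI_dec x) as [Hx|Hx]; [|now apply HeE].
        apply NNPP; intros Hx'; apply Hno; now exists x. }
      pose proof (proj1 (Forall_forall _ _) (proj2 Ho) e He) as H1.
      rewrite Ez, (form_zero E inner) in H1 by (try assumption; apply HE).
      apply (f_equal Re) in H1; simpl in H1; lra. }
    split; [split; [apply HeE | assumption]|].
    destruct (Hev e He) as [nu Hnu]; exists nu; split; [now apply HEs|]; split; [assumption|].
    destruct (smooth_ext 4 e (HEs e HeE)) as (et & Het & Ee).
    pose proof (agree_on _ _ Ee) as Ea.
    (* Diagonalising the form gives the eigenvalue equation only against vectors of the eigenspace.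
       As L^*L preserves that space, the defect L^*L e - nu e is itself an admissible test vector,
       so its norm is zero. *)
    pose proof (in_eigenspace_comb k Hks lambda _ (- nu) _
      (LLt_eigenspace _ _ _ (proj1 HeE) Het Ee) (proj1 HeE)) as Hd.
    set (d := comb (LLt et) (- nu) e) in Hd.
    set (w := cut_off d); pose proof (cut_off_in d : forall x, inI x -> w x = d x) as Ew.
    assert (HwE : E w).
    { split; [now apply in_eigenspace_ext with d | apply cut_off_out]. }
    assert (Hw0 : inner w w = 0).
    { assert (Ewd : agree w d) by (intros x Hx; now apply Ew, intI_inI).
      assert (Eww : agree w w) by easy.
      rewrite (inner_agree w d w w Ewd Eww); unfold d.
      rewrite (proj1 inner_hermitian); try now apply HEc.
      - assert (Eq : inner (LLt et) w = nu * inner e w).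
        { rewrite <- Hnu by assumption; apply inner_agree; [|easy].
          intros x Hx; symmetry; now apply LL_agree. }
        rewrite Eq; ring.
      - apply CC_cont_fun; now apply (LLt_CC 0). }
    intros x Hx; rewrite (LL_agree e et Ea x Hx).
    pose proof (inner_definite w (HEc w HwE) Hw0 x (intI_inI x Hx)) as Hz.
    rewrite Ew in Hz by now apply intI_inI. unfold d, comb in Hz.
    apply Ceq_minus; rewrite <- Hz; ring.
  - intros u Hu x Hx.
    set (w := cut_off u); pose proof (cut_off_in u : forall x, inI x -> w x = u x) as Ew.
    assert (HwE : E w).
    { split; [now apply in_eigenspace_ext with u | apply cut_off_out]. }
    rewrite <- Ew, (Hsp w HwE), proj_sum by assumption; f_equal; apply map_ext; intros e.
    f_equal; apply inner_agree; [|easy]; intros y Hy; now apply Ew, intI_inI.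
Qed.

End Main.

Theorem corollary3 :
  forall k b c : R -> C,
  listT k b c ->
  let K := conv k in
  let Kbar := conv (cconj k) in
  let L := diffop b c in
  let Lstar := diffop_adj b c in
  let LL := fun u : R -> C => Lstar (L u) in
  (* L sesquicommutes with K *)
  (forall u : R -> C, Cn_on 2 (-1) 1 u ->
     forall x : R, intI x -> Kbar (L u) x = L (K u) x) /\
  (* L^*L commutes with K *)
  (forall u : R -> C, Cn_on 4 (-1) 1 u ->
     forall x : R, intI x -> K (LL u) x = LL (K u) x) /\
  (* L^*L is formally self-adjoint *)
  (forall u v : R -> C, Cn_on 4 (-1) 1 u -> Cn_on 4 (-1) 1 v ->
     inner (LL u) v = inner u (LL v)) /\
  (* each eigenspace of K for a nonzero eigenvalue has a finite orthonormal
     basis of eigenfunctions of L^*L *)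
  (forall lambda : C, lambda <> 0 ->
     exists es : list (R -> C),
       orthonormal es /\
       (forall e : R -> C, List.In e es ->
          eigenfunction k lambda e /\
          exists nu : C, diff_eigenfunction LL nu e) /\
       (forall u : R -> C, in_eigenspace k lambda u ->
          forall x : R, inI x ->
            u x = fold_right Cplus 0 (map (fun e => inner u e * e x) es))) /\
  (* an eigenfunction of K is an eigenfunction of L^*L whenever its eigenspace
     is one-dimensional *)
  (forall (lambda : C) (u : R -> C),
     eigenfunction k lambda u -> eigenspace_le1 k lambda ->
     exists nu : C, diff_eigenfunction LL nu u) /\
  (* if all eigenspaces of K are one-dimensional, every eigenfunction solves
     L u = sigma conj(u) *)
  ((forall lambda : C, eigenspace_le1 k lambda) ->
     forall (lambda : C) (u : R -> C), eigenfunction k lambda u ->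
       smooth_on (-1) 1 u /\
       exists sigma : C, forall x : R, intI x -> L u x = sigma * Cconj (u x)).
Proof.
  intros k b c HT K Kbar L Lstar LL.
  destruct (listT_good k b c HT) as (bt & ct & Eb & Ec & Hgood).
  destruct HT as (Hks & _ & _ & Hherm & _ & _).
  split; [exact (sesquicommute_K k b c bt ct Hks Eb Ec Hgood)|].
  split; [exact (LL_commute_K k b c bt ct Hks Eb Ec Hgood)|].
  split; [exact (LL_symmetric k b c bt ct Hks Eb Ec Hgood)|].
  split; [exact (eigenspace_basis k b c bt ct Hks Eb Ec Hgood)|].
  split; [exact (eigenspace_simple_LL k b c bt ct Hks Eb Ec Hgood)|].
  intros H1 lambda u Hu; split; [exact (eigenspace_smooth k Hks _ _ (proj1 Hu))|].
  exact (eigenspace_simple_L k b c bt ct Hks Hherm Eb Ec Hgood lambda u Hu (H1 lambda)).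
Qed.
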